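(* Let $\Sigma_\Lambda=\{\Sigma_\lambda=(\gamma_\lambda,f_\lambda,g_\lambda)\}_{\lambda\in\Lambda}$ be a parametrized family of impulsive systems with inputs (with $\Lambda$ an arbitrary nonempty index set) that is strongly ISS. Suppose that there exist functions $\tilde\varphi_f,\tilde\varphi_g,\eta_f,\eta_g,\varphi_f,\varphi_g\in\mathcal{K}_\infty$ and nondecreasing continuous functions $N_f,N_g,O_f,O_g,P_f,P_g:\mathbb{R}_{\ge 0}\to\mathbb{R}_{\ge 0}$ such that, for all $\lambda\in\Lambda$, $t\ge 0$, $\xi,\xi_1,\xi_2\in\mathbb{R}^n$, $\mu,\mu_1,\mu_2\in\mathbb{R}^m$, $$|f_\lambda(t,\xi,\mu_1)-f_\lambda(t,\xi,\mu_2)|\le\tilde\varphi_f(|\mu_1-\mu_2|)\big[N_f(|\xi|)+O_f(\min\{|\mu_1|,|\mu_2|\})\big],$$ $$|f_\lambda(t,\xi_1,\mu)-f_\lambda(t,\xi_2,\mu)|\le\eta_f(|\xi_1-\xi_2|)\big[P_f(\min\{|\xi_1|,|\xi_2|\})+\varphi_f(|\mu|)\big],$$ $$|g_\lambda(t,\xi,\mu_1)-g_\lambda(t,\xi,\mu_2)|\le\tilde\varphi_g(|\mu_1-\mu_2|)\big[N_g(|\xi|)+O_g(\min\{|\mu_1|,|\mu_2|\})\big],$$ $$|g_\lambda(t,\xi_1,\mu)-g_\lambda(t,\xi_2,\mu)|\le\eta_g(|\xi_1-\xi_2|)\big[P_g(\min\{|\xi_1|,|\xi_2|\})+\varphi_g(|\mu|)\big],$$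 and such that, in addition, there is a continuous nondecreasing function $L^f:\mathbb{R}_{\ge 0}\to\mathbb{R}_{\ge 0}$, with $L^f(M)>0$ for $M>0$, satisfying $\eta_f(s)\le L^f(M)\,s$ for all $M\ge 0$ and all $0\le s\le M$. Then $\Sigma_\Lambda$ is strongly iISS.
   Context: Function classes. $\alpha\in\mathcal{K}$ if $\alpha:\mathbb{R}_{\ge 0}\to\mathbb{R}_{\ge 0}$ is continuous, strictly increasing and $\alpha(0)=0$; $\alpha\in\mathcal{K}_\infty$ if in addition $\alpha$ is unbounded. $\beta\in\mathcal{KL}$ if $\beta:\mathbb{R}_{\ge 0}\times\mathbb{R}_{\ge 0}\to\mathbb{R}_{\ge 0}$, $\beta(\cdot,t)\in\mathcal{K}_\infty$ for every $t\ge 0$, and for each fixed $r\ge 0$, $\beta(r,t)$ decreases monotonically to $0$ as $t\to\infty$. $|\cdot|$ is the Euclidean norm. Impulsive systems. $\Gamma$ is the set of impulse-time sequences $\gamma=\{\tau_k\}_{k=1}^N\subset(0,\infty)$, $N$ finite (possibly $\gamma=\emptyset$) or $N=\infty$, strictly increasing and with no finite limit point; $\gamma$ is also regarded as a set. $\mathcal{U}$ is the set of inputs, i.e. Lebesgue measurable, locally essentially bounded functions $u:[0,\infty)\to\mathbb{R}^m$. An impulsive system with inputs $\Sigma=(\gamma,f,g)$ is given by $$\dot x(t)=f(t,x(t),u(t))\ \text{ for } t\notin\gamma,\qquad x(t)=x(t^-)+g(t,x(t^-),u(t))\ \text{ for } t\in\gamma,$$ where $\gamma\in\Gamma$, $f,g:\mathbb{R}_{\ge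 0}\times\mathbb{R}^n\times\mathbb{R}^m\to\mathbb{R}^n$, $f(t,0,0)=0$ and $g(t,0,0)=0$ for all $t\ge 0$; moreover $f(t,\xi,\mu)$ is Lebesgue measurable in $t$, continuous in $(\xi,\mu)$, and for every compact interval $I\subset\mathbb{R}_{\ge 0}$ and compact $K\subset\mathbb{R}^n\times\mathbb{R}^m$ there is an integrable $m:I\to\mathbb{R}$ with $|f(t,\xi,\mu)|\le m(t)$ on $I\times K$. The dimensions $n,m$ are the same for all members of a family. Solutions. A solution of $\Sigma$ with initial time $t_0\ge 0$, initial state $x_0\in\mathbb{R}^n$ and input $u\in\mathcal{U}$ is a function $x:[t_0,T_x)\to\mathbb{R}^n$ such that: $x(t_0)=x_0$; $x$ is locally absolutely continuous on each interval $J=[t_1,t_2)\subset[t_0,T_x)$ with no points of $\gamma$ in its interior, with $\dot x(t)=f(t,x(t),u(t))$ for almost all $t\in J$; and for every $t\in\gamma\cap(t_0,T_x)$ the left limit $x(t^-)$ exists, is finite, and $x(t)=x(t^-)+g(t,x(t^-),u(t))$. It is maximally defined if no other solution $y:[t_0,T_y)\to\mathbb{R}^n$ has $T_y>T_x$ and coincides with $x$ on $[t_0,T_x)$. $\mathcal{T}_\Sigma(t_0,x_0,u)$ denotes the set of maximally defined solutions. Norms. For an interval $I\subset[0,\infty)$, $n^\gamma_I:=\#(\gamma\cap I)$. For $u\in\mathcal{U}$ and $\rho_1,\rho_2\in\mathcal{K}_\infty$, $$\|u_I\|_{\infty,\gamma}:=\max\Big\{\operatorname{ess\,sup}_{t\in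 I}|u(t)|,\ \sup_{t\in\gamma\cap I}|u(t)|\Big\},\qquad \|u_I\|_{\rho_1,\rho_2,\gamma}:=\int_I\rho_1(|u(s)|)\,ds+\sum_{s\in\gamma\cap I}\rho_2(|u(s)|)$$ (the supremum over the empty set being $0$). Stability. A family $\Sigma_\Lambda=\{\Sigma_\lambda=(\gamma_\lambda,f_\lambda,g_\lambda)\}_{\lambda\in\Lambda}$ is: - strongly ISS if there exist $\beta\in\mathcal{KL}$, $\rho\in\mathcal{K}_\infty$ such that $|x(t)|\le\beta\big(|x_0|,t-t_0+n^{\gamma_\lambda}_{(t_0,t]}\big)+\rho\big(\|u_{(t_0,t]}\|_{\infty,\gamma_\lambda}\big)$; - strongly iISS if there exist $\beta\in\mathcal{KL}$, $\alpha,\rho_1,\rho_2\in\mathcal{K}_\infty$ such that $\alpha(|x(t)|)\le\beta\big(|x_0|,t-t_0+n^{\gamma_\lambda}_{(t_0,t]}\big)+\|u_{(t_0,t]}\|_{\rho_1,\rho_2,\gamma_\lambda}$; in each case for all $\lambda\in\Lambda$, $t_0\ge 0$, $x_0\in\mathbb{R}^n$, $u\in\mathcal{U}$, $x\in\mathcal{T}_{\Sigma_\lambda}(t_0,x_0,u)$ and $t\in[t_0,T_x)$. *)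

(* Defs.v *)
From HB Require Import structures.
From mathcomp Require Import all_boot all_order all_algebra finmap.
From mathcomp Require Import all_classical all_reals all_analysis ess_sup_inf.

Set Implicit Arguments.
Unset Strict Implicit.
Unset Printing Implicit Defensive.
Import Order.TTheory GRing.Theory Num.Theory.
Import numFieldNormedType.Exports.

Local Open Scope classical_set_scope.
Local Open Scope ring_scope.

(* The library's `measurable` on R is Borel.  The real line with the
   Lebesgue-measurable (Caratheodory) sets is the carrier type of
   completed_lebesgue_measure. *)
Notation lebesgueR R := (caratheodory_type (@wlength R idfun)^*%mu).
Notation leb := completed_lebesgue_measure.

(* Functions on R_{>=0} are represented by total functions on R that are only
   constrained on [0, +oo[. *)
Notation Rge0 R := (`[(0 : R), +oo[%classic).

(* The library norm on 'rV[R]_n is the sup norm. *)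
Definition enorm (R : realType) (n : nat) (x : 'rV[R]_n) : R :=
  Num.sqrt (\sum_(i < n) x ord0 i ^+ 2).

(* Domain and codomain are explicit: inference would pick the Borel
   sigma-algebra on R. *)
Definition lebesgue_measurable_fun (R : realType) (n : nat) (D : set R)
    (f : R -> 'rV[R]_n) : Prop :=
  @measurable_fun _ _ (lebesgueR R)
    (g_sigma_algebraType (@open 'rV[R]_n)) D f.

Section function_classes.
Context {R : realType}.

Definition class_K (a : R -> R) : Prop :=
  [/\ {within Rge0 R, continuous a},
      {in `[0, +oo[ &, {homo a : r s / r < s}} &
      a 0 = 0].

Definition class_Kinfty (a : R -> R) : Prop :=
  class_K a /\ (forall M : R, exists2 r, 0 <= r & M < a r).

Definition class_KL (b : R -> R -> R) : Prop :=
  (forall t, 0 <= t -> class_Kinfty (fun r => b r t)) /\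
  (forall r, 0 <= r ->
     {in `[0, +oo[ &, {homo b r : s t / s <= t >-> t <= s}} /\
     b r t @[t --> +oo] --> (0 : R)).

Definition nondecreasing_continuous (N : R -> R) : Prop :=
  [/\ {within Rge0 R, continuous N},
      {in `[0, +oo[ &, {homo N : r s / r <= s}} &
      forall r, 0 <= r -> 0 <= N r].

End function_classes.

Section impulsive_systems.
Context {R : realType}.

(* N = Some p is a sequence of length p (p = 0: no impulse), N = None an
   infinite sequence; tau is indexed from 0. *)
Definition impulse_times (gamma : set R) : Prop :=
  exists (N : option nat) (tau : nat -> R),
    let I := if N is Some p then `I_p else [set: nat] in
    [/\ forall k, I k -> 0 < tau k,
        forall j k, I j -> I k -> (j < k)%N -> tau j < tau k,
        limit_point gamma = set0 &
        gamma = tau @` I].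

Definition is_input (m : nat) (u : R -> 'rV[R]_m) : Prop :=
  lebesgue_measurable_fun (Rge0 R) u /\
  (forall b : R, 0 <= b -> exists M : R,
     \forall t \ae leb, t \in `[0, b] -> enorm (u t) <= M).

Record impulsive_system (n m : nat) := ImpulsiveSystem {
  impulses : set R;
  flow : R -> 'rV[R]_n -> 'rV[R]_m -> 'rV[R]_n;
  jump : R -> 'rV[R]_n -> 'rV[R]_m -> 'rV[R]_n;
  impulsesP : impulse_times impulses;
  flow0 : forall t, 0 <= t -> flow t 0 0 = 0;
  jump0 : forall t, 0 <= t -> jump t 0 0 = 0;
  flow_measurable : forall xi mu,
    lebesgue_measurable_fun (Rge0 R) (fun t => flow t xi mu);
  flow_continuous : forall t, 0 <= t ->
    continuous (fun p : 'rV[R]_n * 'rV[R]_m => flow t p.1 p.2);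
  flow_bounded : forall (a b : R) (K : set ('rV[R]_n * 'rV[R]_m)%type),
    0 <= a -> compact K ->
    exists M : R -> R, leb.-integrable `[a, b]%classic (EFin \o M) /\
      (forall t xi mu, t \in `[a, b] -> K (xi, mu) ->
         enorm (flow t xi mu) <= M t)
}.

Definition absolutely_continuous (n : nat) (a b : R) (x : R -> 'rV[R]_n) :=
  forall e : R, 0 < e -> exists2 d : R, 0 < d &
    forall (p : nat) (s r : 'I_p -> R),
      (forall i, a <= s i /\ s i <= r i /\ r i <= b) ->
      trivIset setT (fun i => `]s i, r i[%classic) ->
      \sum_(i < p) (r i - s i) < d ->
      \sum_(i < p) enorm (x (r i) - x (s i)) < e.

Definition locally_absolutely_continuous (n : nat) (J : set R)
    (x : R -> 'rV[R]_n) :=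
  forall a b : R, a <= b -> `[a, b]%classic `<=` J ->
    absolutely_continuous a b x.

(* [a, T[ for a possibly infinite T *)
Definition itvco_ext (a : R) (T : \bar R) : set R :=
  [set t | a <= t /\ (t%:E < T)%E].

(* A solution x : [t0, Tx[ -> R^n is a pair of a total function and Tx; the
   values of x outside [t0, Tx[ are irrelevant. *)
Definition is_solution (n m : nat) (S : impulsive_system n m)
    (t0 : R) (x0 : 'rV[R]_n) (u : R -> 'rV[R]_m)
    (x : R -> 'rV[R]_n) (Tx : \bar R) : Prop :=
  [/\ (t0%:E < Tx)%E,
      x t0 = x0,
      forall (t1 : R) (t2 : \bar R),
        t0 <= t1 -> (t1%:E < t2)%E -> (t2 <= Tx)%E ->
        (forall t, t1 < t -> (t%:E < t2)%E -> ~ impulses S t) ->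
        locally_absolutely_continuous (itvco_ext t1 t2) x /\
        (\forall t \ae leb, itvco_ext t1 t2 t ->
           is_derive (t : R) (1 : R) x (flow S t (x t) (u t))) &
      forall t, impulses S t -> t0 < t -> (t%:E < Tx)%E ->
        exists2 l : 'rV[R]_n, x s @[s --> t^'-] --> l &
          x t = l + jump S t l (u t)].

Definition is_maximal_solution (n m : nat) (S : impulsive_system n m)
    (t0 : R) (x0 : 'rV[R]_n) (u : R -> 'rV[R]_m)
    (x : R -> 'rV[R]_n) (Tx : \bar R) : Prop :=
  is_solution S t0 x0 u x Tx /\
  ~ (exists (y : R -> 'rV[R]_n) (Ty : \bar R),
       [/\ is_solution S t0 x0 u y Ty, (Tx < Ty)%E &
           forall t, itvco_ext t0 Tx t -> y t = x t]).

(* #(gamma `&` I); gamma `&` I is finite for the bounded I used below *)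
Definition impulse_count (gamma I : set R) : nat :=
  #|` fset_set (gamma `&` I)|.

(* The restriction \_ I extends |u| by 0 outside I, and the supremum over
   gamma `&` I is taken together with 0: both suprema are 0 on empty sets. *)
Definition input_sup_norm (m : nat) (u : R -> 'rV[R]_m) (I gamma : set R) :
    \bar R :=
  maxe (ess_sup leb (EFin \o ((fun s => enorm (u s)) \_ I)))
       (ereal_sup (0%E |` [set (enorm (u s))%:E | s in gamma `&` I])).

Definition input_int_norm (rho1 rho2 : R -> R) (m : nat)
    (u : R -> 'rV[R]_m) (I gamma : set R) : \bar R :=
  (\int[leb]_(s in I) (rho1 (enorm (u s)))%:E +
   \esum_(s in gamma `&` I) (rho2 (enorm (u s)))%:E)%E.

(* `fine` is harmless: the norm of an input over ]t0, t] is finite. *)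
Definition strongly_ISS (Lambda : Type) (n m : nat)
    (Sigma : Lambda -> impulsive_system n m) : Prop :=
  exists (beta : R -> R -> R) (rho : R -> R),
    [/\ class_KL beta, class_Kinfty rho &
      forall (lam : Lambda) (t0 : R) (x0 : 'rV[R]_n) (u : R -> 'rV[R]_m)
        (x : R -> 'rV[R]_n) (Tx : \bar R) (t : R),
        0 <= t0 -> is_input u ->
        is_maximal_solution (Sigma lam) t0 x0 u x Tx ->
        itvco_ext t0 Tx t ->
        let I := `]t0, t]%classic in
        let gamma := impulses (Sigma lam) in
        enorm (x t) <=
          beta (enorm x0) (t - t0 + (impulse_count gamma I)%:R) +
          rho (fine (input_sup_norm u I gamma))].

Definition strongly_iISS (Lambda : Type) (n m : nat)
    (Sigma : Lambda -> impulsive_system n m) : Prop :=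
  exists (beta : R -> R -> R) (alpha rho1 rho2 : R -> R),
    [/\ class_KL beta, class_Kinfty alpha, class_Kinfty rho1,
        class_Kinfty rho2 &
      forall (lam : Lambda) (t0 : R) (x0 : 'rV[R]_n) (u : R -> 'rV[R]_m)
        (x : R -> 'rV[R]_n) (Tx : \bar R) (t : R),
        0 <= t0 -> is_input u ->
        is_maximal_solution (Sigma lam) t0 x0 u x Tx ->
        itvco_ext t0 Tx t ->
        let I := `]t0, t]%classic in
        let gamma := impulses (Sigma lam) in
        ((alpha (enorm (x t)))%:E <=
          (beta (enorm x0) (t - t0 + (impulse_count gamma I)%:R))%:E +
          input_int_norm rho1 rho2 u I gamma)%E].

End impulsive_systems.

(* Main.v *)
(* The proof compares a solution x under u with the ISS solution y, from the same
   initial state, under the input truncated at a radius c. Over a window of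
   bounded hybrid time (time plus number of impulses) Gronwall's inequality, and
   the moduli of g at the finitely many impulses, keep |x - y| small as soon as
   the integral of tphif(|u|) and the terms tphig(|u|) over {|u| > c} are small;
   if rho(c) is small compared with l and the window is long enough, x thus drops
   from the ball of radius L to the ball of radius l without leaving a larger
   ball. Multiplying tphif and tphig by one rapidly growing factor S gives gains
   rho1, rho2 for which an energy at most k makes the tails beyond every radius
   j >= k negligible. Chaining windows, energy at most s then drives x from any
   ball into a ball of radius M(s), uniformly, with M(s) -> 0 as s -> 0. Inverting
   M gives alpha with alpha(|x|) <= max(|x0|, energy), and the remaining decay of
   alpha(|x|) - energy is majorized by a KL function. *)

(* The detour through truncated inputs is forced by the hypothesis: the ISS gain acts on the
   supremum of the input, which a small energy does not bound. The truncated input has supremum at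
   most c, but its solution y must first be constructed, since ISS only estimates maximal solutions
   and promises no global one. Picard iteration and Zorn's lemma provide y, and the ISS estimate
   itself rules out blow-up. Flow and jumps behave differently: [etaf] is linearly bounded on
   bounded sets and enters Gronwall's inequality, whereas [etag] is an arbitrary modulus that can be
   iterated only a bounded number of times. This is why windows are measured in hybrid time. The
   energy is not divided among the windows: each is charged with the whole of it, so that any number
   of windows can be chained. All constants come from beta, rho and the moduli, never from lambda,
   the initial time or the solution, and this makes the chained times uniform. *)
Require Import Defs.
From HB Require Import structures.
From mathcomp Require Import all_boot all_order all_algebra finmap.
From mathcomp Require Import all_classical all_reals all_analysis ess_sup_inf.
From mathcomp Require Import measurable_realfun ring lra.

Set Implicit Arguments.
Unset Strict Implicit.
Unset Printing Implicit Defensive.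
Import Order.TTheory GRing.Theory Num.Theory.
Import numFieldNormedType.Exports.

Local Open Scope classical_set_scope.
Local Open Scope ring_scope.

(** * Euclidean norm *)

Section enorm_theory.
Context {R : realType}.
Implicit Types n : nat.

Lemma enorm_ge0 n (x : 'rV[R]_n) : 0 <= enorm x.
Proof. exact: sqrtr_ge0. Qed.

Lemma sqr_enorm n (x : 'rV[R]_n) : enorm x ^+ 2 = \sum_(i < n) x ord0 i ^+ 2.
Proof. by rewrite sqr_sqrtr// sumr_ge0// => i _; exact: sqr_ge0. Qed.

Lemma enorm0 n : enorm (0 : 'rV[R]_n) = 0.
Proof. by rewrite /enorm big1 ?sqrtr0// => i _; rewrite mxE expr0n. Qed.

Lemma enormN n (x : 'rV[R]_n) : enorm (- x) = enorm x.
Proof. by congr Num.sqrt; apply: eq_bigr => i _; rewrite mxE sqrrN. Qed.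

Lemma enormB n (x y : 'rV[R]_n) : enorm (x - y) = enorm (y - x).
Proof. by rewrite -enormN opprB. Qed.

Lemma enormZ n (a : R) (x : 'rV[R]_n) : enorm (a *: x) = `|a| * enorm x.
Proof.
rewrite /enorm -sqrtr_sqr -sqrtrM ?sqr_ge0//; congr Num.sqrt.
by rewrite mulr_sumr; apply: eq_bigr => i _; rewrite mxE exprMn.
Qed.

Lemma le_enorm n (x y : 'rV[R]_n) :
  (forall i, `|x ord0 i| <= `|y ord0 i|) -> enorm x <= enorm y.
Proof.
move=> xy; rewrite /enorm ler_sqrt; last first.
  by rewrite sumr_ge0// => i _; exact: sqr_ge0.
apply: ler_sum => i _.
by rewrite -[leLHS]real_normK ?num_real// -[leRHS]real_normK ?num_real//;
  rewrite lerXn2r// ?nnegrE.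
Qed.

Lemma coord_le_enorm n (x : 'rV[R]_n) i : `|x ord0 i| <= enorm x.
Proof.
rewrite -sqrtr_sqr /enorm ler_sqrt; last first.
  by rewrite sumr_ge0// => j _; exact: sqr_ge0.
by rewrite (bigD1 i)//= lerDl sumr_ge0// => j _; exact: sqr_ge0.
Qed.

Lemma enorm_eq0 n (x : 'rV[R]_n) : enorm x = 0 -> x = 0.
Proof.
move=> x0; apply/rowP => i; rewrite mxE; apply/normr0_eq0/eqP.
by rewrite eq_le normr_ge0 andbT -x0 coord_le_enorm.
Qed.

(** Sum the squares of |y| x_i - |x| y_i and divide by 2 |x| |y|; the vectors of norm zero are split
    off because of this division. *)
Lemma cauchy_schwarz n (x y : 'rV[R]_n) :
  \sum_(i < n) x ord0 i * y ord0 i <= enorm x * enorm y.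
Proof.
have [x0|x0] := eqVneq (enorm x) 0.
  by rewrite x0 mul0r (enorm_eq0 x0) big1// => i _; rewrite mxE mul0r.
have [y0|y0] := eqVneq (enorm y) 0.
  by rewrite y0 mulr0 (enorm_eq0 y0) big1// => i _; rewrite mxE mulr0.
have {}x0 : 0 < enorm x by rewrite lt_neqAle eq_sym x0 enorm_ge0.
have {}y0 : 0 < enorm y by rewrite lt_neqAle eq_sym y0 enorm_ge0.
suff : 2 * (enorm x * enorm y) * (\sum_(i < n) x ord0 i * y ord0 i) <=
       2 * (enorm x * enorm y) * (enorm x * enorm y).
  by rewrite ler_pM2l// mulr_gt0// mulr_gt0.
have -> : 2 * (enorm x * enorm y) * (enorm x * enorm y) =
    \sum_(i < n) ((enorm y * x ord0 i) ^+ 2 + (enorm x * y ord0 i) ^+ 2).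
  rewrite big_split/=; under eq_bigr do rewrite exprMn.
  under [X in _ + X]eq_bigr do rewrite exprMn.
  by rewrite -!mulr_sumr -!sqr_enorm; ring.
rewrite mulr_sumr; apply: ler_sum => i _.
rewrite -subr_ge0; set l := (X in 0 <= X).
suff -> : l = (enorm y * x ord0 i - enorm x * y ord0 i) ^+ 2 by exact: sqr_ge0.
by rewrite /l; ring.
Qed.

Lemma ler_enormD n (x y : 'rV[R]_n) : enorm (x + y) <= enorm x + enorm y.
Proof.
rewrite -(@ler_pXn2r _ 2)// ?nnegrE ?addr_ge0 ?enorm_ge0//.
have -> : enorm (x + y) ^+ 2 =
    enorm x ^+ 2 + enorm y ^+ 2 + 2 * \sum_(i < n) x ord0 i * y ord0 i.
  rewrite !sqr_enorm mulr_sumr -!big_split/=; apply: eq_bigr => i _.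
  by rewrite mxE; ring.
by have := cauchy_schwarz x y; rewrite sqrrD; lra.
Qed.

Lemma ler_enormB n (x y : 'rV[R]_n) : enorm (x - y) <= enorm x + enorm y.
Proof. by rewrite (le_trans (ler_enormD _ _))// enormN. Qed.

Lemma ler_enorm_dist n (x y : 'rV[R]_n) : `|enorm x - enorm y| <= enorm (x - y).
Proof.
rewrite ler_norml; apply/andP; split.
  by have := ler_enormD (y - x) x; rewrite subrK enormB; lra.
by have := ler_enormD (x - y) y; rewrite subrK; lra.
Qed.

Lemma ler_enorm_distD n (z x y : 'rV[R]_n) :
  enorm (x - y) <= enorm (x - z) + enorm (z - y).
Proof. by rewrite (le_trans _ (ler_enormD _ _))// addrA subrK. Qed.

Lemma ler_enorm_sum n (x : 'rV[R]_n) : enorm x <= \sum_(i < n) `|x ord0 i|.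
Proof.
have s0 : 0 <= \sum_(i < n) `|x ord0 i| by exact: sumr_ge0.
rewrite -(@ler_pXn2r _ 2)// ?nnegrE ?enorm_ge0// sqr_enorm expr2 mulr_suml.
apply: ler_sum => i _; rewrite -real_normK ?num_real// expr2 ler_wpM2l//.
by rewrite (bigD1 i)//= lerDl sumr_ge0.
Qed.

(** With [norm_le_enorm] this is the equivalence of the two norms, by which limits and derivatives
    taken in the sup norm are transferred to [enorm]. *)
Lemma enorm_le_norm n (x : 'rV[R]_n) : enorm x <= n%:R * `|x|.
Proof.
rewrite (le_trans (ler_enorm_sum x))//.
rewrite -[in n%:R](card_ord n) mulr_natl -sumr_const; apply: ler_sum => i _.
rewrite [leRHS]/Num.Def.normr/= mx_normrE.
exact: (le_bigmax _ (fun i => `|x i.1 i.2|) (ord0, i)).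
Qed.

Lemma norm_le_enorm n (x : 'rV[R]_n) : `|x| <= enorm x.
Proof.
rewrite [leLHS]/Num.Def.normr/= mx_normrE; apply: bigmax_le => [|[i j] _/=].
  exact: enorm_ge0.
by rewrite ord1 coord_le_enorm.
Qed.

Lemma enorm_continuous n : continuous (@enorm R n).
Proof.
move=> x; apply/(@cvgrPdist_le _ _ _ (nbhs x) (nbhs_filter x)) => e e0.
(* [n.+1] instead of [n] keeps the radius positive in dimension 0. *)
have n1 : 0 < n.+1%:R :> R by rewrite ltr0n.
apply/nbhs_ballP; exists (e / n.+1%:R); first by rewrite /= divr_gt0.
move=> y; rewrite -ball_normE /= => /ltW; rewrite ler_pdivlMr// mulrC => xy.
rewrite (le_trans (ler_enorm_dist _ _))// (le_trans (enorm_le_norm _))//.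
by rewrite (le_trans _ xy)// ler_wpM2r// ler_nat.
Qed.

End enorm_theory.

Section derivative_estimates.
Context {R : realType}.

Lemma is_derive_dist (V : normedModType R) (f : R -> V) (t : R) (l : V) :
  is_derive t (1 : R) f l -> forall e, 0 < e -> exists2 d, 0 < d &
    forall q, `|q - t| < d -> `|f q - f t - (q - t) *: l| <= e * `|q - t|.
Proof.
move=> [dfl <-] e e0; have := dfl; rewrite /derivable => /cvgrPdist_le.
move=> /(_ e e0)[d/= d0 dl]; exists d => // q qt.
have [->|qneqt] := eqVneq q t; first by rewrite !subrr scale0r subrr !normr0 mulr0.
have qt0 : q - t != 0 by rewrite subr_eq0.
have := dl (q - t); rewrite /ball_/= sub0r normrN => /(_ qt qt0).
rewrite [_ *: 1]mulr1 subrK => H.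
have -> : f q - f t - (q - t) *: 'D_1 f t =
    (q - t) *: ((q - t)^-1 *: (f q - f t) - 'D_1 f t).
  by rewrite scalerBr scalerKV.
by rewrite normrZ mulrC ler_wpM2r// distrC.
Qed.

End derivative_estimates.

(** * Absolutely continuous curves and Gronwall estimates *)

Section tagged_partitions.
Context {R : realType}.

(** Cousin's lemma: every gauge on [a, b] admits a fine partition. Near the supremum of the points
    reachable by such partitions one more interval can be appended, which passes the supremum unless
    it is b. *)
Lemma cousin (P : R -> R -> Prop) (a b : R) : a <= b ->
  (forall t, a <= t -> t <= b -> exists2 d, 0 < d &
     forall p q, a <= p -> p <= t -> t <= q -> q <= b -> q - p < d -> P p q) ->
  exists (p : nat -> R) (N : nat), [/\ p 0%N = a, p N = b,
     {homo p : i j / (i <= j)%N >-> i <= j} &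
     forall i, (i < N)%N -> P (p i) (p i.+1)].
Proof.
move=> ab gauge.
pose reach x := exists (p : nat -> R) (N : nat), [/\ p 0%N = a, p N = x,
     {homo p : i j / (i <= j)%N >-> i <= j} &
     forall i, (i < N)%N -> P (p i) (p i.+1)].
suff : reach b by [].
pose S := [set x | a <= x /\ x <= b /\ reach x].
have Sa : S a by split => //; split => //; exists (fun=> a), 0%N; split.
have hS : has_sup S by split; [exists a|exists b => x [_ []]].
have aS : a <= sup S by apply: ub_le_sup => //; case: hS.
have Sb : sup S <= b by apply: ge_sup; [exists a|move=> x [_ []]].
have [d d0 Pd] := gauge _ aS Sb.
have [x [ax [xb [p [N [p0 pN pm PN]]]]] sx] := sup_adherent (divr_gt0 d0 (ltr0Sn R 1)) hS.
have xs : x <= sup S.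
  apply: ub_le_sup; first by case: hS.
  by split => //; split => //; exists p, N.
(* x is less than d / 2 below the supremum and y at most d / 3 above it, so y - x < d. *)
pose y := Num.min b (sup S + d / 3).
have sy : sup S <= y by rewrite le_min Sb lerDl divr_ge0 // ltW.
have yb : y <= b by rewrite ge_min lexx.
have Pxy : P x y.
  apply: Pd => //.
  have : y <= sup S + d / 3 by rewrite ge_min lexx orbT.
  lra.
have xy : x <= y by exact: le_trans sy.
have Ry : reach y.
  exists (fun i => if (i <= N)%N then p i else y), N.+1; split.
  - by [].
  - by rewrite ltnn.
  - move=> i j ij; case: ifPn => iN; case: ifPn => jN //.
    + exact: pm.
    + by rewrite (le_trans _ xy)// -pN; exact: pm.
    + by move: iN; rewrite (leq_trans ij jN).
  - move=> i; rewrite ltnS => iN; rewrite iN.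
    by case: ifPn => [iN'|]; [exact: PN|rewrite -ltnNge ltnS => Ni];
      rewrite (_ : i = N) ?pN//; apply/eqP; rewrite eqn_leq iN Ni.
suff <- : y = b by [].
apply/eqP; rewrite eq_le yb/=.
have : y <= sup S.
  apply: ub_le_sup; first by case: hS.
  by split; [exact: le_trans xy|split].
by rewrite {1}/y ge_min => /orP[bs|]; [exact: le_trans sy|lra].
Qed.

End tagged_partitions.

Section absolute_continuity.
Context {R : realType}.

(** Scalar counterpart of [absolutely_continuous], for functions such as the norm of a curve. *)
Definition real_ac (a b : R) (f : R -> R) :=
  forall e : R, 0 < e -> exists2 d : R, 0 < d &
    forall (p : nat) (s r : 'I_p -> R),
      (forall i, a <= s i /\ s i <= r i /\ r i <= b) ->
      trivIset setT (fun i => `]s i, r i[%classic) ->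
      \sum_(i < p) (r i - s i) < d ->
      \sum_(i < p) `|f (r i) - f (s i)| < e.

Lemma real_ac_enorm n a b (z : R -> 'rV[R]_n) :
  absolutely_continuous a b z -> real_ac a b (fun t => enorm (z t)).
Proof.
move=> zac e e0; have [d d0 zd] := zac e e0; exists d => // p s r sr tsr srd.
apply: le_lt_trans (zd p s r sr tsr srd).
by apply: ler_sum => i _; exact: ler_enorm_dist.
Qed.

Lemma real_ac_lip a b (f : R -> R) (K : R) :
  (forall s t, a <= s -> s <= t -> t <= b -> `|f t - f s| <= K * (t - s)) ->
  real_ac a b f.
Proof.
move=> fK e e0; exists (e / (`|K| + 1)); first by rewrite divr_gt0// ltr_wpDl.
move=> p s r sr tsr; rewrite ltr_pdivlMr ?ltr_wpDl// mulrC; apply: le_lt_trans.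
rewrite mulr_sumr; apply: ler_sum => i _; have [asi [sri rib]] := sr i.
rewrite (le_trans (fK _ _ asi sri rib))// ler_wpM2r ?subr_ge0//.
by rewrite (le_trans (ler_norm _))// lerDl.
Qed.

Lemma ac_lip n a b (f : R -> 'rV[R]_n) (K : R) :
  (forall s t, a <= s -> s <= t -> t <= b ->
     enorm (f t - f s) <= K * (t - s)) ->
  absolutely_continuous a b f.
Proof.
move=> fK e e0; exists (e / (`|K| + 1)); first by rewrite divr_gt0// ltr_wpDl.
move=> p s r sr tsr; rewrite ltr_pdivlMr ?ltr_wpDl// mulrC; apply: le_lt_trans.
rewrite mulr_sumr; apply: ler_sum => i _; have [asi [sri rib]] := sr i.
rewrite (le_trans (fK _ _ asi sri rib))// ler_wpM2r ?subr_ge0//.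
by rewrite (le_trans (ler_norm _))// lerDl.
Qed.

Lemma real_acB a b (f g : R -> R) : real_ac a b f -> real_ac a b g ->
  real_ac a b (fun t => f t - g t).
Proof.
move=> fac gac e e0; have e20 : 0 < e / 2 by rewrite divr_gt0.
have [d1 d10 fd] := fac _ e20; have [d2 d20 gd] := gac _ e20.
exists (Num.min d1 d2); first by rewrite lt_min d10.
move=> p s r sr tsr; rewrite lt_min => /andP[sd1 sd2].
rewrite (splitr e); apply: le_lt_trans (ltrD (fd _ _ _ sr tsr sd1) (gd _ _ _ sr tsr sd2)).
rewrite -big_split/=; apply: ler_sum => i _.
rewrite (_ : _ - _ - _ = (f (r i) - f (s i)) - (g (r i) - g (s i))); last by ring.
exact: ler_normB.
Qed.

Lemma acB n a b (f g : R -> 'rV[R]_n) :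
  absolutely_continuous a b f -> absolutely_continuous a b g ->
  absolutely_continuous a b (fun t => f t - g t).
Proof.
move=> fac gac e e0; have e20 : 0 < e / 2 by rewrite divr_gt0.
have [d1 d10 fd] := fac _ e20; have [d2 d20 gd] := gac _ e20.
exists (Num.min d1 d2); first by rewrite lt_min d10.
move=> p s r sr tsr; rewrite lt_min => /andP[sd1 sd2].
rewrite (splitr e); apply: le_lt_trans (ltrD (fd _ _ _ sr tsr sd1) (gd _ _ _ sr tsr sd2)).
rewrite -big_split/=; apply: ler_sum => i _.
rewrite (_ : _ - _ - _ = (f (r i) - f (s i)) - (g (r i) - g (s i))).
  by rewrite ler_enormB.
by rewrite !opprD !opprK addrACA.
Qed.

Lemma real_acM_lip a b (f g : R -> R) (C K : R) :
  (forall t, a <= t -> t <= b -> `|f t| <= C) ->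
  (forall t, a <= t -> t <= b -> `|g t| <= 1) ->
  (forall s t, a <= s -> s <= t -> t <= b -> `|g t - g s| <= K * (t - s)) ->
  real_ac a b f -> real_ac a b (fun t => f t * g t).
Proof.
move=> fC g1 gK fac e e0; have e20 : 0 < e / 2 by rewrite divr_gt0.
have [d1 d10 fd] := fac _ e20.
have /real_ac_lip/(_ _ e20)[d2 d20 gd] : forall s t, a <= s -> s <= t -> t <= b ->
    `|C * g t - C * g s| <= `|C| * K * (t - s).
  move=> s t ? ? ?; rewrite -mulrBr normrM -mulrA ler_wpM2l//; exact: gK.
exists (Num.min d1 d2); first by rewrite lt_min d10.
move=> p s r sr tsr; rewrite lt_min => /andP[sd1 sd2].
rewrite (splitr e); apply: le_lt_trans (ltrD (fd _ _ _ sr tsr sd1) (gd _ _ _ sr tsr sd2)).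
rewrite -big_split/=; apply: ler_sum => i _; have [asi [sri rib]] := sr i.
rewrite (_ : f (r i) * g (r i) - f (s i) * g (s i) =
  (f (r i) - f (s i)) * g (r i) + f (s i) * (g (r i) - g (s i))); last by ring.
rewrite (le_trans (ler_normD _ _))// lerD//.
  by rewrite normrM ler_piMr// g1// (le_trans asi).
rewrite -mulrBr !normrM ler_wpM2r// (le_trans (fC _ _ _))//.
  by rewrite (le_trans sri).
exact: ler_norm.
Qed.

Lemma ac_sub n a b c d (f : R -> 'rV[R]_n) : a <= c -> d <= b ->
  absolutely_continuous a b f -> absolutely_continuous c d f.
Proof.
move=> ac db fac e e0; have [D D0 fD] := fac _ e0; exists D => // p s r sr.
by apply: fD => i; have [? [? ?]] := sr i; split; [|split] => //;
  [exact: le_trans ac _|exact: le_trans db].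
Qed.

Lemma eq_ac n a b (f g : R -> 'rV[R]_n) :
  (forall t, a <= t -> t <= b -> f t = g t) ->
  absolutely_continuous a b f -> absolutely_continuous a b g.
Proof.
move=> fg fac e e0; have [D D0 fD] := fac _ e0; exists D => // p s r sr tsr srD.
rewrite (le_lt_trans _ (fD _ _ _ sr tsr srD))//; apply: ler_sum => i _.
have [asi [sri rib]] := sr i.
by rewrite !fg// ?(le_trans asi)// (le_trans sri).
Qed.

(** Clipping all endpoints at c splits a family of intervals in [a, b] into one in [a, c] and one in
    [c, b], neither of greater total length. If c lies outside [a, b], one of the hypotheses already
    covers the whole interval. *)
Lemma ac_cat n a c b (f : R -> 'rV[R]_n) :
  absolutely_continuous a c f -> absolutely_continuous c b f ->
  absolutely_continuous a b f.
Proof.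
move=> fac fcb e e0; have e20 : 0 < e / 2 by rewrite divr_gt0.
have [d1 d10 f1] := fac _ e20; have [d2 d20 f2] := fcb _ e20.
exists (Num.min d1 d2); first by rewrite lt_min d10.
move=> p s r sr tsr; rewrite lt_min => /andP[sd1 sd2].
have [ac|ca] := leP a c; last first.
  rewrite (lt_trans (f2 p s r _ tsr sd2))//; last by lra.
  by move=> i; have [? [? ?]] := sr i; split; [lra|].
have [cb|bc] := leP c b; last first.
  rewrite (lt_trans (f1 p s r _ tsr sd1))//; last by lra.
  by move=> i; have [? [? ?]] := sr i; split => //; split => //; lra.
have triv (s' r' : 'I_p -> R) :
    (forall i, `]s' i, r' i[%classic `<=` `]s i, r i[%classic) ->
    trivIset setT (fun i => `]s' i, r' i[%classic).
  move=> sub i j _ _ [x [xi xj]]; apply: (tsr i j) => //.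
  by exists x; split; exact: sub.
have {}f1 : \sum_(i < p) enorm (f (Num.min (r i) c) - f (Num.min (s i) c)) < e / 2.
  apply: f1.
  - move=> i; have [? [? ?]] := sr i.
    by rewrite /Num.min; case: ltP => ?; case: ltP => ?; split; lra.
  - apply: triv => i x /=; rewrite !in_itv/= => /andP[].
    rewrite lt_min gt_min => /orP[-> /andP[->]//|cx /andP[_ xc]].
    by have := lt_trans cx xc; rewrite ltxx.
  - apply: le_lt_trans sd1; apply: ler_sum => i _; have [? [? ?]] := sr i.
    by rewrite /Num.min; case: ltP => ?; case: ltP => ?; lra.
have {}f2 : \sum_(i < p) enorm (f (Num.max (r i) c) - f (Num.max (s i) c)) < e / 2.
  apply: f2.
  - move=> i; have [? [? ?]] := sr i.
    by rewrite /Num.max; case: ltP => ?; case: ltP => ?; split; lra.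
  - apply: triv => i x /=; rewrite !in_itv/= => /andP[].
    rewrite gt_max lt_max => /andP[-> cx] /orP[->//|xc].
    by have := lt_trans cx xc; rewrite ltxx.
  - apply: le_lt_trans sd2; apply: ler_sum => i _; have [? [? ?]] := sr i.
    by rewrite /Num.max; case: ltP => ?; case: ltP => ?; lra.
rewrite (splitr e); apply: le_lt_trans (ltrD f1 f2).
rewrite -big_split/=; apply: ler_sum => i _; have [? [sri ?]] := sr i.
have [rc|cr] := leP (r i) c.
  rewrite (min_idPl (le_trans sri rc)) (max_idPr (le_trans sri rc)).
  by rewrite subrr enorm0 addr0.
have [sc|cs] := leP (s i) c; first by rewrite addrC ler_enorm_distD.
by rewrite subrr enorm0 add0r.
Qed.

End absolute_continuity.

Section ae_derivative_estimates.
Context {R : realType}.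
Notation mu := (@lebesgue_measure R).

Lemma ae_leb_impl (P Q : R -> Prop) : (forall t, P t -> Q t) ->
  (\forall t \ae leb, P t) -> \forall t \ae leb, Q t.
Proof.
by move=> PQ; apply: negligibleS => t /= nQ Pt; exact/nQ/PQ.
Qed.

Lemma ae_leb_and (P Q : R -> Prop) : (\forall t \ae leb, P t) ->
  (\forall t \ae leb, Q t) -> \forall t \ae leb, P t /\ Q t.
Proof. exact: (@filterI _ _ (ae_filter_ringOfSetsType (@leb R))). Qed.

Lemma negligible_set1 (c : R) : (@leb R).-negligible [set c].
Proof.
apply/negligibleP; first by apply: sub_caratheodory; exact: measurable_set1.
by have := @lebesgue_measure_set1 R c.
Qed.

Lemma ae_leb_neq (c : R) : \forall t \ae leb, t != c.
Proof.
by apply: negligibleS (negligible_set1 c) => t /= /negP; rewrite negbK => /eqP.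
Qed.

Lemma negligible_open_cover (N : set R) (e : R) :
  (@leb R).-negligible N -> 0 < e ->
  exists U : set R, [/\ open U, N `<=` U & (mu U < e%:E)%E].
Proof.
move=> [A [mA A0 NA]] e0; have e20 : 0 < e / 2 by rewrite divr_gt0.
have [U [oU AU UAe]] := @outer_measure_open_le R A _ e20.
exists U; split => //; first exact: subset_trans AU.
apply: (le_lt_trans UAe).
rewrite [X in (X + _)%E](_ : _ = 0%E); last by rewrite -A0.
by rewrite add0e lte_fin ltr_pdivrMr// ltr_pMr// ltr1n.
Qed.

(* Off a null set the increments are controlled by the derivative; on the
   partition intervals covering the null set, by absolute continuity. *)
Lemma ac_nonincreasing (a b : R) (f : R -> R) : a <= b -> real_ac a b f ->
  (\forall t \ae leb, a < t < b -> forall e, 0 < e -> exists2 d, 0 < d &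
     forall p q, a <= p -> p <= t -> t <= q -> q <= b -> q - p < d ->
       f q - f p <= e * (q - p)) ->
  f b <= f a.
Proof.
move=> ab fac aef; set good := (X in \forall t \ae leb, X t) in aef.
apply/ler_addgt0Pr => e e0.
(* The intervals of slope at most e1 contribute at most e / 2 in total; the other half is left for
   the null set. *)
pose e1 := e / 2 / (b - a + 1).
have e10 : 0 < e1 by rewrite !divr_gt0// ltr_wpDl// subr_ge0.
have e20 : 0 < e / 2 by rewrite divr_gt0.
have [d d0 fd] := fac _ e20.
(* The endpoints join the null set, since the derivative is controlled at interior points only. *)
have negN : (@leb R).-negligible (~` [set t | good t] `|` ([set a] `|` [set b])).
  by apply: negligibleU => //; apply: negligibleU; exact: negligible_set1.
have [U [oU NU Ud]] := negligible_open_cover negN d0.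
pose P p q := `[p, q]%classic `<=` U \/ f q - f p <= e1 * (q - p).
have [|p [N [p0 pN pm PN]]] := @cousin R P a b ab.
  move=> t at_ tb.
  have [Ut|NUt] := pselect (U t).
    have [D D0 DU] := (nbhs_ballP _ _).1 (open_nbhs_nbhs (conj oU Ut)).
    exists D => // p q ap pt tq qb qpD; left => x /=.
    rewrite in_itv/= => /andP[px xq]; apply: DU.
    by rewrite /ball/= ltr_norml; apply/andP; split; lra.
  have gt : good t by apply: contrapT => ngt; apply: NUt; apply: NU; left.
  have ta : a < t.
    rewrite lt_neqAle at_ andbT; apply/eqP => at'; apply: NUt; apply: NU.
    by right; left; rewrite at'.
  have tb' : t < b.
    rewrite lt_neqAle tb andbT; apply/eqP => at'; apply: NUt; apply: NU.
    by right; right; rewrite at'.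
  have [|D D0 DP] := gt _ e1 e10; first by rewrite ta.
  by exists D => // p q *; right; exact: DP.
have apb i : (i <= N)%N -> a <= p i <= b.
  by move=> iN; rewrite -p0 -pN !pm.
(* Intervals not contained in U are collapsed to a point; the remaining ones are disjoint and inside
   U, so their total length is below d. *)
pose r i := if `[< `[p i, p i.+1]%classic `<=` U >] then p i.+1 else p i.
have pr i : p i <= r i by rewrite /r; case: ifP => _ //; exact: pm.
have rp i : r i <= p i.+1 by rewrite /r; case: ifP => _ //; exact: pm.
have tr : trivIset setT (fun i : 'I_N => `]p i, r i[%classic).
  move=> i j _ _ [x [/=]]; rewrite !in_itv/= => /andP[pix xri] /andP[pjx xrj].
  apply/val_inj/eqP; rewrite /= eqn_leq; apply/andP; split; rewrite leqNgt; apply/negP.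
  - by move=> /pm; have := rp j; lra.
  - by move=> /pm; have := rp i; lra.
have lenU : \sum_(i < N) (r i - p i) < d.
  rewrite -lte_fin (le_lt_trans _ Ud)//.
  rewrite -sumEFin (eq_bigr (fun i : 'I_N => mu `]p i, r i[%classic)); last first.
    move=> i _; rewrite lebesgue_measure_itv/= lte_fin.
    case: ltP => //; rewrite le_eqVlt ltNge pr orbF => /eqP ->.
    by rewrite subrr.
  rewrite -(@measure_bigsetU_ord _ _ _ mu N xpredT)//.
  apply: le_measure; rewrite ?inE.
  - by apply: bigsetU_measurable => i _; exact: measurable_itv.
  - exact: open_measurable.
  - rewrite -(bigcup_mkord N (fun i => `]p i, r i[%classic)).
    move=> x [i _] /=.
    rewrite /r; case: ifPn => [/asboolP pU|_]; rewrite in_itv/= => /andP[p1 p2].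
      by apply: pU; rewrite /= in_itv/= !ltW.
    by have := lt_trans p1 p2; rewrite ltxx.
have step i : (i < N)%N ->
    f (p i.+1) - f (p i) <= e1 * (p i.+1 - p i) + `|f (r i) - f (p i)|.
  move=> iN; have le0 : 0 <= e1 * (p i.+1 - p i).
    by rewrite mulr_ge0// ?(ltW e10)// subr_ge0 pm.
  rewrite /r; case: ifPn => [_|/asboolP nU].
    by rewrite (le_trans (ler_norm _))// lerDr.
  by rewrite subrr normr0 addr0; case: (PN i iN).
have sumd : \sum_(i < N) `|f (r i) - f (p i)| < e / 2.
  apply: (fd N (fun i => p i) (fun i => r i)) => // i.
  have /andP[ap _] := apb i (ltnW (ltn_ord i)).
  have /andP[_ pb] := apb i.+1 (ltn_ord i).
  by split => //; split => //; exact: le_trans (rp i) pb.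
have : f (p N) - f (p 0%N) <= e1 * (p N - p 0%N) + \sum_(i < N) `|f (r i) - f (p i)|.
  rewrite -(telescope_sumr (fun i => f (p i)))// -(telescope_sumr p)// !big_mkord.
  rewrite mulr_sumr -big_split/=.
  by apply: ler_sum => i _; exact: step.
rewrite p0 pN => H.
have : e1 * (b - a) <= e / 2.
  rewrite /e1 mulrAC ler_pdivrMr ?ltr_wpDl ?subr_ge0//.
  by rewrite ler_wpM2l ?(ltW e20)// lerDl.
lra.
Qed.

(** The straddle lemma. The tag t of a partition interval [p, q] need not be an endpoint, so
    increments must be estimated across t. *)
Lemma is_derive_straddle (V : normedModType R) (f : R -> V) (t : R) (l : V) :
  is_derive t (1 : R) f l -> forall e, 0 < e -> exists2 d, 0 < d &
    forall p q, p <= t -> t <= q -> q - p < d ->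
      `|f q - f p - (q - p) *: l| <= e * (q - p).
Proof.
move=> fl e e0; have [d d0 fd] := is_derive_dist fl e0; exists d => // p q pt tq qp.
have [p0 q0] : `|p - t| < d /\ `|q - t| < d.
  by split; rewrite ltr_norml; apply/andP; split; lra.
have -> : f q - f p - (q - p) *: l =
    (f q - f t - (q - t) *: l) - (f p - f t - (p - t) *: l).
  have -> : (q - p) *: l = (q - t) *: l - (p - t) *: l.
    by rewrite -scalerBl; congr (_ *: _); ring.
  move: ((q - t) *: l) ((p - t) *: l) (f q) (f p) (f t) => X Y x y z.
  by rewrite [in RHS]opprD opprK addrACA [- X + Y]addrC -(opprB X Y)
    [- (y - z)]opprB addrA subrK.
rewrite (le_trans (ler_normB _ _))// (le_trans (lerD (fd _ q0) (fd _ p0)))//.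
by rewrite -mulrDr ger0_norm ?subr_ge0// ler0_norm ?subr_le0// opprB subrKA.
Qed.

Lemma is_derive_straddle_enorm n (z : R -> 'rV[R]_n) (t : R) (w : 'rV[R]_n) :
  is_derive t (1 : R) z w -> forall e, 0 < e -> exists2 d, 0 < d &
    forall p q, p <= t -> t <= q -> q - p < d ->
      enorm (z q - z p - (q - p) *: w) <= e * (q - p).
Proof.
move=> zw e e0; have n1 : 0 < n.+1%:R :> R by rewrite ltr0n.
have [d d0 zd] := is_derive_straddle zw (divr_gt0 e0 n1).
exists d => // p q pt tq qp.
rewrite (le_trans (enorm_le_norm _))//.
rewrite (le_trans (ler_wpM2r (normr_ge0 _) (_ : n%:R <= n.+1%:R)))//.
  by rewrite ler_nat.
have := zd _ _ pt tq qp.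
by rewrite mulrAC ler_pdivlMr// mulrC.
Qed.

(** [ac_nonincreasing] is applied to |z(t)| exp(-A(t - a)) - G(t): the exponential absorbs A |z|
    and, being at most 1, leaves at most g, which G absorbs. The norm, not differentiable at 0, is
    never differentiated; its increments over straddling intervals are estimated instead. *)
Lemma gronwall n (a b A C K : R) (z : R -> 'rV[R]_n) (G : R -> R) :
  a <= b -> 0 <= A -> absolutely_continuous a b z ->
  (forall t, a <= t -> t <= b -> enorm (z t) <= C) ->
  (forall s t, a <= s -> s <= t -> t <= b -> `|G t - G s| <= K * (t - s)) ->
  (\forall t \ae leb, a < t < b -> exists w g,
     [/\ is_derive (t : R) (1 : R) z w, is_derive (t : R) (1 : R) G g, 0 <= g &
         enorm w <= A * enorm (z t) + g]) ->
  enorm (z b) * expR (- A * (b - a)) - G b <= enorm (z a) - G a.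
Proof.
move=> ab A0 zac zC GK aez.
pose E t := expR (- A * (t - a)).
have Eqp p q : A * (q - p) * E q <= E p - E q.
  have := expR_ge1Dx (A * (q - p)).
  rewrite -(ler_pM2r (expR_gt0 (- A * (q - a)))) -expRD -/(E q).
  rewrite (_ : A * (q - p) + - A * (q - a) = - A * (p - a)); last by ring.
  by rewrite -/(E p) mulrDl mul1r; lra.
have E1 t : a <= t -> `|E t| <= 1.
  move=> at_; rewrite ger0_norm ?expR_ge0// -expR0 ler_expR mulNr oppr_le0.
  by rewrite mulr_ge0// subr_ge0.
have EK s t : a <= s -> s <= t -> t <= b -> `|E t - E s| <= A * (t - s).
  move=> as_ st tb; rewrite distrC ger0_norm; last first.
    rewrite (le_trans _ (Eqp s t))// mulr_ge0 ?expR_ge0// mulr_ge0// subr_ge0//.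
  have := E1 s as_; rewrite ger0_norm ?expR_ge0// => Es1.
  have : A * (s - t) * E s <= E t - E s by exact: Eqp.
  have : A * (t - s) * E s <= A * (t - s).
    by rewrite ler_piMr// mulr_ge0// subr_ge0.
  lra.
have := @ac_nonincreasing a b (fun t => enorm (z t) * E t - G t) ab.
have Ea : E a = 1 by rewrite /E subrr mulr0 expR0.
rewrite -/(E b) Ea mulr1; apply.
  apply: real_acB; last exact: real_ac_lip GK.
  apply: (@real_acM_lip _ _ _ _ _ C A) => //; last exact: real_ac_enorm.
  - by move=> t ? ?; rewrite ger0_norm ?enorm_ge0//; exact: zC.
  - by move=> t ? ?; exact: E1.
apply: ae_leb_impl aez => t tP tab e e0; have [w [g [zw Gg g0 wAg]]] := tP tab.
have e40 : 0 < e / 4 by rewrite divr_gt0.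
have [d1 d10 zd] := is_derive_straddle_enorm zw e40.
have [d2 d20 Gd] := is_derive_straddle Gg e40.
have w0 := enorm_ge0 w.
(* At speed at most |w| + e / 4, a time d3 changes A |z| by at most e / 4. The derivatives of z and
   of G cost another e / 4 each. *)
pose d3 := e / 4 / ((A + 1) * (enorm w + e / 4)).
have d30 : 0 < d3 by rewrite divr_gt0// mulr_gt0//; lra.
exists (Num.min d1 (Num.min d2 d3)); first by rewrite !lt_min d10 d20.
move=> p q ap pt tq qb; rewrite !lt_min => /and3P[qp1 qp2 qp3].
have qp0 : 0 <= q - p by lra.
have {}zd p' q' : p' <= t -> t <= q' -> q' - p' < d1 ->
    enorm (z q' - z p') <= (enorm w + e / 4) * (q' - p').
  move=> p't tq' qp'; have := zd _ _ p't tq' qp'.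
  have := ler_enormD (z q' - z p' - (q' - p') *: w) ((q' - p') *: w).
  rewrite subrK enormZ ger0_norm; last by lra.
  by rewrite mulrDl; lra.
have ezqp : enorm (z q) - enorm (z p) <= (enorm w + e / 4) * (q - p).
  by rewrite (le_trans (ler_norm _))// (le_trans (ler_enorm_dist _ _))// zd.
have ezpt : A * (enorm (z t) - enorm (z p)) <= e / 4.
  have : enorm (z t) - enorm (z p) <= (enorm w + e / 4) * d3.
    rewrite (le_trans (ler_norm _))// (le_trans (ler_enorm_dist _ _))//.
    rewrite (le_trans (zd _ _ pt _ _))//; first by lra.
    by rewrite ler_wpM2l//; lra.
  have -> : (enorm w + e / 4) * d3 = e / 4 / (A + 1).
    by rewrite /d3; field; apply/andP; split; apply/eqP; lra.
  move=> /(ler_wpM2l A0)/le_trans; apply.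
  by rewrite mulrA ler_pdivrMr ?ltr_wpDl// mulrC ler_pM2l// lerDl.
have {Gd} : G p - G q <= (- g + e / 4) * (q - p).
  have := Gd p q pt tq qp2; rewrite ler_norml => /andP[+ _].
  by rewrite (_ : (q - p) *: g = (q - p) * g)//; lra.
have Eq1 : E q <= 1.
  by have := E1 q; rewrite ger0_norm ?expR_ge0//; apply; lra.
have Eq0 : 0 <= E q by exact: expR_ge0.
have ep0 := enorm_ge0 (z p).
have h1 : enorm (z p) * (A * (q - p) * E q) <= enorm (z p) * (E p - E q).
  by rewrite ler_wpM2l// Eqp.
have h2 : E q * (enorm (z q) - enorm (z p) - A * (q - p) * enorm (z p)) <=
    (g + e / 2) * (q - p).
  have : E q * (enorm (z q) - enorm (z p) - A * (q - p) * enorm (z p)) <=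
      E q * ((g + e / 2) * (q - p)).
    rewrite ler_wpM2l//.
    have : (enorm w + e / 4 - A * enorm (z p)) * (q - p) <= (g + e / 2) * (q - p).
      by rewrite ler_wpM2r//; lra.
    lra.
  move/le_trans; apply; rewrite ler_piMl// mulr_ge0//; lra.
have : 0 <= e * (q - p) by rewrite mulr_ge0// ltW.
move: h1 h2 {zd zw Gg ezqp ezpt qp1 qp2 qp3}.
lra.
Qed.

End ae_derivative_estimates.

(** * Primitives and superposition of Lebesgue measurable functions *)

Section primitives.
Context {R : realType}.
Notation mu := (@lebesgue_measure R).

Lemma lebesgue_borel_ae (A : set R) :
  @measurable _ (lebesgueR R) A ->
  exists2 X : set R, @measurable _ (measurableTypeR R) X /\ X `<=` A &
    (@leb R).-negligible (A `\` X).
Proof.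
move=> mA; have : (@completed_algebra_gen _ _ R mu) A.
  by rewrite -g_sigma_completed_algebra_genE completed_caratheodory_measurable.
move=> [X mX [N [B [mB B0 NB]] XNA]]; exists X.
  by split => //; rewrite -XNA; exact: subsetUl.
exists B; split => //; first exact: sub_caratheodory.
by apply: subset_trans NB; rewrite -XNA => x [[Xx|//] nXx].
Qed.

(** h(t) is the infimum of the rationals q with h(t) < q. Replacing each of these countably many
    sublevel sets by a Borel subset of full measure yields a Borel function that differs from h on a
    null set only. *)
Lemma measurable_borel_ae (h : R -> R) (c Q : R) :
  @measurable_fun _ _ (lebesgueR R) R setT h -> (forall t, c <= h t <= Q) ->
  exists h' : R -> R, [/\ @measurable_fun _ _ (measurableTypeR R) R setT h',
    (forall t, c <= h' t <= Q) & \forall t \ae leb, h' t = h t].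
Proof.
move=> mh hQ.
pose A (q : rat) := h @^-1` `]-oo, (ratr q)[.
have mA q : @measurable _ (lebesgueR R) (A q).
  by rewrite -[A q]setTI; exact: mh.
have /choice[X XP] : forall q : rat, exists X : set R,
    [/\ @measurable _ (measurableTypeR R) X, X `<=` A q &
    (@leb R).-negligible (A q `\` X)].
  by move=> q; have [X [? ?] ?] := lebesgue_borel_ae (mA q); exists X.
pose q_ k : rat := odflt 0 (choice.unpickle k).
(* A rational whose set misses t is replaced by Q + 1, which lies above h and hence does not spoil
   the infimum. *)
pose H k (t : R) : R := (Q + 1) + (ratr (q_ k) - (Q + 1)) * \1_(X (q_ k)) t.
have HX k t : X (q_ k) t -> H k t = ratr (q_ k).
  by move=> Xt; rewrite /H indicE mem_set// mulr1 addrC subrK.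
have HnX k t : ~ X (q_ k) t -> H k t = Q + 1.
  by move=> Xt; rewrite /H indicE memNset// mulr0 addr0.
have hH k t : h t <= H k t.
  have [Xt|nXt] := pselect (X (q_ k) t).
    rewrite HX//; have [_ /(_ t Xt) + _] := XP (q_ k).
    by rewrite /A /= in_itv/= => /ltW.
  by rewrite HnX//; have /andP[_ /le_trans] := hQ t; apply; rewrite lerDl.
have lbH t : has_lbound (range (H ^~ t)).
  by exists (h t) => _ [k _ <-]; exact: hH.
pose h0 t := infs (H ^~ t) 0.
have mh0 : @measurable_fun _ _ (measurableTypeR R) R setT h0.
  apply: measurable_fun_infs => // k.
  apply: measurable_funD => //; apply: measurable_funM => //.
  by apply: measurable_indic; have [] := XP (q_ k).
(* Clamping gives the bounds at every t and changes nothing where h0 agrees with h. *)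
exists (fun t => Num.max c (Num.min Q (h0 t))); split.
- by apply: measurable_maxr => //; apply: measurable_minr.
- move=> t; have /andP[ch hQt] := hQ t.
  by rewrite le_max lexx/= ge_max ge_min lexx/= andbT (le_trans ch).
have : (@leb R).-negligible (\bigcup_k (A (q_ k) `\` X (q_ k))).
  by apply: negligible_bigcup => k; have [] := XP (q_ k).
apply: negligibleS => t /= ht; apply: contrapT => nt; apply: ht.
suff -> : h0 t = h t.
  have /andP[? ?] := hQ t.
  by rewrite (min_idPr _)// (max_idPr _).
apply/eqP; rewrite eq_le; apply/andP; split; last first.
  by apply: lb_le_inf; [exists (H 0%N t); exists 0%N|move=> _ [k _ <-]].
apply/ler_addgt0Pr => e e0.
have [|q] := @rat_in_itvoo R (h t) (h t + e); first by rewrite ltrDl.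
rewrite in_itv/= => /andP[hq qe].
have qk : q_ (choice.pickle q) = q by rewrite /q_ choice.pickleK.
apply: le_trans (ltW qe); rewrite -[leRHS](_ : H (choice.pickle q) t = _).
  by apply: ge_inf; [by exists (h t) => _ [k _ <-]; exact: hH|exists (choice.pickle q)].
rewrite HX qk//; apply: contrapT => nX; apply: nt.
by exists (choice.pickle q) => //; rewrite qk; split => //=; rewrite in_itv.
Qed.

(** The identity is measurable from the Lebesgue to the Borel sets and pushes the completed measure
    forward to [lebesgue_measure]. *)
Lemma leb_pushforward (D : set R) (f : R -> \bar R) :
  @measurable _ (measurableTypeR R) D ->
  @measurable_fun _ _ (measurableTypeR R) _ D f -> (forall t, 0 <= f t)%E ->
  (\int[mu]_(t in D) f t = \int[leb]_(t in D) f t)%E.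
Proof.
move=> mD mf f0.
have mid : @measurable_fun _ _ (lebesgueR R) (measurableTypeR R) setT id.
  by move=> _ B mB; rewrite setTI; exact: sub_caratheodory.
rewrite -[RHS](@ge0_integral_pushforward _ _ (lebesgueR R) (measurableTypeR R) R id mid (@leb R) D f mD mf).
  exact: eq_measure_integral.
by move=> t _; exact: f0.
Qed.

(** H integrates a Borel version of h over [0, t]. It vanishes for t <= 0, which keeps it Lipschitz
    on the whole line and confines the derivative to t > 0. *)
Lemma bounded_primitive (h : R -> R) (Q : R) :
  @measurable_fun _ _ (lebesgueR R) R setT h -> (forall t, `|h t| <= Q) ->
  exists H : R -> R, [/\ (forall s t, `|H t - H s| <= Q * `|t - s|),
    (\forall t \ae leb, 0 < t -> is_derive (t : R) (1 : R) H (h t)) &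
    (forall t, 0 <= h t) -> forall s t, 0 <= s -> s <= t ->
      (H t - H s)%:E = (\int[leb]_(x in `]s, t]) (h x)%:E)%E].
Proof.
move=> mh hQ.
have Q0 : 0 <= Q := le_trans (normr_ge0 _) (hQ 0).
(* A nonnegative h gets a nonnegative Borel version, as the last conclusion compares integrals of
   nonnegative functions. *)
pose c := if pselect (forall t, 0 <= h t) then 0 else - Q.
have cQ t : c <= h t <= Q.
  have := hQ t; rewrite ler_norml /c => /andP[? ->]; rewrite andbT.
  by case: pselect => //.
have [h' [mh' h'cQ hh']] := measurable_borel_ae mh cQ.
have h'Q t : `|h' t| <= Q.
  have /andP[ch' ?] := h'cQ t; rewrite ler_norml; apply/andP; split => //.
  by apply: le_trans ch'; rewrite /c; case: pselect => ? //=; rewrite oppr_le0.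
have ih' (A : set R) : measurable A -> (mu A < +oo)%E -> mu.-integrable A (EFin \o h').
  move=> mA Aoo; apply: measurable_bounded_integrable => //.
  - exact: measurable_funTS.
  - by exists Q; split; [exact: num_real|move=> M QM t _; exact: le_trans (h'Q t) (ltW QM)].
have itvoo (i : interval R) (a b : R) : i.1 = BLeft a \/ i.1 = BRight a ->
    i.2 = BRight b -> (mu [set` i] < +oo)%E.
  move=> i1 i2; rewrite lebesgue_measure_itv/= i2.
  case: ifP => _; last by rewrite ltry.
  by case: i1 => ->; rewrite /= -EFinB ltry.
have itvoc a b : (mu `]a, b]%classic < +oo)%E by apply: (itvoo _ a b) => //; right.
have itvcc a b : (mu `[a, b]%classic < +oo)%E by apply: (itvoo _ a b) => //; left.
pose H (t : R) : R := (\int[mu]_(x in `[0%R, t]) h' x)%R.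
have HB s t : 0 <= s -> s <= t -> H t - H s = (\int[mu]_(x in `]s, t]) h' x)%R.
  by move=> s0 st; rewrite /H (Rintegral_itvB (ih' _ _ (itvcc 0 t))).
have HQ s t : 0 <= s -> s <= t -> `|H t - H s| <= Q * (t - s).
  move=> s0 st; rewrite HB//.
  have ioc := ih' _ (measurable_itv _) (itvoc s t).
  rewrite (le_trans (le_normr_Rintegral _ ioc))//.
  rewrite (@le_trans _ _ (\int[mu]_(x in `]s, t]) Q)%R)//.
    apply: le_Rintegral => //.
    - exact: integrable_norm ioc.
    - apply: measurable_bounded_integrable => //; first exact: itvoc.
      by exists Q; split; [exact: num_real|move=> M QM x _; rewrite ger0_norm// ltW].
  have -> : (\int[mu]_(x in `]s, t]) Q)%R = Q * fine (mu `]s, t]%classic).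
    exact: Rintegral_cst.
  rewrite lebesgue_measure_itv/= lte_fin.
  case: ltP => [_|]; first by rewrite -EFinB.
  by rewrite mulr0 => _; rewrite mulr_ge0// subr_ge0.
have H0 t : t <= 0 -> H t = 0.
  rewrite le_eqVlt => /orP[/eqP ->|t0].
    rewrite /H set_itv1 /Rintegral integral_set1//.
  by rewrite /H set_itv_ge ?Rintegral_set0// bnd_simp -ltNge.
exists H; split.
- move=> s t; wlog st : s t / s <= t.
    by move=> W; have [/W//|/ltW/W] := leP s t; rewrite distrC (distrC s).
  rewrite [in leRHS]ger0_norm ?subr_ge0//.
  have [s0|s0] := leP 0 s; first exact: HQ.
  have [t0|t0] := leP t 0.
    by rewrite (H0 t t0) (H0 s (ltW s0)) subrr normr0 mulr_ge0// subr_ge0.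
  have := HQ 0 t (lexx 0) (ltW t0); rewrite (H0 0)// (H0 s (ltW s0)).
  by move=> /le_trans; apply; rewrite ler_wpM2l// lerB// ltW.
- have loc : locally_integrable setT h'.
    split => //; first exact: openT.
    move=> K _ cK.
    have := ih' K (compact_measurable cK) (compact_finite_measure cK).
    by move=> /integrableP[_].
  have := @FTC1 R h' (BLeft 0) (fun y => ih' _ (measurable_itv _) (itvcc 0 y)) loc.
  move=> [B [mB B0 NB]].
  have aeB : \forall t \ae leb, ~ B t.
    exists B; split => //; first exact: sub_caratheodory.
    by move=> t /= nnB; apply: contrapT.
  apply: ae_leb_impl (ae_leb_and hh' aeB) => t [ht nBt] t0.
  have /= dHt := contrapT (fun n => nBt (NB t n)).
  have [|dH H't] := dHt; first by rewrite lte_fin.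
  by apply: DeriveDef => //; rewrite -derive1E H't.
- move=> h0 s t s0 st; rewrite HB//.
  have h'0 x : 0 <= h' x.
    have /andP[+ _] := h'cQ x; rewrite /c; case: pselect => //.
  rewrite /Rintegral fineK; last first.
    by apply: integrable_fin_num => //; exact: ih'.
  rewrite leb_pushforward//; last first.
    by apply: measurableT_comp => //; exact: measurable_funTS.
  have moc : @measurable _ (lebesgueR R) `]s, t]%classic.
    by apply: sub_caratheodory; exact: measurable_itv.
  have mh'_leb : @measurable_fun _ _ (lebesgueR R) R setT h'.
    move=> _ Y mY; rewrite setTI; apply: sub_caratheodory.
    by rewrite -[X in measurable X]setTI; exact: mh'.
  apply: (@ge0_ae_eq_integral _ (lebesgueR R) R (@leb R)).
  + exact: moc.
  + by apply: measurableT_comp; last exact: measurable_funTS.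
  + by apply: measurableT_comp; last exact: measurable_funTS.
  + by move=> x _; rewrite lee_fin.
  + by move=> x _; rewrite lee_fin.
  + by apply: ae_leb_impl hh' => x -> _.
Qed.

End primitives.

Section measurability.
Context {R : realType}.

Lemma measurable_coord n (D : set R) (v : R -> 'rV[R]_n) (i : 'I_n) :
  lebesgue_measurable_fun D v ->
  @measurable_fun _ _ (lebesgueR R) R D (fun t => v t ord0 i).
Proof.
move=> mv mD; apply: (measurability _ (RGenOInfty.measurableE R)) => //.
move=> _ [_ [x ->] <-].
pose O := [set p : 'rV[R]_n | x < p ord0 i].
have oO : open O.
  have := @open_comp _ _ (fun p : 'rV[R]_n => p ord0 i) [set y | x < y].
  apply; last exact: open_gt.
  by move=> p _; exact: coord_continuous.
have := mv mD O (@sub_sigma_algebra _ _ _ O oO).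
congr (@measurable _ (lebesgueR R) (_ `&` _)).
by apply/seteqP; split=> t; rewrite /O /= in_itv/= andbT.
Qed.

Lemma lebesgue_measurable_enorm n (D : set R) (v : R -> 'rV[R]_n) :
  lebesgue_measurable_fun D v ->
  @measurable_fun _ _ (lebesgueR R) R D (fun t => enorm (v t)).
Proof.
move=> mv mD; apply: (measurability _ (RGenOInfty.measurableE R)) => //.
move=> _ [_ [x ->] <-].
pose O := [set p : 'rV[R]_n | x < enorm p].
have oO : open O.
  have := @open_comp _ _ (@enorm R n) [set y | x < y].
  by apply; [move=> p _; exact: enorm_continuous|exact: open_gt].
have := mv mD O (@sub_sigma_algebra _ _ _ O oO).
congr (@measurable _ (lebesgueR R) (_ `&` _)).
by apply/seteqP; split=> t; rewrite /O /= in_itv/= andbT.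
Qed.

Definition grid (k n : nat) (p : 'rV[R]_n) : 'rV[int]_n :=
  \row_i Num.floor (k.+1%:R * p ord0 i).

Definition grid_point (k n : nat) (p : 'rV[int]_n) : 'rV[R]_n :=
  \row_i ((p ord0 i)%:~R / k.+1%:R).

Lemma grid_dist k n (p : 'rV[R]_n) :
  `|p - grid_point k (grid k p)| <= n%:R / k.+1%:R.
Proof.
rewrite (le_trans (norm_le_enorm _))// (le_trans (ler_enorm_sum _))//.
rewrite -[in n%:R](card_ord n) mulr_natl -sumr_const; apply: ler_sum => i _.
rewrite !mxE; have k0 : 0 < k.+1%:R :> R by rewrite ltr0n.
have -> : p ord0 i - (Num.floor (k.+1%:R * p ord0 i))%:~R / k.+1%:R =
    (k.+1%:R * p ord0 i - (Num.floor (k.+1%:R * p ord0 i))%:~R) / k.+1%:R.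
  by field; apply/eqP; lra.
rewrite normrM normfV (gtr0_norm k0) ler_pdivrMr// mulVf ?gt_eqF//.
have := floor_le_tmp (k.+1%:R * p ord0 i); have := floorD1_gt (k.+1%:R * p ord0 i).
rewrite intrD => h1 h2; rewrite ger0_norm; lra.
Qed.

Lemma grid_cvg n (p : 'rV[R]_n) :
  (grid_point k (grid k p)) @[k --> \oo] --> p.
Proof.
apply/cvgrPdist_le => e e0.
near=> k; rewrite (le_trans (grid_dist _ _))//.
rewrite ler_pdivrMr ?ltr0n// mulrC -ler_pdivrMr//.
rewrite (@le_trans _ _ k%:R)//; last by rewrite ler_nat.
by near: k; exact: nbhs_infty_ger.
Unshelve. all: by end_near. Qed.

(* The arguments are rounded to a grid, so that only countably many sections of
   [g] are involved. *)
Lemma superposition_measurable (a b : nat) (D : set R)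
    (g : R -> 'rV[R]_a -> 'rV[R]_b -> R) (w : R -> 'rV[R]_a) (z : R -> 'rV[R]_b) :
  @measurable _ (lebesgueR R) D ->
  (forall p q, @measurable_fun _ _ (lebesgueR R) R D (fun t => g t p q)) ->
  (forall t, D t -> continuous (fun p : 'rV[R]_a * 'rV[R]_b => g t p.1 p.2)) ->
  (forall i, @measurable_fun _ _ (lebesgueR R) R D (fun t => w t ord0 i)) ->
  (forall i, @measurable_fun _ _ (lebesgueR R) R D (fun t => z t ord0 i)) ->
  @measurable_fun _ _ (lebesgueR R) R D (fun t => g t (w t) (z t)).
Proof.
move=> mD mg cg mw mz.
have mgrid k n (y : R -> 'rV[R]_n) (p : 'rV[int]_n) :
    (forall i, @measurable_fun _ _ (lebesgueR R) R D (fun t => y t ord0 i)) ->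
    @measurable _ (lebesgueR R) (D `&` [set t | grid k (y t) = p]).
  move=> my.
  pose E i := D `&` [set t | Num.floor (k.+1%:R * y t ord0 i) = p ord0 i].
  have mE i : @measurable _ (lebesgueR R) (E i).
    have := my i mD _ (measurable_itv `[(p ord0 i)%:~R / k.+1%:R, ((p ord0 i)%:~R + 1) / k.+1%:R[).
    congr (@measurable _ (lebesgueR R) (_ `&` _)); apply/seteqP.
    have k0 : 0 < k.+1%:R :> R by rewrite ltr0n.
    split=> t /=; rewrite in_itv/= ler_pdivrMr// ltr_pdivlMr// -(intrD _ _ 1) mulrC.
      by move=> tp; apply/floor_def.
    by move=> <-; rewrite floor_le_tmp floorD1_gt.
  have -> : D `&` [set t | grid k (y t) = p] = D `&` \bigcap_(i in [set: 'I_n]) E i.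
    apply/seteqP; split=> t [Dt /= H]; split => //.
      by move=> i _; split => //=; rewrite -H mxE.
    by apply/rowP => i; rewrite mxE; have [] := H i Logic.I.
  apply: measurableI => //; apply: fin_bigcap_measurable => [|i _].
    exact: finite_finset.
  exact: mE.
pose F k t := g t (grid_point k (grid k (w t))) (grid_point k (grid k (z t))).
apply: (@measurable_fun_cvg _ (lebesgueR R) R D F).
- move=> k.
  pose dec j : 'rV[int]_a * 'rV[int]_b := odflt (0, 0) (choice.unpickle j).
  (* On each of these countably many pieces both roundings are constant, so the approximant is a
     section of g there. *)
  pose E j := (D `&` [set t | grid k (w t) = (dec j).1]) `&` (D `&` [set t | grid k (z t) = (dec j).2]).
  have mE j : @measurable _ (lebesgueR R) (E j) by apply: measurableI; exact: mgrid.
  have -> : D = \bigcup_j E j.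
    apply/seteqP; split=> [t Dt|t [j _ [[]]]//].
    exists (choice.pickle (grid k (w t), grid k (z t))) => //.
    by rewrite /E /dec choice.pickleK.
  apply/measurable_fun_bigcup => // j.
  apply: (@eq_measurable_fun _ _ (lebesgueR R) R _ (fun t => g t (grid_point k (dec j).1) (grid_point k (dec j).2))).
    by move=> t; rewrite inE => -[[_ /= <-] [_ /= <-]].
  by apply: measurable_funS (mg _ _) => // t [[]].
- move=> t Dt.
  have /= cgt := cg t Dt (w t, z t).
  have H : (grid_point k (grid k (w t)), grid_point k (grid k (z t))) @[k --> \oo] -->
      (w t, z t) by apply: (@cvg_pair _ _ _ _ (nbhs (w t)) (nbhs (z t))); exact: grid_cvg.
  exact: (continuous_cvg _ cgt H).
Qed.

End measurability.

(** * Global existence and continuation of solutions *)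

Lemma ler_dist_max (R : realDomainType) (a p q : R) :
  `|Num.max a p - Num.max a q| <= `|p - q|.
Proof.
have max_sub r s : Num.max a r - Num.max a s <= `|r - s|.
  rewrite lerBlDr ge_max; apply/andP; split.
    by rewrite (le_trans (_ : a <= Num.max a s)) ?le_max ?lexx// lerDr.
  by rewrite -lerBlDr (le_trans _ (ler_norm _))// lerB// le_max lexx orbT.
by rewrite ler_norml max_sub andbT lerNl opprB distrC.
Qed.

Section picard.
Context {R : realType} (n : nat).
Variables (F : R -> 'rV[R]_n -> 'rV[R]_n) (A Q : R).
Let K := n%:R * Q.

Definition lipschitz_curve (C : R) (y : R -> 'rV[R]_n) :=
  forall s t, enorm (y t - y s) <= C * `|t - s|.

Hypothesis A0 : 0 < A.
Hypothesis F_lip : forall t x y, 0 <= t -> enorm (F t x - F t y) <= A * enorm (x - y).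
Hypothesis F_bound : forall t x, 0 <= t -> enorm (F t x) <= Q.
Hypothesis F_meas : forall y C i, lipschitz_curve C y ->
  @measurable_fun _ _ (lebesgueR R) R (Rge0 R) (fun t => F t (y t) ord0 i).

Let Q0 : 0 <= Q.
Proof. exact: le_trans (enorm_ge0 _) (F_bound 0 (lexx 0)). Qed.

Let K0 : 0 <= K.
Proof. by rewrite mulr_ge0. Qed.

Lemma picard_step (C a : R) (xi : 'rV[R]_n) (y : R -> 'rV[R]_n) :
  lipschitz_curve C y ->
  exists Y : R -> 'rV[R]_n, [/\ Y a = xi, lipschitz_curve K Y &
    \forall t \ae leb, 0 < t -> is_derive (t : R) (1 : R) Y (F t (y t))].
Proof.
move=> yC.
pose h (i : 'I_n) := (fun t => F t (y t) ord0 i) \_ (Rge0 R).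
have mh i : @measurable_fun _ _ (lebesgueR R) R setT (h i).
  apply/(measurable_restrictT _ _).1; last exact: F_meas yC.
  by apply: sub_caratheodory; exact: measurable_itv.
have hQ i t : `|h i t| <= Q.
  rewrite /h patchE; case: ifPn => [|_]; last by rewrite normr0.
  rewrite inE /= in_itv/= andbT => t0.
  exact: le_trans (coord_le_enorm _ _) (F_bound _ t0).
have /choice[H HP] : forall i, exists Hi : R -> R,
    (forall s t, `|Hi t - Hi s| <= Q * `|t - s|) /\
    (\forall t \ae leb, 0 < t -> is_derive (t : R) (1 : R) Hi (h i t)).
  by move=> i; have [Hi [? ? _]] := bounded_primitive (mh i) (hQ i); exists Hi.
exists (fun t => xi + \row_i (H i t - H i a)); split.
- by apply/rowP => i; rewrite !mxE subrr addr0.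
- move=> s t; rewrite (le_trans (ler_enorm_sum _))// /K -mulrA.
  rewrite -[in n%:R](card_ord n) mulr_natl -sumr_const; apply: ler_sum => i _.
  rewrite !mxE; have [Hlip _] := HP i.
  by rewrite (_ : _ - _ = H i t - H i s) ?Hlip//; ring.
- have : \forall t \ae leb, forall i, 0 < t -> is_derive (t : R) (1 : R) (H i) (h i t).
    apply: (@filter_forall _ _ _ _ (ae_filter_ringOfSetsType (@leb R))) => i.
    by have [_] := HP i.
  apply: ae_leb_impl => t Ht t0.
  have dcoord (i : 'I_1) (j : 'I_n) : is_derive (t : R) (1 : R)
      (fun x => (xi + \row_k (H k x - H k a)) i j) (F t (y t) i j).
    rewrite (_ : (fun x => _) = (fun x => H j x + cst (xi i j - H j a) x)); last first.
      by apply/funext => x; rewrite !mxE/=; ring.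
    have Hj := Ht j t0.
    rewrite (_ : F t (y t) i j = h j t + 0).
      exact: is_deriveD.
    rewrite addr0 /h patchE mem_set//= ?in_itv/= ?andbT ?(ltW t0)//.
    by rewrite (ord1 i).
  have dY : derivable (fun x => xi + \row_k (H k x - H k a)) t (1 : R).
    by apply/derivable_mxP => i j; have [] := dcoord i j.
  apply: DeriveDef => //; rewrite derive_mx//; apply/matrixP => i j; rewrite mxE.
  by have [_] := dcoord i j.
Qed.

(** Integrating A c exp(2A(t - a)) gives at most (c / 2) exp(2A(t - a)): the weight grows at twice
    the Lipschitz constant, hence the factor 1/2. [gronwall] is used with rate 0, that is, as a mean
    value inequality. *)
Lemma picard_contraction (c C a : R) (y1 y2 Y1 Y2 : R -> 'rV[R]_n) : 0 <= a ->
  0 <= c -> Y1 a = Y2 a -> lipschitz_curve C Y1 -> lipschitz_curve C Y2 ->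
  (\forall t \ae leb, 0 < t -> is_derive (t : R) (1 : R) Y1 (F t (y1 t))) ->
  (\forall t \ae leb, 0 < t -> is_derive (t : R) (1 : R) Y2 (F t (y2 t))) ->
  (forall t, a <= t -> enorm (y1 t - y2 t) <= c * expR (2 * A * (t - a))) ->
  forall t, a <= t -> enorm (Y1 t - Y2 t) <= c / 2 * expR (2 * A * (t - a)).
Proof.
move=> a0 c0 Ya Y1C Y2C dY1 dY2 y12 b ab.
pose G t := c / 2 * expR (2 * A * (t - a)).
have dG t : is_derive (t : R) (1 : R) G (A * c * expR (2 * A * (t - a))).
  have din : is_derive (t : R) (1 : R) (fun x : R => (2 * A) *: (x - a)) ((2 * A) *: (1 - 0)).
    by apply: is_deriveZ; apply: is_deriveB.
  have := is_deriveZ (c / 2) (@is_derive1_comp R expR _ t _ _ (is_derive_expR _) din).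
  rewrite subr0 (_ : c / 2 *: _ = A * c * expR (2 * A * (t - a)))//.
  rewrite [LHS]/GRing.scale/= ![_ *: _]/GRing.scale/= mulr1.
  by field.
have lipz s t : enorm ((Y1 t - Y2 t) - (Y1 s - Y2 s)) <= (C + C) * `|t - s|.
  rewrite (_ : _ - _ - _ = (Y1 t - Y1 s) - (Y2 t - Y2 s)).
    by rewrite mulrDl (le_trans (ler_enormB _ _))// lerD.
  by rewrite !opprD !opprK addrACA.
have := @gronwall R n a b 0 (`|C + C| * (b - a)) (A * c * expR (2 * A * (b - a)))
  (fun t => Y1 t - Y2 t) G ab (lexx 0).
rewrite oppr0 mul0r expR0 mulr1 Ya subrr enorm0 sub0r => H.
have : enorm (Y1 b - Y2 b) - G b <= - G a; last first.
  have : 0 <= G a by rewrite mulr_ge0// ?expR_ge0// divr_ge0.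
  by rewrite -/(G b); lra.
apply: H.
- apply: (@ac_lip _ _ _ _ _ (C + C)) => s t _ st _.
  by have := lipz s t; rewrite ger0_norm// subr_ge0.
- move=> t at_ tb; have := lipz a t; rewrite Ya subrr subr0 => /le_trans; apply.
  rewrite ger0_norm ?subr_ge0//.
  rewrite (@le_trans _ _ (`|C + C| * (t - a)))//.
    by rewrite ler_wpM2r ?subr_ge0 ?ler_norm.
  by rewrite ler_wpM2l// lerB.
- move=> s t as_ st tb; rewrite -mulrBr normrM ger0_norm ?divr_ge0//.
  have Ets : expR (2 * A * (t - a)) - expR (2 * A * (s - a)) <=
      2 * A * (t - s) * expR (2 * A * (t - a)).
    have := expR_ge1Dx (- (2 * A * (t - s))).
    rewrite -(ler_pM2r (expR_gt0 (2 * A * (t - a)))) -expRD.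
    by rewrite (_ : - _ + _ = 2 * A * (s - a)); [lra|ring].
  have Etb : expR (2 * A * (t - a)) <= expR (2 * A * (b - a)).
    by rewrite ler_expR ler_pM2l ?mulr_gt0// lerB.
  rewrite ger0_norm; last by rewrite subr_ge0 ler_expR ler_pM2l ?mulr_gt0// lerB.
  rewrite (le_trans (ler_wpM2l _ Ets)) ?divr_ge0//.
  rewrite (_ : c / 2 * _ = A * c * (t - s) * expR (2 * A * (t - a))); last by field.
  rewrite (_ : A * c * _ * (t - s) = A * c * (t - s) * expR (2 * A * (b - a))); last by ring.
  by rewrite ler_wpM2l// !mulr_ge0 ?subr_ge0// ltW.
- apply: ae_leb_impl (ae_leb_and dY1 dY2) => t [dY1t dY2t] /andP[at_ tb].
  have t0 : 0 < t by exact: le_lt_trans at_.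
  exists (F t (y1 t) - F t (y2 t)), (A * c * expR (2 * A * (t - a))); split.
  + by have := dY1t t0; have := dY2t t0 => *; exact: is_deriveB.
  + exact: dG.
  + by rewrite !mulr_ge0 ?expR_ge0// ltW.
  + rewrite mul0r add0r (le_trans (F_lip _ _ (ltW t0)))// -mulrA ler_wpM2l ?(ltW A0)//.
    by apply: y12; exact: ltW.
Qed.

Lemma le_geometric (x b C : R) : (forall k, x <= b + C / 2 ^+ k) -> x <= b.
Proof.
move=> H; apply/ler_addgt0Pr => e e0.
have [k _ ek] : exists2 k, True & `|C| / 2 ^+ k <= e.
  have /cvgrPdist_le/(_ e e0) : @geometric R `|C| 2^-1 @ \oo --> (0 : R).
    by apply: cvg_geometric; rewrite ger0_norm ?invr_ge0// invf_lt1// ltr1n.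
  move=> [k _ /(_ k (leqnn k))]; rewrite sub0r normrN /geometric/= => H'.
  by exists k => //; rewrite -exprVn (le_trans (ler_norm _)).
rewrite (le_trans (H k))// lerD2l (le_trans _ ek)//.
by rewrite ler_wpM2r ?ler_norm// invr_ge0 exprn_ge0.
Qed.

(* Picard iteration in the weighted norm sup |y(t)| exp(-2A(t-a)), for which the
   integral operator halves distances. *)
Lemma picard (a : R) (xi : 'rV[R]_n) : 0 <= a ->
  exists y : R -> 'rV[R]_n, [/\ y a = xi, lipschitz_curve K y &
    \forall t \ae leb, a < t -> is_derive (t : R) (1 : R) y (F t (y t))].
Proof.
move=> a0.
pose E t := expR (2 * A * (t - a)).
have E0 t : 0 <= E t by exact: expR_ge0.
pose T := {y : R -> 'rV[R]_n | lipschitz_curve K y}.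
have /choice[S SP] : forall y : T, exists Y : T, proj1_sig Y a = xi /\
    \forall t \ae leb, 0 < t -> is_derive (t : R) (1 : R) (proj1_sig Y) (F t (proj1_sig y t)).
  move=> [y yK]; have [Y [Ya YK dY]] := picard_step a xi yK.
  by exists (exist _ Y YK).
have xiK : lipschitz_curve K (fun=> xi).
  by move=> s t; rewrite subrr enorm0 mulr_ge0.
pose u k := proj1_sig (iter k S (exist _ _ xiK)).
have uK k : lipschitz_curve K (u k) by rewrite /u; case: (iter _ _ _).
have ua k : u k a = xi.
  by case: k => [//|k]; rewrite /u iterS; have [] := SP (iter k S (exist _ _ xiK)).
have du k : \forall t \ae leb, 0 < t -> is_derive (t : R) (1 : R) (u k.+1) (F t (u k t)).
  by rewrite /u iterS; have [] := SP (iter k S (exist _ _ xiK)).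
(* The first step moves by at most K (t - a) = c (2A(t - a)), which is at most c exp(2A(t - a)). *)
pose c := K / (2 * A).
have c0 : 0 <= c by rewrite divr_ge0// mulr_ge0// ltW.
have ustep k t : a <= t -> enorm (u k.+1 t - u k t) <= c / 2 ^+ k * E t.
  elim: k t => [|k IH] t at_.
    rewrite expr0 divr1 -[u 0%N t](_ : u 1%N a = _); last by rewrite ua.
    rewrite (le_trans (uK _ _ _))// ger0_norm ?subr_ge0//.
    rewrite (_ : K * (t - a) = c * (2 * A * (t - a))); last first.
      by rewrite /c; field; rewrite gt_eqF.
    by rewrite ler_wpM2l// (le_trans _ (expR_ge1Dx _))// lerDr.
  rewrite (_ : c / 2 ^+ k.+1 = c / 2 ^+ k / 2); last first.
    by rewrite exprSr invfM mulrA.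
  apply: (@picard_contraction (c / 2 ^+ k) K a (u k.+1) (u k)) => //.
  - by rewrite divr_ge0// exprn_ge0.
  - by rewrite !ua.
have ucauchy k j t : a <= t -> enorm (u (k + j)%N t - u k t) <= 2 * c * E t / 2 ^+ k.
  move=> at_.
  suff : enorm (u (k + j)%N t - u k t) <= (2 * c * E t) * (1 / 2 ^+ k - 1 / 2 ^+ (k + j)).
    move/le_trans; apply; rewrite ler_wpM2l//; last by rewrite mul1r gerBl divr_ge0// exprn_ge0.
    by rewrite mulr_ge0// mulr_ge0.
  elim: j => [|j IH]; first by rewrite addn0 !subrr enorm0 mulr0.
  rewrite addnS (le_trans (ler_enorm_distD (u (k + j)%N t) _ _))//.
  rewrite (le_trans (lerD (ustep _ _ at_) IH))// exprS.
  have k0 : (2 : R) ^+ (k + j) != 0 by rewrite expf_neq0.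
  have k1 : (2 : R) ^+ k != 0 by rewrite expf_neq0.
  rewrite le_eqVlt; apply/orP; left; apply/eqP; field; apply/andP; split => //.
have ucoord k m t i : a <= t ->
    u k t ord0 i - 2 * c * E t / 2 ^+ k <= u m t ord0 i + 2 * c * E t / 2 ^+ m.
  move=> at_.
  have key p j : `|u (p + j)%N t ord0 i - u p t ord0 i| <= 2 * c * E t / 2 ^+ p.
    rewrite (le_trans _ (ucauchy p j t at_))//.
    by have := coord_le_enorm (u (p + j)%N t - u p t) i; rewrite !mxE.
  have pos p : 0 <= 2 * c * E t / 2 ^+ p.
    by rewrite divr_ge0 ?exprn_ge0// mulr_ge0// mulr_ge0.
  have [km|mk] := leqP k m.
    have := key k (m - k)%N; rewrite subnKC// ler_norml => /andP[+ _].
    by have := pos m; lra.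
  have := key m (k - m)%N; rewrite subnKC ?(ltnW mk)// ler_norml => /andP[_].
  by have := pos k; lra.
(* The limit is written down coordinatewise as the supremum of the lower bounds that the Cauchy
   estimate provides. *)
pose yl (t : R) : 'rV[R]_n :=
  \row_i sup [set u k t ord0 i - 2 * c * E t / 2 ^+ k | k in [set: nat]].
(* The iterates are controlled from a on only; freezing the limit before a makes it Lipschitz on the
   whole line. *)
pose y t := yl (Num.max a t).
have yu k t : a <= t -> enorm (y t - u k t) <= n%:R * (2 * c) / 2 ^+ k * E t.
  move=> at_; rewrite /y (max_idPr at_) (le_trans (ler_enorm_sum _))//.
  rewrite (_ : n%:R * (2 * c) / 2 ^+ k * E t = n%:R * (2 * c * E t / 2 ^+ k)); last by ring.
  rewrite -[in n%:R](card_ord n) mulr_natl -sumr_const; apply: ler_sum => i _.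
  rewrite !mxE ler_norml; apply/andP; split.
    rewrite lerBrDl; apply: ub_le_sup; last by exists k.
    by exists (u 0%N t ord0 i + 2 * c * E t / 2 ^+ 0) => _ [m _ <-]; exact: ucoord.
  rewrite lerBlDl; apply: ge_sup; last by move=> _ [m _ <-]; exact: ucoord.
  by exists (u 0%N t ord0 i - 2 * c * E t / 2 ^+ 0); exists 0%N.
have yK : lipschitz_curve K y.
  move=> s t.
  have ymax r : y r = y (Num.max a r) by rewrite /y (max_idPr (_ : a <= Num.max a r))// le_max lexx.
  rewrite (le_trans _ (ler_wpM2l K0 (ler_dist_max a t s)))// ymax (ymax s).
  have : a <= Num.max a s by rewrite le_max lexx.
  have : a <= Num.max a t by rewrite le_max lexx.
  move: (Num.max a t) (Num.max a s) => p q ap aq.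
  apply: (@le_geometric _ _ (n%:R * (2 * c) * (E p + E q))) => k.
  rewrite (le_trans (ler_enorm_distD (u k p) _ _))//.
  rewrite (le_trans (lerD (yu k p ap) (ler_enorm_distD (u k q) _ _)))//.
  have := yu k q aq; rewrite enormB => yuq.
  rewrite (le_trans (lerD (lexx _) (lerD (uK k _ _) yuq)))//.
  by rewrite le_eqVlt; apply/orP; left; apply/eqP; ring.
(* The solution is the image Y of y under the integral operator: its derivative is F(t, y(t)), and
   the contraction estimate identifies it with y from a on. *)
have [Ya dY] := SP (exist _ _ yK); set Y := S _ in Ya dY.
exists (proj1_sig Y); split => //; first by case: (Y).
have Yy t : a <= t -> proj1_sig Y t = y t.
  move=> at_; apply/eqP; rewrite -subr_eq0; apply/eqP/enorm_eq0/eqP.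
  rewrite eq_le enorm_ge0 andbT.
  apply: (@le_geometric _ _ (n%:R * (2 * c) * E t)) => k; rewrite add0r.
  rewrite (le_trans (ler_enorm_distD (u k.+1 t) _ _))//.
  rewrite (le_trans (lerD (@picard_contraction (n%:R * (2 * c) / 2 ^+ k) K a y
    (u k) (proj1_sig Y) (u k.+1) a0 _ _ _ _ dY (du k) (yu k) t at_) (lexx _)))//.
  - by rewrite divr_ge0 ?exprn_ge0// mulr_ge0// mulr_ge0.
  - by rewrite Ya ua.
  - by case: (Y).
  rewrite (enormB (u k.+1 t)) (le_trans (lerD (lexx _) (yu k.+1 t at_)))//.
  have k1 : (2 : R) ^+ k != 0 by rewrite expf_neq0.
  by rewrite le_eqVlt; apply/orP; left; apply/eqP; rewrite exprS /E; field.
apply: ae_leb_impl dY => t dYt at_; rewrite Yy ?(ltW at_)//.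
by apply: dYt; exact: le_lt_trans at_.
Qed.

End picard.

Section impulse_sets.
Context {R : realType}.
Implicit Types (gamma : set R) (a b c t : R).

(** By Bolzano-Weierstrass: infinitely many impulses in a bounded interval would have a limit
    point. *)
Lemma impulses_finite gamma a b : impulse_times gamma ->
  finite_set (gamma `&` `]a, b]%classic).
Proof.
move=> [N [tau [_ _ lim0 _]]]; apply: contrapT => inf.
have bnd : bounded_set (gamma `&` `]a, b]%classic).
  exists (`|a| + `|b|); split; first exact: num_real.
  move=> M abM x [_ /=]; rewrite in_itv/= => /andP[ax xb].
  rewrite (le_trans _ (ltW abM))// ler_norml; apply/andP; split.
    have := ler_norm (- a); rewrite normrN; have := normr_ge0 b; lra.
  by have := ler_norm b; have := normr_ge0 a; lra.
have [l ll] := infinite_bounded_limit_point_nonempty inf bnd.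
suff : limit_point gamma l by rewrite lim0.
by move=> U Ul; have [y [yl [gy _] Uy]] := ll U Ul; exists y.
Qed.

Lemma impulses_gap gamma t : impulse_times gamma ->
  exists2 e, 0 < e & forall s, s != t -> `|s - t| < e -> ~ gamma s.
Proof.
move=> [N [tau [_ _ lim0 _]]].
have : ~ limit_point gamma t by rewrite lim0.
rewrite not_limit_pointE => -[U tU Ug].
have [e e0 eU] := (nbhs_ballP _ _).1 tU.
exists e => // s st ste gs; have : (gamma `&` U) s.
  by split => //; apply: eU; rewrite /ball/= distrC.
by move=> /Ug; rewrite /= => /eqP; rewrite (negPf st).
Qed.

Lemma impulse_countD gamma a b c : impulse_times gamma -> a <= b -> b <= c ->
  impulse_count gamma `]a, c]%classic =
  (impulse_count gamma `]a, b]%classic + impulse_count gamma `]b, c]%classic)%N.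
Proof.
move=> gt ab bc; rewrite /impulse_count.
have -> : gamma `&` `]a, c]%classic =
    (gamma `&` `]a, b]%classic) `|` (gamma `&` `]b, c]%classic).
  rewrite -setIUr; congr (_ `&` _); rewrite -itv_bndbnd_setU//= bnd_simp//.
rewrite fset_setU; [|exact: impulses_finite..].
rewrite cardfsU (_ : (_ `&` _)%fset = fset0) ?cardfs0 ?subn0//.
rewrite -fset_setI; [|exact: impulses_finite..].
rewrite -fset_set0; congr fset_set; apply/seteqP; split => // x.
rewrite /= !in_itv/= => -[[_ /andP[_ xb]] [_ /andP[bx _]]].
by have := lt_le_trans bx xb; rewrite ltxx.
Qed.

Lemma impulse_count_gt0 gamma a b t : impulse_times gamma ->
  gamma t -> a < t -> t <= b -> (0 < impulse_count gamma `]a, b]%classic)%N.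
Proof.
move=> gt g at_ tb; rewrite /impulse_count cardfs_gt0; apply/fset0Pn; exists t.
rewrite in_fset_set; last exact: impulses_finite.
by rewrite inE; split => //=; rewrite in_itv/= at_.
Qed.

Lemma impulse_count0 gamma a b : impulse_times gamma ->
  (forall t, a < t -> t <= b -> ~ gamma t) ->
  impulse_count gamma `]a, b]%classic = 0%N.
Proof.
move=> gt ng; rewrite /impulse_count (_ : gamma `&` _ = set0) ?fset_set0//.
apply/seteqP; split => // t [g]; rewrite /= in_itv/= => /andP[at_ tb].
exact: ng g.
Qed.

Lemma last_impulse gamma a b : impulse_times gamma ->
  (0 < impulse_count gamma `]a, b]%classic)%N ->
  exists t, [/\ gamma t, a < t, t <= b & forall s, t < s -> s <= b -> ~ gamma s].
Proof.
move=> gt; pose G := fset_set (gamma `&` `]a, b]%classic).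
have GP t : (t \in G) <-> [/\ gamma t, a < t & t <= b].
  rewrite in_fset_set; last exact: impulses_finite.
  rewrite inE; split=> [[g]|[g at_ tb]].
    by rewrite /= in_itv/= => /andP[].
  by split => //=; rewrite in_itv/= at_.
rewrite /impulse_count cardfs_gt0 => /fset0Pn[t0 t0G].
pose t := \big[Num.max/t0]_(s <- G) s.
have tG : t \in G.
  rewrite /t big_seq; apply: (big_ind (fun z => z \in G)) => // x y xG yG.
  by rewrite /Num.max; case: ifP.
have [g at_ tb] := (GP t).1 tG; exists t; split => // s ts sb gs.
have sG : s \in G by apply/GP; split => //; exact: lt_trans ts.
have : s <= t by apply: le_bigmax_seq sG _.
by rewrite leNgt ts.
Qed.

End impulse_sets.

Section solutions.
Context {R : realType} (n m : nat) (S : @impulsive_system R n m).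

Lemma is_solution_restart (t0 : R) x0 u x Tx (t1 : R) : is_solution S t0 x0 u x Tx ->
  t0 <= t1 -> (t1%:E < Tx)%E -> is_solution S t1 (x t1) u x Tx.
Proof.
move=> [t0T xt0 flowx jumpx] t01 t1T; split => //.
- by move=> s1 s2 ts1; apply: flowx; exact: le_trans ts1.
- by move=> t gt t1t; apply: jumpx => //; exact: le_lt_trans t1t.
Qed.

(** [is_solution] describes the flow on half-open intervals. The gap free of impulses after b leaves
    room for one that contains the closed interval [a, b]. *)
Lemma solution_flow (t0 : R) x0 u x Tx (a b : R) : is_solution S t0 x0 u x Tx ->
  t0 <= a -> a <= b -> (b%:E < Tx)%E ->
  (forall t, a < t -> t <= b -> ~ impulses S t) ->
  absolutely_continuous a b x /\
  \forall t \ae leb, a < t < b ->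
    is_derive (t : R) (1 : R) x (flow S t (x t) (u t)).
Proof.
move=> [t0T xt0 flowx jumpx] t0a ab bT noimp.
have [e e0 gap] := impulses_gap b (impulsesP S).
pose t2 := Order.min Tx (b + e)%:E.
have bt2 : (b%:E < t2)%E by rewrite lt_min bT lte_fin ltrDl.
have [|||acx dx] := flowx a t2 t0a.
- by apply: le_lt_trans bt2; rewrite lee_fin.
- by rewrite ge_min lexx.
- move=> t at_; rewrite lt_min lte_fin => /andP[_ tbe].
  have [tb|bt] := leP t b; first exact: noimp.
  by apply: gap; [rewrite gt_eqF|rewrite ger0_norm ?subr_ge0 ?(ltW bt)// ltrBlDl].
split.
  apply: acx => // t /=; rewrite in_itv/= => /andP[at_ tb]; split => //.
  by apply: le_lt_trans bt2; rewrite lee_fin.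
apply: ae_leb_impl dx => t dx /andP[at_ tb]; apply: dx; split; first exact: ltW.
by apply: lt_trans bt2; rewrite lte_fin.
Qed.

End solutions.

Section maximal_solutions.
Context {R : realType} (n m : nat) (S : @impulsive_system R n m).
Variables (t0 : R) (x0 : 'rV[R]_n) (u : R -> 'rV[R]_m).

Let curve := ((R -> 'rV[R]_n) * \bar R)%type.

Let extends (p q : curve) :=
  (p.2 <= q.2)%E /\ forall t, itvco_ext t0 p.2 t -> q.1 t = p.1 t.

Let extends_refl p : extends p p.
Proof. by split. Qed.

Let extends_trans p q r : extends p q -> extends q r -> extends p r.
Proof.
move=> [pq1 pq2] [qr1 qr2]; split; first exact: le_trans qr1.
move=> t [t0t tp]; rewrite qr2 ?pq2//; split => //; exact: lt_le_trans pq1.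
Qed.

Let chain_union (A : set curve) : A !=set0 ->
  (forall p, A p -> is_solution S t0 x0 u p.1 p.2) ->
  (forall p q, A p -> A q -> extends p q \/ extends q p) ->
  exists2 q, is_solution S t0 x0 u q.1 q.2 & forall p, A p -> extends p q.
Proof.
move=> [p0 Ap0] Asol Atot.
pose T := ereal_sup [set p.2 | p in A].
have T_ub p : A p -> (p.2 <= T)%E by move=> Ap; apply: ereal_sup_ubound; exists p.
have T_lt t : (t%:E < T)%E -> exists p, A p /\ (t%:E < p.2)%E.
  by move=> /ereal_sup_gt[_ [p Ap <-] tp]; exists p.
(* From t0 on, all members of the chain defined beyond t agree at t; the default 0 is taken only
   from T on. *)
pose x t := if pselect (exists p, A p /\ (t%:E < p.2)%E) is left H
  then (projT1 (cid H)).1 t else 0.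
have xE p t : A p -> t0 <= t -> (t%:E < p.2)%E -> x t = p.1 t.
  move=> Ap t0t tp; rewrite /x; case: pselect => [H|]; last by case; exists p.
  case: (cid H) => q [Aq tq] /=.
  by have [[_ ->]|[_ ->]] := Atot _ _ Ap Aq.
exists (x, T); last first.
  by move=> p Ap; split => [|t [t0t tp]] /=; [exact: T_ub|exact: xE].
split => /=.
- have [t0p _ _ _] := Asol _ Ap0; exact: lt_le_trans (T_ub _ Ap0).
- by have [t0p <- _ _] := Asol _ Ap0; exact: xE.
- move=> t1 t2 t01 t12 t2T noimp; split.
    move=> a b ab abT.
    have [t1a _] : itvco_ext t1 t2 a by apply: abT; rewrite /= in_itv/= lexx ab.
    have [_ bt2] : itvco_ext t1 t2 b by apply: abT; rewrite /= in_itv/= lexx ab.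
    have [p [Ap bp]] := T_lt b (lt_le_trans bt2 t2T).
    apply: (@eq_ac R n a b p.1).
      move=> t at_ tb; apply/esym/xE => //; first exact: le_trans (le_trans t01 t1a) at_.
      by apply: le_lt_trans bp; rewrite lee_fin.
    have [t0p _ flowp _] := Asol _ Ap.
    have [|||acp _] := flowp t1 (Order.min t2 p.2) t01.
    + rewrite lt_min t12/=; apply: le_lt_trans bp.
      by rewrite lee_fin (le_trans t1a).
    + by rewrite ge_min lexx orbT.
    + by move=> t t1t; rewrite lt_min => /andP[tt2 _]; exact: noimp.
    apply: acp => // t /=; rewrite in_itv/= => /andP[at_ tb]; split.
      exact: le_trans at_.
    by rewrite lt_min; apply/andP; split; [apply: le_lt_trans bt2|apply: le_lt_trans bp];
      rewrite lee_fin.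
  (* The chain may be uncountable, but null sets can be united only countably often: one member for
     each rational time below T already covers the domain. *)
  have /choice[P PP] : forall q : rat, exists p, A p /\
      ((ratr q)%:E < T -> (ratr q)%:E < p.2)%E.
    move=> q; have [qT|] := pselect ((ratr q)%:E < T)%E.
      by have [p [Ap qp]] := T_lt _ qT; exists p.
    by exists p0.
  pose G (p : curve) t := itvco_ext t1 (Order.min t2 p.2) t ->
    is_derive (t : R) (1 : R) p.1 (flow S t (p.1 t) (u t)).
  have aeG q : \forall t \ae leb, G (P q) t.
    have [Ap _] := PP q; have [t0p _ flowp _] := Asol _ Ap.
    have [tp|pt] := ltP t1%:E (P q).2; last first.
      apply: aeW => t [t1t]; rewrite lt_min => /andP[_ tp].
      by have := lt_le_trans tp pt; rewrite lte_fin ltNge t1t.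
    have [|||_ //] := flowp t1 (Order.min t2 (P q).2) t01.
    + by rewrite lt_min t12.
    + by rewrite ge_min lexx orbT.
    + by move=> t t1t; rewrite lt_min => /andP[tt2 _]; exact: noimp.
  have aeGk k : \forall t \ae leb, G (P (odflt 0 (choice.unpickle k))) t by exact: aeG.
  have := ae_leb_and (ae_leb_neq t0) (ae_foralln aeGk).
  apply: ae_leb_impl => t [tt0 Gt] [t1t tt2].
  have t0t : t0 < t by rewrite lt_neqAle eq_sym tt0 (le_trans t01).
  have [q [tq qT]] : exists q : rat, t < ratr q /\ ((ratr q)%:E < T)%E.
    have : (t%:E < T)%E by exact: lt_le_trans tt2 t2T.
    case: T {T_ub T_lt t2T PP} => [r| |] tr.
    - have [|q] := @rat_in_itvoo R t r; first by rewrite -lte_fin.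
      by rewrite in_itv/= => /andP[? ?]; exists q; rewrite lte_fin.
    - have [|q] := @rat_in_itvoo R t (t + 1); first by rewrite ltrDl.
      by rewrite in_itv/= => /andP[? ?]; exists q; rewrite ltry.
    - by [].
  have [Ap /(_ qT) qp] := PP q.
  have tp : (t%:E < (P q).2)%E by apply: lt_trans qp; rewrite lte_fin.
  have := Gt (choice.pickle q); rewrite choice.pickleK /= => {}Gt.
  rewrite (xE _ _ Ap (ltW t0t) tp).
  apply: near_eq_is_derive (Gt _); last by split => //; rewrite lt_min tt2.
  have : t \in `]t0, (ratr q)[ by rewrite in_itv/= t0t.
  move=> /near_in_itvoo; apply: filterS => s; rewrite in_itv/= => /andP[t0s sq].
  by apply/esym/xE => //; [exact: ltW|apply: lt_trans qp; rewrite lte_fin].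
- move=> t imp t0t tT; have [p [Ap tp]] := T_lt t tT.
  have [_ _ _ jumpp] := Asol _ Ap; have [l pl xl] := jumpp t imp t0t tp.
  exists l; last by rewrite (xE p)// ltW.
  apply: cvg_trans pl; apply: near_eq_cvg.
  near=> s; apply/esym/xE => //.
    by near: s; exact: nbhs_left_ge.
  apply: lt_trans tp; rewrite lte_fin.
  by near: s; exact: nbhs_left_lt.
Unshelve. all: by end_near. Qed.

(** Zorn's lemma for the preorder [extends], with upper bounds of nonempty chains from
    [chain_union]; a maximal element admits no proper extension. *)
Lemma maximal_extension x Tx : is_solution S t0 x0 u x Tx ->
  exists y Ty, [/\ is_maximal_solution S t0 x0 u y Ty, (Tx <= Ty)%E &
    forall t, itvco_ext t0 Tx t -> y t = x t].
Proof.
move=> solx.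
pose C := {p : curve | is_solution S t0 x0 u p.1 p.2 /\ extends (x, Tx) p}.
pose r (p q : C) := `[< extends (proj1_sig p) (proj1_sig q) >].
have c0 : C by exists (x, Tx); split.
have [||A Atot|[p [solp xp]] pmax] := @ZL_preorder C c0 r.
- by move=> p; apply/asboolP; exact: extends_refl.
- by move=> p q s /asboolP pq /asboolP qs; apply/asboolP; exact: extends_trans qs.
- have [->|/set0P[q0 Aq0]] := eqVneq A set0; first by exists c0 => s [].
  have [||p q [p' Ap' <-] [q' Aq' <-]|q solq Aq] := @chain_union (@proj1_sig _ _ @` A).
  + by exists (proj1_sig q0), q0.
  + by move=> _ [[p [solp ?]] _ <-].
  + by have [/asboolP|/asboolP] := Atot _ _ Ap' Aq'; [left|right].
  have xq : extends (x, Tx) q.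
    apply: extends_trans (Aq _ (ex_intro2 _ _ q0 Aq0 erefl)).
    by case: (q0) => ? [].
  exists (exist _ q (conj solq xq)) => s As; apply/asboolP => /=.
  by apply: Aq; exists s.
exists p.1, p.2; split; [split => //|exact: xp.1|exact: xp.2].
move=> [y [Ty [soly pTy yp]]].
have py : extends p (y, Ty) by split => //; exact: ltW.
have xy : extends (x, Tx) (y, Ty) by exact: extends_trans py.
have /asboolP[/= Typ _] := pmax (exist _ (y, Ty) (conj soly xy)) (asboolT py).
by have := lt_le_trans pTy Typ; rewrite ltxx.
Qed.

End maximal_solutions.

Section clamping.
Context {R : realType} (n : nat).

(** Truncation by coordinates is plainly nonexpansive. Composed with it, a flow that is Lipschitz on
    balls becomes globally Lipschitz and bounded, as Picard iteration requires. *)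
Definition clamp (M : R) (x : 'rV[R]_n) : 'rV[R]_n :=
  \row_i Num.max (- M) (Num.min M (x ord0 i)).

Lemma clamp_id (M : R) x : enorm x <= M -> clamp M x = x.
Proof.
move=> xM; apply/rowP => i; rewrite mxE.
have := le_trans (coord_le_enorm x i) xM; rewrite ler_norml => /andP[? ?].
by rewrite (min_idPr _)// (max_idPr _).
Qed.

Lemma clamp_lip (M : R) x y : enorm (clamp M x - clamp M y) <= enorm (x - y).
Proof.
have sub1 p q : Num.max (- M) (Num.min M p) - Num.max (- M) (Num.min M q) <= `|p - q|.
  have pq := ler_norm (p - q); have pq0 := normr_ge0 (p - q).
  by rewrite /Num.max /Num.min; case: (ltP M p) => ?; case: (ltP M q) => ?;
    case: ltP => ?; case: ltP => ?; lra.
apply: le_enorm => i; rewrite !mxE ler_norml sub1 andbT.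
by rewrite lerNl opprB (le_trans (sub1 _ _))// distrC.
Qed.

Lemma enorm_clamp (M : R) x : 0 <= M -> enorm (clamp M x) <= n%:R * M.
Proof.
move=> M0; rewrite (le_trans (ler_enorm_sum _))//.
rewrite -[in n%:R](card_ord n) mulr_natl -sumr_const; apply: ler_sum => i _.
rewrite mxE ler_norml le_max lexx/= ge_max ge_min lexx/= andbT.
by rewrite (le_trans _ M0)// oppr_le0.
Qed.

End clamping.

Lemma lipschitz_curve_continuous (R : realType) n (C : R) (z : R -> 'rV[R]_n) :
  lipschitz_curve C z -> continuous z.
Proof.
move=> zC t; apply/cvgrPdist_le => e e0.
have C1 : 0 < `|C| + 1 by rewrite ltr_wpDl.
near=> s; rewrite (le_trans (norm_le_enorm _))// (le_trans (zC _ _))//.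
rewrite (le_trans (_ : _ <= (`|C| + 1) * `|t - s|))//.
  by rewrite ler_wpM2r// (le_trans (ler_norm _))// lerDl.
rewrite mulrC -ler_pdivlMr//.
by near: s; apply: cvgr_dist_le; [exact: cvg_id|rewrite divr_gt0].
Unshelve. all: by end_near. Qed.

Section continuation.
Context {R : realType} (n m : nat) (S : @impulsive_system R n m).
Variable v : R -> 'rV[R]_m.
Let F t x := flow S t x (v t).

Hypothesis v_meas : lebesgue_measurable_fun (Rge0 R) v.
Hypothesis F_loclip : forall M, exists2 A, 0 < A & forall t x y, 0 <= t ->
  enorm x <= M -> enorm y <= M -> enorm (F t x - F t y) <= A * enorm (x - y).
Hypothesis F_bound0 : exists q, forall t, 0 <= t -> enorm (F t 0) <= q.

Lemma clamp_loclip M : 0 <= M -> exists2 A, 0 < A & forall t x y, 0 <= t ->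
  enorm (F t (clamp M x) - F t (clamp M y)) <= A * enorm (x - y).
Proof.
move=> M0; have [A A0 FA] := F_loclip (n%:R * M); exists A => // t x y t0.
rewrite (le_trans (FA _ _ _ t0 _ _)) ?enorm_clamp//.
by rewrite ler_wpM2l ?clamp_lip// ltW.
Qed.

(** The clamped equation has solutions for all times; they solve the original one, apart from the
    jumps, while their norm is at most M. *)
Lemma truncated_solution M a xi : 0 <= M -> 0 <= a ->
  exists z C, [/\ z a = xi, lipschitz_curve C z &
    \forall t \ae leb, a < t -> is_derive (t : R) (1 : R) z (F t (clamp M (z t)))].
Proof.
move=> M0 a0; have [A A0 FA] := clamp_loclip M0; have [q Fq] := F_bound0.
have [B B0 FB] := F_loclip (n%:R * M).
have FQ t x : 0 <= t -> enorm (F t (clamp M x)) <= q + B * (n%:R * M).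
  move=> t0; have := ler_enormD (F t (clamp M x) - F t 0) (F t 0).
  rewrite subrK => /le_trans; apply; rewrite addrC lerD ?Fq//.
  rewrite (le_trans (FB _ _ _ t0 (enorm_clamp _ M0) _))//.
    by rewrite enorm0 mulr_ge0.
  by rewrite subr0 ler_wpM2l ?(ltW B0) ?enorm_clamp.
have Fm (y : R -> 'rV[R]_n) C i : lipschitz_curve C y ->
    @measurable_fun _ _ (lebesgueR R) R (Rge0 R) (fun t => F t (clamp M (y t)) ord0 i).
  move=> yC.
  apply: (@superposition_measurable R n m (Rge0 R) (fun t p q => flow S t p q ord0 i)).
  - by apply: sub_caratheodory; exact: measurable_itv.
  - by move=> p q'; apply: measurable_coord; exact: flow_measurable.
  - move=> t; rewrite /= in_itv/= andbT => t0 p.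
    apply: (@continuous_comp _ _ _ (fun p : 'rV[R]_n * 'rV[R]_m => flow S t p.1 p.2)
      (fun p : 'rV[R]_n => p ord0 i)); last exact: coord_continuous.
    exact: flow_continuous.
  - move=> j; rewrite (_ : (fun t => _) = fun t => Num.max (- M) (Num.min M (y t ord0 j))); last first.
      by apply/funext => t; rewrite mxE.
    apply: measurable_maxr; first exact: measurable_cst.
    apply: measurable_minr; first exact: measurable_cst.
    have cy : continuous (fun t => y t ord0 j).
      move=> t; apply: (@continuous_comp _ _ _ y (fun p : 'rV[R]_n => p ord0 j)).
        exact: lipschitz_curve_continuous yC t.
      exact: coord_continuous.
    have my := continuous_measurable_fun cy.
    apply: measurable_funTS => _ Y mY; rewrite setTI; apply: sub_caratheodory.
    by rewrite -[X in measurable X]setTI; exact: my.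
  - by move=> j; exact: measurable_coord.
have [z [za zK dz]] := picard A0 FA FQ Fm xi a0.
by exists z, (n%:R * (q + B * (n%:R * M))).
Qed.

Lemma local_solution r xi : 0 <= r -> exists w C e, [/\ 0 < e, w r = xi,
  lipschitz_curve C w, forall t, r < t -> t < r + e -> ~ impulses S t &
  \forall t \ae leb, r < t < r + e -> is_derive (t : R) (1 : R) w (F t (w t))].
Proof.
move=> r0; have xi0 := enorm_ge0 xi.
have [||w [C [wr wC dw]]] := @truncated_solution (enorm xi + 1) r xi; [lra|by []|].
have [e e0 gap] := impulses_gap r (impulsesP S).
(* At speed at most C the curve needs longer than d to leave the ball of radius |xi| + 1, so the
   clamping is inactive until then. *)
pose d := Num.min e (`|C| + 1)^-1.
have d0 : 0 < d by rewrite lt_min e0 invr_gt0 ltr_wpDl.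
exists w, C, d; split => //.
- move=> t rt; rewrite -ltrBlDl lt_min => /andP[te _]; apply: gap; first by rewrite gt_eqF.
  by rewrite gtr0_norm// subr_gt0.
- apply: ae_leb_impl dw => t dwt /andP[rt]; rewrite -ltrBlDl lt_min => /andP[_ tC].
  have := dwt rt; rewrite clamp_id//.
  have := ler_enormD (w t - w r) (w r); rewrite subrK => /le_trans; apply.
  rewrite wr addrC lerD2l -wr (le_trans (wC _ _))//.
  rewrite gtr0_norm ?subr_gt0//.
  have t_r : 0 < t - r by rewrite subr_gt0.
  have C1 : 0 < `|C| + 1 by rewrite ltr_wpDl.
  have tC1 : (t - r) * (`|C| + 1) <= 1 by rewrite -ler_pdivlMr// div1r ltW.
  rewrite (le_trans (_ : C * (t - r) <= (t - r) * (`|C| + 1)))//.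
  by rewrite mulrC ler_pM2l// (le_trans (ler_norm _))// lerDl.
Qed.

Lemma initial_solution t0 x0 : 0 <= t0 -> exists x e, 0 < e /\
  is_solution S t0 x0 v x (t0 + e)%:E.
Proof.
move=> t00; have [w [C [e [e0 wt wC noimp dw]]]] := local_solution x0 t00.
exists w, e; split => //; split => //.
- by rewrite lte_fin ltrDl.
- move=> t1 t2 t01 t12 t2T _; split.
    move=> a b ab _; apply: (@ac_lip _ _ _ _ _ C) => s t _ st _.
    by have := wC s t; rewrite ger0_norm// subr_ge0.
  apply: ae_leb_impl (ae_leb_and (ae_leb_neq t0) dw) => t [tt0 dwt] [t1t tt2].
  apply: dwt; apply/andP; split; first by rewrite lt_neqAle eq_sym tt0 (le_trans t01).
  by rewrite -lte_fin; exact: lt_le_trans t2T.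
- by move=> t imp t0t; rewrite lte_fin => te; have := noimp t t0t te.
Qed.

(** Clamping is inactive along x, so x and z solve the same globally Lipschitz equation, and
    Gronwall's inequality for x - z applies with initial value 0. *)
Lemma flow_unique M t0 x0 x Tx a b z C : 0 <= t0 -> 0 <= M ->
  is_solution S t0 x0 v x Tx ->
  t0 <= a -> a <= b -> (b%:E < Tx)%E ->
  (forall t, a < t -> t <= b -> ~ impulses S t) ->
  (forall t, a <= t -> t <= b -> enorm (x t) <= M) ->
  z a = x a -> lipschitz_curve C z ->
  (\forall t \ae leb, a < t -> is_derive (t : R) (1 : R) z (F t (clamp M (z t)))) ->
  x b = z b.
Proof.
move=> t00 M0 solx t0a ab bT noimp xM za zC dz.
have [acx dx] := solution_flow solx t0a ab bT noimp.
have [A A0 FA] := clamp_loclip M0.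
have zC' s t : s <= t -> enorm (z t - z s) <= C * (t - s).
  by move=> st; have := zC s t; rewrite ger0_norm// subr_ge0.
have := @gronwall R n a b A (M + (M + `|C| * (b - a))) 0 (fun t => x t - z t) (fun=> 0)
  ab (ltW A0).
have xza : x a - z a = 0 by rewrite za subrr.
rewrite xza enorm0 subr0 => H.
have : enorm (x b - z b) * expR (- A * (b - a)) <= 0.
  rewrite -[leLHS]subr0; apply: H.
  - by apply: acB => //; apply: (@ac_lip _ _ _ _ _ C) => s t _ st _; exact: zC'.
  - move=> t at_ tb; rewrite (le_trans (ler_enormB _ _))// lerD ?xM//.
    have := ler_enormD (z t - z a) (z a); rewrite subrK => /le_trans; apply.
    rewrite addrC lerD//; first by rewrite za xM.
    rewrite (le_trans (zC' _ _ at_))// (le_trans (ler_wpM2r _ (ler_norm C))) ?subr_ge0//.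
    by rewrite ler_wpM2l// lerB.
  - by move=> s t _ _ _; rewrite ?subr0 normr0 mul0r.
  - apply: ae_leb_impl (ae_leb_and dx dz) => t [dxt dzt] /andP[at_ tb].
    exists (F t (x t) - F t (clamp M (z t))), 0; split => //.
    + have := dxt _; rewrite at_ tb => /(_ isT) ?; have ? := dzt at_.
      exact: is_deriveB.
    + exact: is_derive_cst.
    + rewrite addr0; have tge0 : 0 <= t.
        exact: le_trans (le_trans t00 t0a) (ltW at_).
      by have := FA t (x t) (z t) tge0; rewrite (clamp_id (xM _ (ltW at_) (ltW tb))).
rewrite pmulr_lle0 ?expR_gt0// => xz0; apply/eqP; rewrite -subr_eq0; apply/eqP.
by apply/enorm_eq0/eqP; rewrite eq_le xz0 enorm_ge0.
Qed.

(** Just before r the bounded solution x agrees with a clamped solution z that is defined beyond r.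
    Thus x has the left limit z(r), from which a jump, if r is an impulse, and a local solution
    continue it. *)
Lemma solution_extension M t0 x0 x r : 0 <= t0 -> 
  is_solution S t0 x0 v x r%:E ->
  (forall t, t0 <= t -> t < r -> enorm (x t) <= M) ->
  exists y e, [/\ 0 < e, is_solution S t0 x0 v y (r + e)%:E &
    forall t, t < r -> y t = x t].
Proof.
move=> t00 solx xM; have [t0r xt0 flowx jumpx] := solx.
rewrite lte_fin in t0r.
have M0 : 0 <= M by apply: le_trans (xM t0 (lexx _) t0r); exact: enorm_ge0.
have [e e0 gap] := impulses_gap r (impulsesP S).
pose tau := Num.max t0 (r - e / 2).
have t0tau : t0 <= tau by rewrite le_max lexx.
have taur : tau < r by rewrite gt_max t0r/= ltrBlDr ltrDl divr_gt0.
have noimp t : tau < t -> t < r -> ~ impulses S t.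
  move=> taut tr; apply: gap; first by rewrite lt_eqF.
  have : r - e / 2 < t by apply: le_lt_trans taut; rewrite le_max lexx orbT.
  by rewrite ltr0_norm ?subr_lt0//; lra.
have [z [C [ztau zC dz]]] := truncated_solution (x tau) M0 (le_trans t00 t0tau).
have xz s : tau <= s -> s < r -> x s = z s.
  move=> taus sr; apply: (flow_unique t00 M0 solx t0tau taus _ _ _ ztau zC dz).
  - by rewrite lte_fin.
  - by move=> t taut ts; apply: noimp => //; exact: le_lt_trans sr.
  - move=> t taut ts; apply: xM; first exact: le_trans taut.
    exact: le_lt_trans sr.
pose xi := if `[< impulses S r >] then z r + jump S r (z r) (v r) else z r.
have [w [D [d [d0 wr wD noimpw dw]]]] := local_solution xi (le_trans t00 (ltW t0r)).
pose y t := if t < r then x t else w t.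
have yx t : t < r -> y t = x t by rewrite /y => ->.
have yw t : r <= t -> y t = w t by rewrite /y ltNge => ->.
have lip_ac C' z' a b : lipschitz_curve C' z' -> absolutely_continuous a b z'.
  move=> zC'; apply: (@ac_lip _ _ _ _ _ C') => s t _ st _.
  by have := zC' s t; rewrite ger0_norm// subr_ge0.
exists y, d; split => //; split.
- by rewrite lte_fin (lt_trans t0r)// ltrDl.
- by rewrite yx.
- move=> t1 t2 t01 t12 t2T noimp12; split.
    move=> a b ab abT.
    have [t1a _] : itvco_ext t1 t2 a by apply: abT; rewrite /= in_itv/= lexx ab.
    have [_ bt2] : itvco_ext t1 t2 b by apply: abT; rewrite /= in_itv/= lexx ab.
    have acx a' b' : t1 <= a' -> a' <= b' -> b' <= b -> b' < r ->
        absolutely_continuous a' b' y.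
      move=> t1a' ab' b'b b'r.
      apply: (@eq_ac _ _ _ _ x).
        by move=> t _ tb; rewrite yx// (le_lt_trans tb).
      have b't2 : (b'%:E < t2)%E by apply: le_lt_trans bt2; rewrite lee_fin.
      have [|||acx _] := flowx t1 (Order.min t2 r%:E) t01.
      + by rewrite lt_min t12 lte_fin/= (le_lt_trans t1a')// (le_lt_trans ab').
      + by rewrite ge_min lexx orbT.
      + by move=> t t1t; rewrite lt_min => /andP[tt2 _]; exact: noimp12.
      apply: acx => // t /=; rewrite in_itv/= => /andP[a't tb']; split.
        exact: le_trans a't.
      rewrite lt_min lte_fin (le_lt_trans tb')// andbT.
      by apply: le_lt_trans b't2; rewrite lee_fin.
    have [br|rb] := ltP b r; first exact: acx.
    have [ra|ar] := leP r a.
      apply: (@eq_ac _ _ _ _ w); last exact: lip_ac wD.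
      by move=> t at_ _; rewrite yw// (le_trans ra).
    have nimpr : ~ impulses S r.
      apply: noimp12; first exact: le_lt_trans ar.
      by apply: le_lt_trans bt2; rewrite lee_fin.
    have wzr : w r = z r by rewrite wr /xi; case: asboolP.
    (* With no impulse at r the curve is continuous there, and it is glued from x up to p, z from p
       to r, and w after r. *)
    pose p := Num.max a tau.
    have pr : p < r by rewrite gt_max ar.
    have ap : a <= p by rewrite le_max lexx.
    have taup : tau <= p by rewrite le_max lexx orbT.
    apply: (@ac_cat _ _ _ p).
      by apply: acx => //; rewrite (le_trans (ltW pr)).
    apply: (@ac_cat _ _ _ r).
      apply: (@eq_ac _ _ _ _ z); last exact: lip_ac zC.
      move=> t pt; rewrite le_eqVlt => /orP[/eqP ->|tr]; first by rewrite yw.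
      by rewrite yx// xz// (le_trans taup).
    apply: (@eq_ac _ _ _ _ w); last exact: lip_ac wD.
    by move=> t rt _; rewrite yw.
  have dx : \forall t \ae leb, itvco_ext t1 (Order.min t2 r%:E) t ->
      is_derive (t : R) (1 : R) x (flow S t (x t) (v t)).
    have [t1r|rt1] := ltP t1 r; last first.
      apply: aeW => t [t1t]; rewrite lt_min lte_fin => /andP[_ tr].
      by have := lt_le_trans tr (le_trans rt1 t1t); rewrite ltxx.
    have [|||_ //] := flowx t1 (Order.min t2 r%:E) t01.
    + by rewrite lt_min t12 lte_fin.
    + by rewrite ge_min lexx orbT.
    + by move=> t t1t; rewrite lt_min => /andP[tt2 _]; exact: noimp12.
  apply: ae_leb_impl (ae_leb_and (ae_leb_neq r) (ae_leb_and dx dw)).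
  move=> t [/eqP tr [dxt dwt]] [t1t tt2].
  have [tr'|rt] := ltP t r.
    rewrite yx//; apply: near_eq_is_derive (dxt _); last first.
      by split => //; rewrite lt_min tt2 lte_fin.
    have : t \in `]t - 1, r[ by rewrite in_itv/= tr' andbT ltrBlDr ltrDl.
    move=> /near_in_itvoo; apply: filterS => s; rewrite in_itv/= => /andP[_ sr].
    by rewrite yx.
  have {}rt : r < t by rewrite lt_neqAle rt andbT; apply/eqP => rt'; apply: tr.
  have td : t < r + d by rewrite -lte_fin; exact: lt_le_trans t2T.
  rewrite yw ?(ltW rt)//; apply: near_eq_is_derive (dwt _); last by rewrite rt.
  have : t \in `]r, t + 1[ by rewrite in_itv/= rt/= ltrDl.
  move=> /near_in_itvoo; apply: filterS => s; rewrite in_itv/= => /andP[rs _].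
  by rewrite yw// ltW.
- move=> t imp t0t; rewrite lte_fin => td.
  have [tr|rt|tr] := ltgtP t r.
  + have [|l xl xt] := jumpx t imp t0t; first by rewrite lte_fin.
    exists l; last by rewrite yx.
    apply: cvg_trans xl; apply: near_eq_cvg; near=> s; rewrite yx//.
    apply: lt_trans tr; near: s; exact: nbhs_left_lt.
  + by have := noimpw t rt td.
  + rewrite tr in imp t0t *; exists (z r); last first.
      by rewrite yw// wr /xi; case: asboolP.
    have zr : z s @[s --> r] --> z r by exact: lipschitz_curve_continuous zC r.
    have zl : z s @[s --> r^'-] --> z r by exact: cvg_at_left_filter zr.
    apply: cvg_trans zl; apply: near_eq_cvg; near=> s.
    rewrite yx; last by near: s; exact: nbhs_left_lt.
    rewrite xz//; by near: s; exact: nbhs_left_ge.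
Unshelve. all: by end_near. Qed.

Lemma global_solution M t0 x0 : 0 <= t0 ->
  (forall y Ty, is_maximal_solution S t0 x0 v y Ty ->
     forall t, itvco_ext t0 Ty t -> enorm (y t) <= M) ->
  exists y, is_maximal_solution S t0 x0 v y +oo%E.
Proof.
move=> t00 yM; have [w [e [e0 solw]]] := initial_solution x0 t00.
have [y [Ty [maxy _ _]]] := maximal_extension solw.
have [soly nexty] := maxy.
case: Ty => [r| |] in maxy soly nexty *; last 2 first.
- by exists y.
- by case: soly.
have [|z [d [d0 solz zy]]] := @solution_extension M t0 x0 y r t00 soly.
  by move=> t t0t tr; apply: (yM _ _ maxy); split => //; rewrite lte_fin.
exfalso; apply: nexty; exists z, (r + d)%:E; split => //.
  by rewrite lte_fin ltrDl.
by move=> t [_]; rewrite lte_fin; exact: zy.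
Qed.

End continuation.

(** * Comparison functions, truncated inputs and energies *)

Section comparison_functions.
Context {R : realType}.
Implicit Types (a N : R -> R) (b : R -> R -> R).

Lemma class_K0 a : class_K a -> a 0 = 0.
Proof. by case. Qed.

Lemma class_K_lt a r s : class_K a -> 0 <= r -> r < s -> a r < a s.
Proof.
move=> [_ inc _] r0 rs; apply: inc => //; rewrite in_itv/= andbT//.
exact: le_trans (ltW rs).
Qed.

Lemma class_K_le a r s : class_K a -> 0 <= r -> r <= s -> a r <= a s.
Proof.
move=> aK r0; rewrite le_eqVlt => /orP[/eqP->//|rs].
exact/ltW/class_K_lt.
Qed.

Lemma class_K_ge0 a r : class_K a -> 0 <= r -> 0 <= a r.
Proof. by move=> aK r0; rewrite -(class_K0 aK) class_K_le. Qed.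

Lemma ncont_le N r s : nondecreasing_continuous N -> 0 <= r -> r <= s -> N r <= N s.
Proof.
move=> [_ inc _] r0 rs; apply: inc => //; rewrite in_itv/= andbT//.
exact: le_trans rs.
Qed.

Lemma ncont_ge0 N r : nondecreasing_continuous N -> 0 <= r -> 0 <= N r.
Proof. by case=> _ _; apply. Qed.

Lemma within_ge0_continuousP a : {within Rge0 R, continuous a} <->
  forall r e, 0 <= r -> 0 < e -> exists2 d, 0 < d &
    forall s, 0 <= s -> `|s - r| < d -> `|a s - a r| <= e.
Proof.
split=> [/subspace_continuousP ca r e r0 e0|H].
  have /(_ _)/cvgrPdist_le/(_ e e0) := ca r.
  rewrite /= in_itv/= andbT => /(_ r0)[d/= d0 ad].
  exists d => // s s0 sr; rewrite distrC; apply: ad; rewrite /= ?in_itv/= ?andbT//.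
  by rewrite distrC.
apply/subspace_continuousP => r; rewrite /= in_itv/= andbT => r0.
apply/cvgrPdist_le => e e0; have [d d0 ad] := H r e r0 e0.
exists d => // s /= sr; rewrite in_itv/= andbT => s0.
by rewrite distrC; apply: ad => //; rewrite distrC.
Qed.

Lemma class_K_small a e : class_K a -> 0 < e ->
  exists2 d, 0 < d & forall r, 0 <= r -> r <= d -> a r <= e.
Proof.
move=> [ca _ a0] e0.
have [d d0 ad] := (within_ge0_continuousP a).1 ca 0 e (lexx 0) e0.
exists (d / 2) => [|r r0 rd]; first by rewrite divr_gt0.
have := ad r r0; rewrite subr0 a0 subr0 ger0_norm// => rd'.
rewrite (le_trans (ler_norm _))// rd'// (le_lt_trans rd)//.
by rewrite ltr_pdivrMr// ltr_pMr// ltr1n.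
Qed.

Lemma class_KL_le b r s t : class_KL b -> 0 <= r -> 0 <= s -> s <= t ->
  b r t <= b r s.
Proof.
move=> [_ bL] r0 s0 st; have [inc _] := bL r r0.
by apply: inc => //; rewrite in_itv/= andbT// (le_trans s0).
Qed.

Lemma class_KL_lel b r s t : class_KL b -> 0 <= r -> r <= s -> 0 <= t ->
  b r t <= b s t.
Proof. by move=> [bK _] r0 rs t0; have [aK _] := bK t t0; exact: (class_K_le aK r0 rs). Qed.

Lemma class_KL_ge0 b r t : class_KL b -> 0 <= r -> 0 <= t -> 0 <= b r t.
Proof. by move=> [bK _] r0 t0; have [aK _] := bK t t0; exact: (class_K_ge0 aK r0). Qed.

Lemma class_KL_small b r e : class_KL b -> 0 <= r -> 0 < e ->
  exists T : nat, (0 < T)%N /\ b r T%:R <= e.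
Proof.
move=> bKL r0 e0; have [_ bL] := bKL; have [_] := bL r r0.
move=> /cvgrPdist_le/(_ e e0)[M [_ HM]].
pose T := (Num.bound M).+1; exists T; split => //.
have : M < T%:R.
  by rewrite (lt_trans (unstable.ltr_bound M))// ltr_nat.
move=> /HM; rewrite sub0r normrN; apply: le_trans; exact: ler_norm.
Qed.

End comparison_functions.

Section truncated_inputs.
Context {R : realType} (m : nat).

(** Large values are sent to 0 and not rescaled to norm c: in the hypotheses on the input the
    difference is then mu itself and the minimum of the two norms is 0, which leaves the constants
    [Of 0] and [Og 0]. *)
Definition truncate (c : R) (p : 'rV[R]_m) : 'rV[R]_m :=
  if enorm p <= c then p else 0.

Lemma enorm_truncate c p : 0 <= c -> enorm (truncate c p) <= c.
Proof. by move=> c0; rewrite /truncate; case: ifP => // _; rewrite enorm0. Qed.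

Lemma truncate_measurable c (D : set R) (u : R -> 'rV[R]_m) :
  lebesgue_measurable_fun D u ->
  lebesgue_measurable_fun D (fun t => truncate c (u t)).
Proof.
move=> mu mD O mO.
have mc : @measurable _ (lebesgueR R) (D `&` [set t | enorm (u t) <= c]).
  have := lebesgue_measurable_enorm mu mD (measurable_itv `]-oo, c]).
  by congr (@measurable _ (lebesgueR R) (_ `&` _)); apply/seteqP; split => t /=;
    rewrite in_itv.
have mc' : @measurable _ (lebesgueR R) (D `\` (D `&` [set t | enorm (u t) <= c])).
  exact: measurableD.
have mO' := mu mD O mO.
have [zO|nzO] := pselect (O 0).
  rewrite [X in measurable X](_ : _ = ((D `&` u @^-1` O) `&` (D `&` [set t | enorm (u t) <= c])) `|`
    (D `\` (D `&` [set t | enorm (u t) <= c]))).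
    by apply: measurableU => //; exact: measurableI.
  apply/seteqP; split => t /=; rewrite /truncate.
    by move=> [Dt]; case: ifPn => [uc|/negP nuc] Ot; [left|right; split => // -[_]].
  by move=> [[[Dt Ot] [_ ->]]//|[Dt nuc]]; split => //; case: ifP => // uc; case: nuc.
rewrite [X in measurable X](_ : _ = (D `&` u @^-1` O) `&` (D `&` [set t | enorm (u t) <= c])).
  exact: measurableI.
apply/seteqP; split => t /=; rewrite /truncate.
  by move=> [Dt]; case: ifPn => [uc|/negP nuc] Ot.
by move=> [[Dt Ot] [_ ->]].
Qed.

Lemma input_sup_norm_le c (v : R -> 'rV[R]_m) (I gamma : set R) : 0 <= c ->
  (forall t, enorm (v t) <= c) ->
  0 <= fine (input_sup_norm v I gamma) <= c.
Proof.
move=> c0 vc.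
have n0 : (0 <= input_sup_norm v I gamma)%E.
  by rewrite /input_sup_norm le_max; apply/orP; right; apply: ereal_sup_ubound; left.
have nc : (input_sup_norm v I gamma <= c%:E)%E.
  rewrite /input_sup_norm ge_max; apply/andP; split.
    apply/ess_supP; apply: aeW => t /=; rewrite lee_fin patchE.
    by case: ifP.
  by apply: ge_ereal_sup => _ [->|[t _ <-]]; rewrite lee_fin.
rewrite fine_ge0//= -lee_fin fineK// ge0_fin_numE//.
by rewrite (le_lt_trans nc)// ltry.
Qed.

End truncated_inputs.

Section bootstrapping.
Context {R : realType}.

Lemma real_ac_uniform (a b : R) (f : R -> R) : real_ac a b f ->
  forall e, 0 < e -> exists2 d, 0 < d &
    forall s t, a <= s -> s <= t -> t <= b -> t - s < d -> `|f t - f s| < e.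
Proof.
move=> fac e e0; have [d d0 fd] := fac e e0; exists d => // s t as_ st tb std.
have := fd 1%N (fun=> s) (fun=> t); rewrite !big_ord1; apply => //.
by move=> i j _ _ _; rewrite (ord1 i) (ord1 j).
Qed.

(* A bound that improves itself propagates: the set where [f <= e0] is open and
   closed in [a, b]. *)
Lemma bootstrap (a b B e0 : R) (f : R -> R) : a <= b -> B < e0 ->
  real_ac a b f -> f a <= e0 ->
  (forall s, a <= s -> s <= b -> (forall r, a <= r -> r <= s -> f r <= e0) ->
     f s <= B) ->
  f b <= B.
Proof.
move=> ab Be0 fac fa impr.
have e20 : 0 < (e0 - B) / 2 by rewrite divr_gt0// subr_gt0.
have [d d0 fd] := real_ac_uniform fac e20.
(* The weak bound e0 on [a, p] improves to B at p, and f increases by less than (e0 - B) / 2 from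
   there to any point up to q. *)
pose P p q := (forall r, a <= r -> r <= p -> f r <= e0) ->
  forall r, a <= r -> r <= q -> f r <= e0.
have [|p [N [p0 pN pm PN]]] := @cousin R P a b ab.
  move=> t at_ tb; exists d => // p q ap pt tq qb qpd fp r ar rq.
  have [rp|pr] := leP r p; first exact: fp.
  have pb : p <= b by exact: le_trans pt tb.
  have := fd p r ap (ltW pr) (le_trans rq qb).
  have -> : r - p < d by apply: le_lt_trans qpd; rewrite lerB.
  move=> /(_ isT) H; have := impr p ap pb fp.
  by move: H; rewrite ltr_norml => /andP[_]; lra.
have Pb : forall r, a <= r -> r <= b -> f r <= e0.
  rewrite -pN; have : (N <= N)%N by [].
  elim: {-2}N => [_ r ar|k IH kN].
    by rewrite p0 => ra; rewrite (_ : r = a)//; apply/eqP; rewrite eq_le ra.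
  by apply: PN => //; apply: IH; exact: ltnW.
by apply: impr => // r ar rb; exact: Pb.
Qed.

Lemma cvg_left_enorm_le n (x : R -> 'rV[R]_n) (l : 'rV[R]_n) (a t B : R) :
  a < t -> x s @[s --> t^'-] --> l ->
  (forall s, a <= s -> s < t -> enorm (x s) <= B) -> enorm l <= B.
Proof.
move=> at_ xl xB.
have cl : enorm (x s) @[s --> t^'-] --> enorm l.
  exact: (continuous_cvg _ (@enorm_continuous R n l) xl).
apply: (@closed_cvg _ _ (t^'-) _ (fun s => enorm (x s)) [set r | r <= B]) cl.
  exact: closed_le.
near=> s; apply: xB.
  by near: s; exact: nbhs_left_ge.
by near: s; exact: nbhs_left_lt.
Unshelve. all: by end_near. Qed.

End bootstrapping.

Section tails.
Context {R : realType}.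

Definition tail (c : R) (phi : R -> R) (r : R) : R := if r <= c then 0 else phi r.

Lemma tail_ge0 c phi r : class_K phi -> 0 <= r -> 0 <= tail c phi r.
Proof. by move=> phiK r0; rewrite /tail; case: ifP => // _; exact: class_K_ge0. Qed.

(** A class K function is constrained on [0, +oo[ only; composed with [Num.max 0] it is continuous,
    hence Borel, on the line and unchanged on norms. *)
Lemma class_K_continuous (phi : R -> R) : class_K phi ->
  continuous (fun r : R => phi (Num.max 0 r)).
Proof.
move=> [/within_ge0_continuousP cphi _ _] r; apply/cvgrPdist_le => e e0.
have max0 (s : R) : 0 <= Num.max 0 s by rewrite le_max lexx.
have [d d0 phid] := cphi (Num.max 0 r) e (max0 r) e0.
exists d => //= s /= rs; rewrite distrC; apply: phid => //.
by rewrite (le_lt_trans (ler_dist_max _ _ _))// distrC.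
Qed.

Lemma class_K_measurable (phi : R -> R) m (D : set R) (u : R -> 'rV[R]_m) :
  class_K phi -> lebesgue_measurable_fun D u ->
  @measurable_fun _ _ (lebesgueR R) R D (fun t => phi (enorm (u t))).
Proof.
move=> phiK mu.
rewrite (_ : (fun t => _) = (fun r => phi (Num.max 0 r)) \o (fun t => enorm (u t))); last first.
  by apply/funext => t /=; rewrite (max_idPr (enorm_ge0 _)).
apply: (@measurableT_comp _ _ _ _ (measurableTypeR R)).
  exact: continuous_measurable_fun (class_K_continuous phiK).
exact: lebesgue_measurable_enorm.
Qed.

Lemma tail_measurable c (phi : R -> R) m (D : set R) (u : R -> 'rV[R]_m) :
  class_K phi -> lebesgue_measurable_fun D u ->
  @measurable_fun _ _ (lebesgueR R) R D (fun t => tail c phi (enorm (u t))).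
Proof.
move=> phiK mu.
rewrite (_ : (fun t => _) =
    (fun r => phi (Num.max 0 r) * \1_(`]c, +oo[%classic) r) \o (fun t => enorm (u t))); last first.
  apply/funext => t /=; rewrite (max_idPr (enorm_ge0 _)) indicE /tail.
  case: ifPn => [uc|]; [rewrite memNset ?mulr0//|rewrite -ltNge => cu; rewrite mem_set ?mulr1//].
  - by rewrite /= in_itv/= andbT; apply/negP; rewrite -leNgt.
  - by rewrite /= in_itv/= andbT.
apply: (@measurableT_comp _ _ _ _ (measurableTypeR R)).
  apply: measurable_funM; last by apply: measurable_indic; exact: measurable_itv.
  exact: continuous_measurable_fun (class_K_continuous phiK).
exact: lebesgue_measurable_enorm.
Qed.

End tails.

(** Inputs are only essentially bounded, while [bounded_primitive] takes a bounded integrand.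
    Capping k at K changes nothing where k(t) <= K and can only lower the integral. G then serves as
    the absorbing function of [gronwall]. *)
Lemma capped_primitive (R : realType) (k : R -> R) (W K : R) :
  @measurable_fun _ _ (lebesgueR R) R (Rge0 R) k -> (forall t, 0 <= k t) ->
  0 <= W -> 0 <= K ->
  exists G g : R -> R, [/\ (forall t, 0 <= g t),
    (forall t, 0 <= t -> k t <= K -> g t = W * k t),
    (forall s t, `|G t - G s| <= W * K * `|t - s|),
    (\forall t \ae leb, 0 < t -> is_derive (t : R) (1 : R) G (g t)) &
    (forall s t, 0 <= s -> s <= t -> G s <= G t) /\
    (forall a b d, 0 <= a -> a <= b ->
      (\int[leb]_(s in `]a, b]) (k s)%:E <= d%:E)%E -> G b - G a <= W * d)].
Proof.
move=> mk k0 W0 K0.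
pose h := (fun s => W * Num.min (k s) K) \_ (Rge0 R).
have h_ge0 s : 0 <= h s.
  rewrite /h patchE; case: ifPn => // _.
  by rewrite mulr_ge0// le_min k0.
have mge0 : @measurable _ (lebesgueR R) (Rge0 R).
  by apply: sub_caratheodory; exact: measurable_itv.
have mh : @measurable_fun _ _ (lebesgueR R) R setT h.
  apply/(measurable_restrictT _ _).1; first exact: mge0.
  apply: measurable_funM; first exact: measurable_cst.
  by apply: measurable_minr; [exact: mk|exact: measurable_cst].
have hQ s : `|h s| <= W * K.
  rewrite ger0_norm// /h patchE; case: ifPn => _; last by rewrite mulr_ge0.
  by rewrite ler_wpM2l// ge_min lexx orbT.
have [G [Glip dG Gint]] := bounded_primitive mh hQ.
have {}Gint := Gint h_ge0.
exists G, h; split => //.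
  move=> t t0 kK; rewrite /h patchE mem_set/= ?in_itv/= ?andbT//.
  by rewrite (min_idPl kK).
split.
  move=> s t s0 st; rewrite -subr_ge0 -lee_fin Gint//.
  by apply: integral_ge0 => r _; rewrite lee_fin.
move=> a b d a0 ab kd; rewrite -lee_fin Gint// EFinM.
apply: (@le_trans _ _ (W%:E * \int[leb]_(s in `]a, b]) (k s)%:E)%E); last first.
  by apply: lee_wpmul2l => //; rewrite lee_fin.
have sub : `]a, b]%classic `<=` Rge0 R.
  by move=> s /=; rewrite !in_itv/= andbT => /andP[as_ _]; exact: le_trans (ltW as_).
have mab : @measurable _ (lebesgueR R) `]a, b]%classic.
  by apply: sub_caratheodory; exact: measurable_itv.
have mkab : @measurable_fun _ _ (lebesgueR R) R `]a, b]%classic k.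
  exact: measurable_funS mge0 sub mk.
rewrite -ge0_integralZl_EFin; first last.
- exact: W0.
- by apply: measurableT_comp; [exact: EFin_measurable|exact: mkab].
- by move=> s _; rewrite lee_fin.
- exact: mab.
apply: ge0_le_integral.
- exact: mab.
- by move=> s _; rewrite lee_fin.
- apply: measurableT_comp; first exact: EFin_measurable.
  exact: measurable_funTS.
- apply: measurable_funeM; apply: measurableT_comp; [exact: EFin_measurable|exact: mkab].
- move=> s /sub abs; rewrite -EFinM lee_fin /h patchE mem_set//.
  by rewrite ler_wpM2l// ge_min lexx.
Qed.

Section hybrid_time.
Context {R : realType}.
Implicit Types (gamma : set R) (a b t : R).

Lemma impulse_count_le1 gamma a b : impulse_times gamma ->
  (forall t, a < t -> t < b -> ~ gamma t) ->
  (impulse_count gamma `]a, b]%classic <= 1)%N.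
Proof.
move=> gt ng; rewrite /impulse_count.
have sub : gamma `&` `]a, b]%classic `<=` [set b].
  move=> t [g]; rewrite /= in_itv/= => /andP[at_ tb].
  by case: (ltgtP t b) tb => // tb _; case: (ng t at_ tb g).
rewrite (leq_trans (n := #|` fset_set [set b]|))//.
  apply: fsubset_leq_card; apply/fsubsetP => t.
  rewrite !in_fset_set//; last exact: impulses_finite.
  by move=> /set_mem/sub/mem_set.
by rewrite fset_set1 cardfs1.
Qed.

(* The first time at which the hybrid time reaches [T]: it overshoots by at most
   one jump. *)
Lemma hybrid_time_mid gamma (t0 t T : R) : impulse_times gamma -> t0 <= t -> 0 <= T ->
  let h s := s - t0 + (impulse_count gamma `]t0, s]%classic)%:R in
  T <= h t -> exists s, [/\ t0 <= s, s <= t, T <= h s & h s <= T + 1].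
Proof.
move=> gt t0t T0 h Th.
have hD r s : t0 <= r -> r <= s -> h s = h r + (s - r) + (impulse_count gamma `]r, s]%classic)%:R.
  move=> t0r rs; rewrite /h (impulse_countD gt t0r rs) natrD.
  by ring.
pose S := [set s | t0 <= s /\ T <= h s].
have St : S t by [].
have infS : has_inf S by split; [exists t|exists t0 => s []].
pose s := inf S.
have st : s <= t by exact: ge_inf infS.2 _ St.
have t0s : t0 <= s by apply: lb_le_inf; [exists t|move=> ? []].
have before r : t0 <= r -> r < s -> h r < T.
  move=> t0r rs; rewrite ltNge; apply/negP => Tr.
  by have := ge_inf infS.2 (conj t0r Tr : S r); rewrite leNgt rs.
have [e e0 gap] := impulses_gap s gt.
exists s; split => //.
- rewrite leNgt; apply/negP => hsT.
  (* With no impulse right after s, the hybrid time would stay below T for a while, against the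
     choice of s as an infimum. *)
  have d0 : 0 < Num.min e (T - h s) by rewrite lt_min e0 subr_gt0.
  have [r [t0r Tr] rd] := inf_adherent d0 infS.
  have sr : s <= r by exact: ge_inf infS.2 _ (conj t0r Tr).
  have rs : r - s < Num.min e (T - h s) by rewrite ltrBlDl.
  have [rse rsT] : r - s < e /\ r - s < T - h s by move: rs; rewrite lt_min => /andP.
  move: Tr; rewrite (hD s r t0s sr) impulse_count0//; first by lra.
  move=> q sq qr; apply: gap; first by rewrite gt_eqF.
  by rewrite gtr0_norm ?subr_gt0// (le_lt_trans _ rse)// lerB.
- have [s0|t0s'] := leP s t0.
    have -> : s = t0 by apply/eqP; rewrite eq_le s0.
    rewrite /h subrr add0r impulse_count0 ?addr_ge0//.
    by move=> q t0q; rewrite leNgt t0q.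
  apply/ler_addgt0Pr => d d0.
  (* At r the hybrid time is still below T; from r to s it gains less than d in time and at most one
     impulse, at s itself. *)
  pose r := Num.max t0 (s - Num.min e d / 2).
  have ed0 : 0 < Num.min e d by rewrite lt_min e0.
  have rs : r < s by rewrite gt_max t0s'/= ltrBlDl ltrDr divr_gt0.
  have t0r : t0 <= r by rewrite le_max lexx.
  have sr : s - r <= Num.min e d / 2.
    by rewrite lerBlDl -lerBlDr le_max lexx orbT.
  have ed2 : Num.min e d / 2 < Num.min e d by rewrite ltr_pdivrMr// ltr_pMr// ltr1n.
  have [sre srd] : s - r < e /\ s - r < d.
    by move: (le_lt_trans sr ed2); rewrite lt_min => /andP.
  have c1 : (impulse_count gamma `]r, s]%classic)%:R <= 1 :> R.
    rewrite (ler_nat _ _ 1) impulse_count_le1// => q rq qs; apply: gap.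
      by rewrite lt_eqF.
    by rewrite ltr0_norm ?subr_lt0// opprB (le_lt_trans _ sre)// lerB// ltW.
  have := before r t0r rs.
  by rewrite (hD r s t0r (ltW rs)); lra.
Qed.

End hybrid_time.

Section energy.
Context {R : realType} (m : nat).
Implicit Types (u : R -> 'rV[R]_m) (gamma : set R).

Lemma input_int_norm_ge0 rho1 rho2 u (I gamma : set R) : class_K rho1 -> class_K rho2 ->
  (0 <= input_int_norm rho1 rho2 u I gamma)%E.
Proof.
move=> K1 K2; apply: adde_ge0.
  by apply: integral_ge0 => s _; rewrite lee_fin class_K_ge0// enorm_ge0.
by apply: esum_ge0 => s _; rewrite lee_fin class_K_ge0// enorm_ge0.
Qed.

Lemma measurable_class_K_itv rho u (a b : R) : class_K rho -> is_input u -> 0 <= a ->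
  @measurable_fun _ _ (lebesgueR R) (\bar R) `]a, b]%classic
    (fun s => (rho (enorm (u s)))%:E).
Proof.
move=> K1 [mu _] a0; apply: measurableT_comp; first exact: EFin_measurable.
apply: measurable_funS (class_K_measurable K1 mu).
  by apply: sub_caratheodory; exact: measurable_itv.
by move=> s /=; rewrite !in_itv/= andbT => /andP[as_ _]; exact: le_trans (ltW as_).
Qed.

Lemma input_int_norm_sub rho1 rho2 u gamma (t0 a b t : R) :
  class_K rho1 -> class_K rho2 -> is_input u -> 0 <= t0 -> t0 <= a -> b <= t ->
  (input_int_norm rho1 rho2 u `]a, b]%classic gamma <=
   input_int_norm rho1 rho2 u `]t0, t]%classic gamma)%E.
Proof.
move=> K1 K2 iu t00 t0a bt.
have sub : `]a, b]%classic `<=` `]t0, t]%classic by apply: subset_itv; rewrite bnd_simp.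
apply: leeD.
  apply: ge0_subset_integral.
  - by apply: sub_caratheodory; exact: measurable_itv.
  - by apply: sub_caratheodory; exact: measurable_itv.
  - exact: measurable_class_K_itv.
  - by move=> s _; rewrite lee_fin class_K_ge0// enorm_ge0.
  - exact: sub.
rewrite esum_mkcondr [leRHS]esum_mkcondr; apply: le_esum => s gs.
case: ifPn => [/set_mem/sub|_]; first by move=> /mem_set ->.
by case: ifPn => _ //; rewrite lee_fin class_K_ge0// enorm_ge0.
Qed.

(** Both parts of the energy are nonnegative, so the integral, and also each single impulse term, is
    bounded by the whole. *)
Lemma input_int_norm_tail rho1 rho2 phi1 phi2 u gamma (a b c k s : R) :
  class_K rho1 -> class_K rho2 -> class_K phi1 -> class_K phi2 ->
  is_input u -> 0 <= a -> 0 <= k ->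
  (forall r, 0 <= r -> tail c phi1 r <= k * rho1 r) ->
  (forall r, 0 <= r -> tail c phi2 r <= k * rho2 r) ->
  (input_int_norm rho1 rho2 u `]a, b]%classic gamma <= s%:E)%E ->
  (\int[leb]_(t in `]a, b]) (tail c phi1 (enorm (u t)))%:E <= (k * s)%:E)%E /\
  forall t, gamma t -> a < t -> t <= b -> tail c phi2 (enorm (u t)) <= k * s.
Proof.
move=> K1 K2 F1 F2 iu a0 k0 t1 t2 En.
have mab : @measurable _ (lebesgueR R) `]a, b]%classic.
  by apply: sub_caratheodory; exact: measurable_itv.
have i0 : (0 <= \int[leb]_(t in `]a, b]) (rho1 (enorm (u t)))%:E)%E.
  by apply: integral_ge0 => r _; rewrite lee_fin class_K_ge0// enorm_ge0.
have e0 : (0 <= \esum_(t in gamma `&` `]a, b]) (rho2 (enorm (u t)))%:E)%E.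
  by apply: esum_ge0 => r _; rewrite lee_fin class_K_ge0// enorm_ge0.
split.
- apply: (@le_trans _ _ (\int[leb]_(t in `]a, b]) (k%:E * (rho1 (enorm (u t)))%:E))%E).
    apply: ge0_le_integral.
    + exact: mab.
    + by move=> r _; rewrite lee_fin tail_ge0// enorm_ge0.
    + apply: measurableT_comp; first exact: EFin_measurable.
      apply: measurable_funS (tail_measurable c F1 iu.1).
        by apply: sub_caratheodory; exact: measurable_itv.
      by move=> r /=; rewrite !in_itv/= andbT => /andP[as_ _]; exact: le_trans (ltW as_).
    + by apply: measurable_funeM; exact: measurable_class_K_itv.
    + by move=> r _; rewrite -EFinM lee_fin t1// enorm_ge0.
  rewrite ge0_integralZl_EFin.
  + rewrite EFinM lee_wpmul2l ?lee_fin//.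
    by apply: le_trans En; rewrite leeDl.
  + exact: mab.
  + by move=> r _; rewrite lee_fin class_K_ge0// enorm_ge0.
  + exact: measurable_class_K_itv.
  + exact: k0.
- move=> t gt at_ tb; rewrite (le_trans (t2 _ (enorm_ge0 _)))// ler_wpM2l//.
  rewrite -lee_fin (le_trans _ En)// (le_trans _ (leeDr _ i0))//.
  rewrite -(@esum_set1 R R t (fun t => (rho2 (enorm (u t)))%:E)); last first.
    by rewrite lee_fin class_K_ge0// enorm_ge0.
  rewrite esum_mkcond [leRHS]esum_mkcond; apply: le_esum => r _.
  case: ifPn => [/set_mem -> |_].
    by rewrite mem_set//; split => //=; rewrite in_itv/= at_.
  by case: ifPn => _ //; rewrite lee_fin class_K_ge0// enorm_ge0.
Qed.

End energy.

(* A Lipschitz majorant of [f] that inherits its monotonicity. *)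
Definition supconv (R : realType) (f : R -> R) (z : R) : R :=
  sup [set f w - 2 * `|w - z| | w in [set w | 0 <= w]].

Section sup_convolution.
Context {R : realType} (f : R -> R).
Hypothesis f_le : forall w, 0 <= w -> f w <= w.

Let S z := [set f w - 2 * `|w - z| | w in [set w | 0 <= w]].

Let ubS z : ubound (S z) z.
Proof.
move=> _ [w w0 <-]; have := f_le w0; have := ler_norm (w - z).
by have := normr_ge0 (w - z); lra.
Qed.

Let supS z : has_sup (S z).
Proof.
split; last by exists z; exact: ubS.
by exists (f 0 - 2 * `|0 - z|); exists 0 => /=.
Qed.

Lemma supconv_lb z w : 0 <= w -> f w - 2 * `|w - z| <= supconv f z.
Proof. by move=> w0; apply: sup_upper_bound (supS z) _ _; exists w. Qed.

Lemma supconv_ge z : 0 <= z -> f z <= supconv f z.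
Proof. by move=> z0; have := supconv_lb z z0; rewrite subrr normr0 mulr0 subr0. Qed.

Lemma supconv_le z B : (forall w, 0 <= w -> f w - 2 * `|w - z| <= B) ->
  supconv f z <= B.
Proof. by move=> fB; apply: ge_sup (supS z).1 _ => _ [w w0 <-]; exact: fB. Qed.

Lemma supconv_le_id z : supconv f z <= z.
Proof. by apply: supconv_le => w w0; apply: ubS; exists w. Qed.

Lemma supconv_lip y z : `|supconv f y - supconv f z| <= 2 * `|y - z|.
Proof.
have lip r s : supconv f r - supconv f s <= 2 * `|r - s|.
  rewrite lerBlDr; apply: supconv_le => w w0; have := supconv_lb s w0.
  by have := ler_distD r w s; lra.
by rewrite ler_norml lip andbT lerNl opprB distrC lip.
Qed.

Lemma supconv_continuous : continuous (supconv f).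
Proof.
move=> z; apply/cvgrPdist_le => e e0; exists (e / 2) => /=; first by rewrite divr_gt0.
move=> y /= zy; rewrite (le_trans (supconv_lip _ _))//.
by rewrite mulrC -ler_pdivlMr// ltW.
Qed.

Lemma supconv_homo y z : (forall v w, 0 <= v -> v <= w -> f v <= f w) ->
  y <= z -> supconv f y <= supconv f z.
Proof.
move=> fle yz; apply: supconv_le => w w0.
have wz : w <= w + (z - y) by rewrite lerDl subr_ge0.
have := supconv_lb z (le_trans w0 wz); have := fle _ _ w0 wz.
by rewrite (_ : w + (z - y) - z = w - y); [lra|ring].
Qed.

Lemma supconv_anti y z : (forall v w, 0 <= v -> v <= w -> f w <= f v) ->
  0 <= y -> y <= z -> supconv f z <= supconv f y.
Proof.
move=> fle y0 yz; apply: supconv_le => w w0.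
have [wz|wz] := leP (z - y) w.
  have v0 : 0 <= w - (z - y) by rewrite subr_ge0.
  have := supconv_lb y v0; have := fle _ w v0.
  rewrite gerBl subr_ge0 => /(_ yz).
  by rewrite (_ : w - (z - y) - y = w - z); [lra|ring].
(* Here the shifted point w - (z - y) would be negative; 0 replaces it, where f is largest and the
   penalty 2y is still below 2(z - w). *)
have := supconv_lb y (lexx 0); have := fle _ _ (lexx 0) w0.
rewrite sub0r normrN (ger0_norm y0) distrC ger0_norm; first by lra.
by lra.
Qed.

End sup_convolution.

Section comparison_constructions.
Context {R : realType}.

(** Minus the sup-convolution of -phi is a continuous nondecreasing minorant g, positive on z > 0.
    The factor z / (1 + |z|) adds strict growth and the value 0 at 0; it tends to 1, so g z / (1 +
    |z|) remains unbounded. *)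
Lemma class_Kinfty_minorant (phi : R -> R) : (forall z, 0 < z -> 0 < phi z) ->
  (forall y z, 0 < y -> y <= z -> phi y <= phi z) ->
  (forall M, exists2 z, 0 < z & M < phi z) ->
  exists2 a, class_Kinfty a & forall z, 0 < z -> a z <= phi z.
Proof.
move=> phi0 phile phioo.
pose f w := if w <= 0 then 0 else - phi w.
have fE w : 0 < w -> f w = - phi w by move=> w0; rewrite /f lt_geF.
have f_le0 w : f w <= 0.
  by rewrite /f; have [//|w0] := leP w 0; rewrite oppr_le0 ltW// phi0.
have fle v w : 0 <= v -> v <= w -> f w <= f v.
  move=> v0 vw; rewrite [f v]/f; have [v0'|v_gt0] := leP v 0; first exact: f_le0.
  by rewrite fE ?(lt_le_trans v_gt0)// lerN2 phile.
have f_le w : 0 <= w -> f w <= w by exact: le_trans.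
pose g z := - supconv f z.
have g_phi z : 0 < z -> g z <= phi z.
  move=> z0; have := supconv_ge f_le (ltW z0).
  by rewrite /g fE// lerNl.
(* Points w below z / 2 pay a penalty of at least z, and beyond z / 2 monotonicity gives phi(w) >=
   phi(z / 2). *)
have g_ge z : 0 < z -> Num.min z (phi (z / 2)) <= g z.
  move=> z0; rewrite /g lerNr; apply: supconv_le => // w w0.
  have z2 : 0 < z / 2 by rewrite divr_gt0.
  have [wz|wz] := leP w (z / 2).
    rewrite (le_trans (_ : _ <= - z))// ?lerN2 ?ge_min ?lexx//.
    have := f_le0 w; rewrite distrC ger0_norm; last by lra.
    by lra.
  rewrite (le_trans (_ : _ <= - phi (z / 2)))// ?lerN2 ?ge_min ?lexx ?orbT//.
  rewrite fE ?(lt_trans z2 wz)// lerBlDr (le_trans (_ : _ <= - phi (z / 2)))//.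
    by rewrite lerN2 phile// ltW.
  by rewrite lerDl mulr_ge0.
have g_gt0 z : 0 < z -> 0 < g z.
  by move=> z0; rewrite (lt_le_trans _ (g_ge z z0))// lt_min z0 phi0// divr_gt0.
have g_le y z : 0 <= y -> y <= z -> g y <= g z.
  by move=> y0 yz; rewrite lerN2 supconv_anti.
have frac_lt (y z : R) : 0 <= y -> y < z -> y / (1 + `|y|) < z / (1 + `|z|).
  move=> y0 yz; have z0 := le_lt_trans y0 yz.
  rewrite (ger0_norm y0) (gtr0_norm z0) ltr_pdivrMr; last by rewrite ltr_wpDr.
  by rewrite mulrAC ltr_pdivlMr; [lra|rewrite ltr_wpDr// ltW].
exists (fun z => z / (1 + `|z|) * g z); last first.
  move=> z z0; rewrite (le_trans _ (g_phi z z0))// ler_piMl ?(ltW (g_gt0 z z0))//.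
  by rewrite gtr0_norm// ler_pdivrMr ?ltr_wpDr ?(ltW z0)// mul1r lerDr.
split; first split.
- apply: continuous_subspaceT => z; apply: cvgM.
    apply: cvgM; first exact: cvg_id.
    apply: cvgV; first by rewrite gt_eqF// ltr_wpDr.
    by apply: cvgD; [exact: cvg_cst|exact: cvg_norm].
  by apply: cvgN; exact: supconv_continuous.
- move=> y z; rewrite !in_itv/= !andbT => y0 z0 yz.
  rewrite (le_lt_trans (_ : _ <= y / (1 + `|y|) * g z))//.
    by rewrite ler_wpM2l ?g_le ?(ltW yz)// divr_ge0// addr_ge0.
  by rewrite ltr_pM2r ?frac_lt// g_gt0// (le_lt_trans y0).
- by rewrite mul0r mul0r.
move=> M; have [z z0 phiz] := phioo (2 * (`|M| + 1)).
pose r := Num.max (2 * z) (2 * (`|M| + 1)).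
have M1 : 1 <= `|M| + 1 by rewrite lerDr.
have zr : z <= r / 2 by rewrite ler_pdivlMr// mulrC le_max lexx.
have Mr : 2 * (`|M| + 1) <= r by rewrite le_max lexx orbT.
have r1 : 1 <= r by lra.
have r0 : 0 < r by lra.
exists r; first exact: ltW.
have gr : 2 * (`|M| + 1) <= g r.
  rewrite (le_trans _ (g_ge r r0))// le_min Mr/=.
  by rewrite (le_trans (ltW phiz))// phile.
have fr : 2^-1 <= r / (1 + `|r|).
  rewrite (gtr0_norm r0) ler_pdivlMr; last by lra.
  by lra.
rewrite (le_lt_trans (ler_norm M))// (lt_le_trans (_ : _ < 2^-1 * (2 * (`|M| + 1))))//.
  by lra.
by rewrite ler_pM// ?invr_ge0// mulr_ge0//; lra.
Qed.

(** Each [a k] is multiplied by a ramp that vanishes up to k - 1 and has reached 1 at k. Locally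
    only finitely many ramps are active, so the finite sums [G N] agree for large N, which gives
    continuity. *)
Lemma nondecreasing_continuous_majorant (a : nat -> R) : (forall k, 0 <= a k) ->
  exists S, [/\ nondecreasing_continuous S, forall r, 0 <= r -> 1 <= S r &
    forall k r, k%:R < r -> a k <= S r].
Proof.
move=> a0.
pose G N (r : R) : R := 1 + \sum_(k < N) a k * Num.max 0 (r - k%:R + 1).
pose S (r : R) := G (Num.bound r).+1 r.
have max0 (r : R) : 0 <= Num.max 0 r by rewrite le_max lexx.
have Geq N r j : r + 1 <= N%:R -> G (N + j)%N r = G N r.
  move=> rN; elim: j => [|j IH]; first by rewrite addn0.
  rewrite addnS -IH /G big_ord_recr/= [Num.max _ _]max_l ?mulr0 ?addr0//.
  have : N%:R <= (N + j)%:R :> R by rewrite ler_nat leq_addr.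
  by lra.
have GE N M r : r + 1 <= N%:R -> r + 1 <= M%:R -> G N r = G M r.
  move=> rN rM; have [NM|MN] := leqP N M.
    by rewrite -(subnKC NM) Geq.
  by rewrite -(subnKC (ltnW MN)) Geq.
have bnd (r : R) : r + 1 <= (Num.bound r).+1%:R.
  by rewrite -natr1 lerD2r ltW// unstable.ltr_bound.
have SE N r : r + 1 <= N%:R -> S r = G N r by move=> rN; exact: GE.
have GS N r s : r <= s -> G N r <= G N s.
  move=> rs; rewrite lerD2l; apply: ler_sum => k _; rewrite ler_wpM2l//.
  by rewrite ge_max max0/= le_max lerD2r lerD2r rs orbT.
have Sle r s : r <= s -> S r <= S s.
  move=> rs; rewrite (SE (Num.bound s).+1 r) ?GS//.
  by rewrite (le_trans _ (bnd s))// lerD2r.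
have S1 r : 1 <= S r by rewrite lerDl sumr_ge0// => k _; rewrite mulr_ge0.
exists S; split => //.
- split => [|r s _ _ rs|r _]; [|exact: Sle|exact: le_trans (S1 r)].
  apply/within_ge0_continuousP => r e r0 e0.
  pose N := (Num.bound (r + 1)).+1; pose A := \sum_(k < N) a k.
  have A0 : 0 <= A by rewrite sumr_ge0.
  exists (Num.min 1 (e / (A + 1))) => [|s s0].
    by rewrite lt_min ltr01 divr_gt0// ltr_wpDl.
  rewrite lt_min => /andP[sr1 sre].
  have rN : r + 1 + 1 <= N%:R by exact: bnd.
  rewrite (SE N r); last by lra.
  rewrite (SE N s); last by have := ler_norm (s - r); lra.
  rewrite /G opprD addrACA subrr add0r -sumrB (le_trans (ler_norm_sum _ _ _))//.
  apply: (@le_trans _ _ (A * `|s - r|)).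
    rewrite /A mulr_suml; apply: ler_sum => k _.
    rewrite -mulrBr normrM (ger0_norm (a0 k)) ler_wpM2l//.
    rewrite (le_trans (ler_dist_max _ _ _))// opprD addrACA subrr addr0.
    by rewrite opprB addrA subrK.
  rewrite (le_trans (_ : _ <= (A + 1) * `|s - r|))//.
    by rewrite ler_wpM2r// lerDl.
  by rewrite mulrC -ler_pdivlMr ?ltr_wpDl// ltW.
- move=> k r kr; have kN : (k < (Num.bound r).+1)%N.
    rewrite ltnS -(ler_nat R) ltW// (lt_trans kr)//; exact: unstable.ltr_bound.
  rewrite /S /G (bigD1 (Ordinal kN))//= (le_trans (_ : _ <= a k * Num.max 0 (r - k%:R + 1)))//.
    by rewrite ler_peMr// le_max orbC lerDr subr_ge0 ltW.
  rewrite addrCA lerDl addr_ge0// sumr_ge0// => j _; exact: mulr_ge0.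
Qed.

Lemma class_Kinfty_mul (phi S : R -> R) : class_Kinfty phi ->
  nondecreasing_continuous S -> (forall r, 0 <= r -> 1 <= S r) ->
  class_Kinfty (fun r => phi r * S r).
Proof.
move=> [phiK phioo] Snc S1; have [cphi _ phi0] := phiK; have [cS _ _] := Snc.
have pS r : 0 <= r -> phi r <= phi r * S r.
  by move=> r0; rewrite ler_peMr ?S1// (class_K_ge0 phiK).
split; first split.
- by move=> r; apply: cvgM; [exact: cphi|exact: cS].
- move=> r s; rewrite !in_itv/= !andbT => r0 s0 rs.
  rewrite (le_lt_trans (_ : _ <= phi r * S s))//.
    by rewrite ler_wpM2l ?(class_K_ge0 phiK)// (ncont_le Snc)// ltW.
  by rewrite ltr_pM2r ?(class_K_lt phiK)// (lt_le_trans ltr01)// S1.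
- by rewrite phi0 mul0r.
by move=> M; have [r r0 Mr] := phioo M; exists r => //; rewrite (lt_le_trans Mr)// pS.
Qed.

(** Sup-convolution in r yields continuity in r and preserves both monotonicities. The summand r /
    (1 + t) supplies strict growth and unboundedness in r, and tends to 0 in t. *)
Lemma class_KL_majorant (psi : R -> R -> R) :
  (forall r t, 0 <= r -> 0 <= t -> 0 <= psi r t <= r) ->
  (forall r s t, 0 <= r -> r <= s -> 0 <= t -> psi r t <= psi s t) ->
  (forall r s t, 0 <= r -> 0 <= s -> s <= t -> psi r t <= psi r s) ->
  (forall r e, 0 <= r -> 0 < e -> exists2 T, 0 <= T & psi r T <= e) ->
  exists2 b, class_KL b & forall r t, 0 <= r -> 0 <= t -> psi r t <= b r t.
Proof.
move=> psi_r psi_le psi_anti psi_lim.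
have psi_id t : 0 <= t -> forall w, 0 <= w -> psi w t <= w.
  by move=> t0 w w0; have /andP[] := psi_r w t w0 t0.
have psi_ge0 r t : 0 <= r -> 0 <= t -> 0 <= psi r t.
  by move=> r0 t0; have /andP[] := psi_r r t r0 t0.
pose F t := supconv (psi ^~ t).
have F0 r t : 0 <= r -> 0 <= t -> 0 <= F t r.
  by move=> r0 t0; rewrite (le_trans (psi_ge0 r t r0 t0))// supconv_ge//; exact: psi_id.
have F_anti r s t : 0 <= s -> s <= t -> F t r <= F s r.
  move=> s0 st; have t0 := le_trans s0 st.
  apply: (supconv_le (psi_id t t0)) => w w0.
  by rewrite (le_trans _ (supconv_lb (psi_id s s0) r w0))// lerD2r psi_anti.
have frac_anti (r s t : R) : 0 <= r -> 0 <= s -> s <= t -> r / (1 + t) <= r / (1 + s).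
  by move=> r0 s0 st; rewrite ler_wpM2l// lef_pV2 ?posrE ?ltr_wpDr ?lerD2l// (le_trans s0).
exists (fun r t => F t r + r / (1 + t)); last first.
  move=> r t r0 t0; rewrite (le_trans (supconv_ge (psi_id t t0) r0))// lerDl.
  by rewrite divr_ge0// addr_ge0.
split=> [t t0|r r0].
- have t1 : 0 < 1 + t by rewrite ltr_wpDr.
  split; first split.
  + apply: continuous_subspaceT => r; apply: cvgD.
      exact: (supconv_continuous (psi_id t t0)).
    by apply: cvgM; [exact: cvg_id|exact: cvg_cst].
  + move=> r s; rewrite !in_itv/= !andbT => r0 s0 rs.
    apply: ler_ltD; last by rewrite ltr_pM2r ?invr_gt0.
    apply: (supconv_homo (psi_id t t0)) (ltW rs) => v w v0 vw.
    exact: psi_le.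
  + rewrite mul0r addr0; apply/eqP; rewrite eq_le F0// andbT.
    exact: (supconv_le_id (psi_id t t0)).
  move=> M; exists ((`|M| + 1) * (1 + t)); first by rewrite mulr_ge0// ?ltW// ltr_wpDl.
  have r0 : 0 <= (`|M| + 1) * (1 + t) by rewrite mulr_ge0// ?ltW// ltr_wpDl.
  rewrite mulfK ?gt_eqF// (lt_le_trans (_ : _ < `|M| + 1))//.
    by rewrite (le_lt_trans (ler_norm M))// ltrDl.
  by rewrite lerDr F0.
- split=> [s t|].
    rewrite !in_itv/= !andbT => s0 t0 st.
    by rewrite lerD ?F_anti ?frac_anti.
  apply/cvgrPdist_le => e e0.
  have e2 : 0 < e / 2 by rewrite divr_gt0.
  have r2 : 0 <= 2 * r by rewrite mulr_ge0.
  have [T T0 psiT] := psi_lim (2 * r) (e / 2) r2 e2.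
  exists (Num.max T (r / (e / 2))); split; first exact: num_real.
  move=> t; rewrite gt_max => /andP[Tt rt].
  have t0 : 0 <= t := le_trans T0 (ltW Tt).
  have FT : F t r <= e / 2.
    rewrite (le_trans (F_anti r T t T0 (ltW Tt)))//.
    apply: (supconv_le (psi_id T T0)) => w w0.
    (* Slope 2 pays off here: a point w > 2r contributes at most w - 2(w - r) < 0, so smallness of
       psi at radius 2r suffices. *)
    have [wr|wr] := leP w (2 * r).
      rewrite (le_trans _ psiT)// lerBlDr (le_trans (psi_le w _ T w0 wr T0))//.
      by rewrite lerDl mulr_ge0.
    have := psi_id T T0 w w0; have := ler_norm (w - r).
    by lra.
  have rT : r / (1 + t) <= e / 2.
    rewrite ler_pdivrMr ?ltr_wpDr//; move: rt; rewrite ltr_pdivrMr// => /ltW/le_trans; apply.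
    by rewrite mulrC ler_pM2l// lerDr.
  rewrite sub0r normrN ger0_norm; last by rewrite addr_ge0 ?F0// divr_ge0// addr_ge0.
  by rewrite [e]splitr lerD.
Qed.

End comparison_constructions.

(** * Comparison with truncated inputs and strong iISS *)

Section iss.
Context {R : realType} (n m : nat) (Lambda : Type).
Variable Sigma : Lambda -> @impulsive_system R n m.
Variables (tphif tphig etaf etag phif phig : R -> R).
Variables (Nf Ng Of Og Pf Pg Lf : R -> R).
Hypotheses (tphif_Kinfty : class_Kinfty tphif) (tphig_Kinfty : class_Kinfty tphig).
Hypotheses (etaf_Kinfty : class_Kinfty etaf) (etag_Kinfty : class_Kinfty etag).
Hypotheses (phif_Kinfty : class_Kinfty phif) (phig_Kinfty : class_Kinfty phig).
Hypotheses (Nf_nc : nondecreasing_continuous Nf) (Ng_nc : nondecreasing_continuous Ng).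
Hypotheses (Of_nc : nondecreasing_continuous Of) (Og_nc : nondecreasing_continuous Og).
Hypotheses (Pf_nc : nondecreasing_continuous Pf) (Pg_nc : nondecreasing_continuous Pg).
Hypothesis flow_input : forall (lam : Lambda) (t : R) (xi : 'rV[R]_n)
    (mu1 mu2 : 'rV[R]_m), 0 <= t ->
  enorm (flow (Sigma lam) t xi mu1 - flow (Sigma lam) t xi mu2) <=
    tphif (enorm (mu1 - mu2)) *
      (Nf (enorm xi) + Of (Num.min (enorm mu1) (enorm mu2))).
Hypothesis flow_state : forall (lam : Lambda) (t : R) (xi1 xi2 : 'rV[R]_n)
    (mu : 'rV[R]_m), 0 <= t ->
  enorm (flow (Sigma lam) t xi1 mu - flow (Sigma lam) t xi2 mu) <=
    etaf (enorm (xi1 - xi2)) *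
      (Pf (Num.min (enorm xi1) (enorm xi2)) + phif (enorm mu)).
Hypothesis jump_input : forall (lam : Lambda) (t : R) (xi : 'rV[R]_n)
    (mu1 mu2 : 'rV[R]_m), 0 <= t ->
  enorm (jump (Sigma lam) t xi mu1 - jump (Sigma lam) t xi mu2) <=
    tphig (enorm (mu1 - mu2)) *
      (Ng (enorm xi) + Og (Num.min (enorm mu1) (enorm mu2))).
Hypothesis jump_state : forall (lam : Lambda) (t : R) (xi1 xi2 : 'rV[R]_n)
    (mu : 'rV[R]_m), 0 <= t ->
  enorm (jump (Sigma lam) t xi1 mu - jump (Sigma lam) t xi2 mu) <=
    etag (enorm (xi1 - xi2)) *
      (Pg (Num.min (enorm xi1) (enorm xi2)) + phig (enorm mu)).
Hypothesis Lf_nc : nondecreasing_continuous Lf.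
Hypothesis etaf_Lf : forall M s : R, 0 <= M -> 0 <= s -> s <= M -> etaf s <= Lf M * s.

Variables (beta : R -> R -> R) (rho : R -> R).
Hypotheses (beta_KL : class_KL beta) (rho_Kinfty : class_Kinfty rho).
Hypothesis ISS : forall (lam : Lambda) (t0 : R) (x0 : 'rV[R]_n) (u : R -> 'rV[R]_m)
    (x : R -> 'rV[R]_n) (Tx : \bar R) (t : R),
  0 <= t0 -> is_input u ->
  is_maximal_solution (Sigma lam) t0 x0 u x Tx ->
  itvco_ext t0 Tx t ->
  let I := `]t0, t]%classic in
  let gamma := impulses (Sigma lam) in
  enorm (x t) <= beta (enorm x0) (t - t0 + (impulse_count gamma I)%:R) +
    rho (fine (input_sup_norm u I gamma)).

Let tphif_K : class_K tphif. Proof. by case: tphif_Kinfty. Qed.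
Let tphig_K : class_K tphig. Proof. by case: tphig_Kinfty. Qed.
Let etaf_K : class_K etaf. Proof. by case: etaf_Kinfty. Qed.
Let etag_K : class_K etag. Proof. by case: etag_Kinfty. Qed.
Let phif_K : class_K phif. Proof. by case: phif_Kinfty. Qed.
Let phig_K : class_K phig. Proof. by case: phig_Kinfty. Qed.
Let rho_K : class_K rho. Proof. by case: rho_Kinfty. Qed.

Notation count lam a b := (impulse_count (impulses (Sigma lam)) `]a, b]%classic).

(** The minimum in [flow_state] lets the bound on y alone control the factor, and [Lf] makes the
    modulus linear, as Gronwall's inequality requires. *)
Lemma flow_lip lam (t : R) x y (mu : 'rV[R]_m) d M c : 0 <= t ->
  enorm y <= M -> enorm mu <= c -> enorm (x - y) <= d ->
  enorm (flow (Sigma lam) t x mu - flow (Sigma lam) t y mu) <=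
    Lf d * (Pf M + phif c) * enorm (x - y).
Proof.
move=> t0 yM muc xyd; rewrite (le_trans (flow_state _ _ _ _ t0))//.
have d0 : 0 <= d := le_trans (enorm_ge0 _) xyd.
have L0 : 0 <= Lf d by exact: ncont_ge0.
have min0 : 0 <= Num.min (enorm x) (enorm y) by rewrite le_min !enorm_ge0.
rewrite (_ : Lf d * _ * _ = Lf d * enorm (x - y) * (Pf M + phif c)); last by ring.
rewrite ler_pM//.
- by rewrite class_K_ge0// enorm_ge0.
- by rewrite addr_ge0 ?(ncont_ge0 Pf_nc)// (class_K_ge0 phif_K)// enorm_ge0.
- by apply: etaf_Lf => //; exact: enorm_ge0.
- rewrite lerD//; last by apply: class_K_le => //; exact: enorm_ge0.
  by apply: ncont_le => //; rewrite ge_min yM orbT.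
Qed.

Lemma flow_trunc lam (t : R) x (mu : 'rV[R]_m) M c : 0 <= t -> enorm x <= M ->
  enorm (flow (Sigma lam) t x mu - flow (Sigma lam) t x (truncate c mu)) <=
    (Nf M + Of 0) * tail c tphif (enorm mu).
Proof.
move=> t0 xM; rewrite /truncate /tail; case: ifPn => [_|_].
  by rewrite subrr enorm0 mulr0.
rewrite (le_trans (flow_input _ _ _ _ t0))// subr0 enorm0 mulrC.
rewrite (min_idPr (enorm_ge0 _)); apply: ler_wpM2r.
  by apply: class_K_ge0 => //; exact: enorm_ge0.
rewrite lerD2r.
by apply: ncont_le => //; exact: enorm_ge0.
Qed.

Lemma jump_trunc lam (t : R) x (mu : 'rV[R]_m) M c : 0 <= t -> enorm x <= M ->
  enorm (jump (Sigma lam) t x mu - jump (Sigma lam) t x (truncate c mu)) <=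
    (Ng M + Og 0) * tail c tphig (enorm mu).
Proof.
move=> t0 xM; rewrite /truncate /tail; case: ifPn => [_|_].
  by rewrite subrr enorm0 mulr0.
rewrite (le_trans (jump_input _ _ _ _ t0))// subr0 enorm0 mulrC.
rewrite (min_idPr (enorm_ge0 _)); apply: ler_wpM2r.
  by apply: class_K_ge0 => //; exact: enorm_ge0.
rewrite lerD2r.
by apply: ncont_le => //; exact: enorm_ge0.
Qed.

Lemma jump_modulus lam (t : R) x y (mu : 'rV[R]_m) d M c : 0 <= t ->
  enorm y <= M -> enorm mu <= c -> enorm (x - y) <= d ->
  enorm (jump (Sigma lam) t x mu - jump (Sigma lam) t y mu) <=
    (Pg M + phig c) * etag d.
Proof.
move=> t0 yM muc xyd; rewrite (le_trans (jump_state _ _ _ _ t0))// mulrC.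
have min0 : 0 <= Num.min (enorm x) (enorm y) by rewrite le_min !enorm_ge0.
rewrite ler_pM//.
- by rewrite addr_ge0 ?(ncont_ge0 Pg_nc)// (class_K_ge0 phig_K)// enorm_ge0.
- by rewrite class_K_ge0// enorm_ge0.
- rewrite lerD//; last by apply: class_K_le => //; exact: enorm_ge0.
  by apply: ncont_le => //; rewrite ge_min yM orbT.
- by apply: class_K_le => //; exact: enorm_ge0.
Qed.

(** A bounded input makes the flow Lipschitz on balls uniformly in time. ISS bounds every maximal
    solution by beta(|xi|, 0) + rho(c), so [global_solution] applies. *)
Lemma iss_global_solution lam c (v : R -> 'rV[R]_m) (t0 : R) xi :
  lebesgue_measurable_fun (Rge0 R) v -> 0 <= c -> (forall t, enorm (v t) <= c) ->
  0 <= t0 -> exists y, is_solution (Sigma lam) t0 xi v y +oo%E /\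
    forall t, t0 <= t ->
      enorm (y t) <= beta (enorm xi) (t - t0 + (count lam t0 t)%:R) + rho c.
Proof.
move=> mv c0 vc t00.
have iv : is_input v.
  by split => // b _; exists c; apply: aeW => t _.
have bound y Ty : is_maximal_solution (Sigma lam) t0 xi v y Ty ->
    forall t, itvco_ext t0 Ty t ->
    enorm (y t) <= beta (enorm xi) (t - t0 + (count lam t0 t)%:R) + rho c.
  move=> maxy t t0t; rewrite (le_trans (ISS t00 iv maxy t0t))// lerD2l.
  by have /andP[? ?] := input_sup_norm_le `]t0, t]%classic (impulses (Sigma lam)) c0 vc;
    exact: class_K_le.
have [|||y maxy] := @global_solution R n m (Sigma lam) v mv _ _ (beta (enorm xi) 0 + rho c) t0 xi t00.
- move=> M; have [M0|M0] := leP 0 M; last first.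
    exists 1 => // t x y _ xM; have := le_lt_trans xM M0.
    by rewrite ltNge enorm_ge0.
  exists (Lf (M + M) * (Pf M + phif c) + 1).
    rewrite ltr_wpDl// mulr_ge0//; first by apply: ncont_ge0 => //; rewrite addr_ge0.
    by rewrite addr_ge0 ?(ncont_ge0 Pf_nc)// (class_K_ge0 phif_K).
  move=> t x y t0' xM yM; have MM : enorm (x - y) <= M + M.
    by rewrite (le_trans (ler_enormB _ _))// lerD.
  rewrite (le_trans (flow_lip _ t0' yM (vc t) MM))// ler_wpM2r ?enorm_ge0//.
  by rewrite lerDl.
- exists (tphif c * (Nf 0 + Of 0)) => t t0'.
  have := flow_input lam 0 (v t) 0 t0'.
  rewrite (flow0 _ t0') !subr0 !enorm0 (min_idPr (enorm_ge0 _)) => /le_trans; apply.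
  rewrite ler_wpM2r// ?addr_ge0 ?(ncont_ge0 Nf_nc) ?(ncont_ge0 Of_nc)//.
  by apply: class_K_le => //; exact: enorm_ge0.
- move=> y Ty maxy t t0t; rewrite (le_trans (bound _ _ maxy _ t0t))// lerD2r.
  have [t0t' _] := t0t.
  by apply: class_KL_le; rewrite ?enorm_ge0// addr_ge0// subr_ge0.
exists y; split; first by case: maxy.
by move=> t t0t; apply: (bound _ _ maxy); split => //; rewrite ltry.
Qed.

(** The Lipschitz constant A is valid only while |x - y| <= E, and Gronwall's inequality then gives
    a bound below E; [bootstrap] closes this circle. *)
Lemma flow_compare lam c u x Tx y (t0 : R) x0 y0 (a b M0 e0 E d : R) :
  0 <= c -> 0 <= E -> is_input u -> 0 <= t0 ->
  is_solution (Sigma lam) t0 x0 u x Tx ->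
  is_solution (Sigma lam) t0 y0 (fun t => truncate c (u t)) y +oo%E ->
  t0 <= a -> a <= b -> (b%:E < Tx)%E ->
  (forall t, a < t -> t <= b -> ~ impulses (Sigma lam) t) ->
  (forall t, a <= t -> t <= b -> enorm (y t) <= M0) ->
  (\int[leb]_(s in `]a, b]) (tail c tphif (enorm (u s)))%:E <= d%:E)%E ->
  0 <= d -> enorm (x a - y a) <= e0 ->
  let W := Nf (M0 + E) + Of 0 in let A := Lf E * (Pf M0 + phif c) in
  (e0 + W * d) * expR (A * (b - a)) < E ->
  enorm (x b - y b) <= (e0 + W * d) * expR (A * (b - a)).
Proof.
move=> c0 E0 [mu ubnd] t00 solx soly t0a ab bT noimp yM0 intd d0 ea W A small.
have a0 : 0 <= a := le_trans t00 t0a.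
have M00 : 0 <= M0 by apply: le_trans (yM0 a (lexx _) ab); exact: enorm_ge0.
have e00 : 0 <= e0 by apply: le_trans ea; exact: enorm_ge0.
have [acx dx] := solution_flow solx t0a ab bT noimp.
have [acy dy] := solution_flow soly t0a ab (ltry _) noimp.
have W0 : 0 <= W.
  by rewrite addr_ge0 ?(ncont_ge0 Nf_nc) ?(ncont_ge0 Of_nc)// addr_ge0.
have A0 : 0 <= A.
  rewrite mulr_ge0 ?(ncont_ge0 Lf_nc)// addr_ge0 ?(ncont_ge0 Pf_nc)//.
  exact: class_K_ge0.
have [B uB] := ubnd b (le_trans a0 ab).
(* Almost everywhere on [0, b] the tail of [tphif] is at most K, so the cap is inactive there. *)
pose K := tphif (Num.max 0 B).
have max0 : 0 <= Num.max 0 B by rewrite le_max lexx.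
have K0 : 0 <= K by exact: class_K_ge0.
pose tl s := tail c tphif (enorm (u s)).
have tl0 s : 0 <= tl s by apply: tail_ge0 => //; exact: enorm_ge0.
have mtl : @measurable_fun _ _ (lebesgueR R) R (Rge0 R) tl by exact: tail_measurable.
have [G [h [h_ge0 hE Glip dG [Gle Gd]]]] := capped_primitive mtl tl0 W0 K0.
have {}Gd := Gd a b d a0 ab intd.
have lek s : a <= s -> s <= b -> 
    (e0 + W * d) * expR (A * (s - a)) <= (e0 + W * d) * expR (A * (b - a)).
  move=> as_ sb; rewrite ler_wpM2l ?ler_expR ?ler_wpM2l ?lerB//.
  by rewrite addr_ge0// mulr_ge0.
have e0E : e0 <= E.
  apply: le_trans (ltW small); apply: le_trans (lek a (lexx _) ab).
  by rewrite subrr mulr0 expR0 mulr1 lerDl mulr_ge0.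
have acxy := acB acx acy.
apply: (@bootstrap R a b _ E (fun t => enorm (x t - y t)) ab small).
- exact: real_ac_enorm acxy.
- exact: le_trans ea e0E.
move=> s as_ sb eE.
apply: le_trans (lek s as_ sb).
have := @gronwall R n a s A E (W * K) (fun t => x t - y t) G as_ A0 (ac_sub (lexx a) sb acxy) eE.
move=> H.
have : enorm (x s - y s) * expR (- A * (s - a)) - G s <= enorm (x a - y a) - G a.
  apply: H.
  - move=> r t ar rt ts; have := Glip r t; rewrite (ger0_norm (_ : 0 <= t - r))//.
    by rewrite subr_ge0.
  - have := ae_leb_and (ae_leb_and dx dy) (ae_leb_and uB dG).
    apply: ae_leb_impl => t [[dxt dyt] [uBt dGt]] /andP[at_ ts].
    have tb : t < b := lt_le_trans ts sb.
    have t_0 : 0 < t := le_lt_trans a0 at_.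
    have htl : h t = W * tl t.
      apply: hE; first exact: ltW.
      rewrite /tl /tail; case: ifPn => // _.
      apply: class_K_le => //; first exact: enorm_ge0.
      rewrite le_max uBt ?orbT// in_itv/= (ltW t_0) (ltW tb)//.
    exists (flow (Sigma lam) t (x t) (u t) - flow (Sigma lam) t (y t) (truncate c (u t))), (h t).
    split => //.
    + have := dxt; rewrite at_ tb => /(_ isT) ?.
      have := dyt; rewrite at_ tb => /(_ isT) ?.
      exact: is_deriveB.
    + exact: dGt.
    + rewrite htl.
      have xE : enorm (x t) <= M0 + E.
        have := ler_enormD (y t) (x t - y t); rewrite addrC subrK => /le_trans; apply.
        by rewrite lerD ?yM0 ?eE// ?(ltW at_) ?(ltW tb) ?(ltW ts).
      have := flow_trunc lam (u t) c (ltW t_0) xE => h1.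
      have h2 := flow_lip lam (ltW t_0) (yM0 t (ltW at_) (ltW tb))
        (enorm_truncate (u t) c0) (eE t (ltW at_) (ltW ts)).
      rewrite (le_trans (ler_enorm_distD (flow (Sigma lam) t (x t) (truncate c (u t))) _ _))//.
      by rewrite addrC lerD.
move=> H2.
have Gs : G s - G a <= W * d.
  by rewrite (le_trans _ Gd)// lerB// Gle// (le_trans a0).
rewrite -ler_pdivrMr ?expR_gt0// -expRN -mulNr.
by move: H2; rewrite lerBlDr => /le_trans; apply; rewrite -addrA lerD// addrC.
Qed.

(* Each jump distorts the deviation of [x] from [y] by the modulus [etag], so the
   smallness of the tails is chosen backwards, by induction on the number of
   impulses. *)
Lemma window_deviation c M0 E Hmax (J : nat) : 0 <= c -> 0 <= M0 -> 0 <= Hmax ->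
  forall e, 0 < e -> e < E -> exists2 d, 0 < d &
  forall lam u x Tx y (t1 : R) xi (t : R), is_input u -> 0 <= t1 ->
    is_solution (Sigma lam) t1 xi u x Tx ->
    is_solution (Sigma lam) t1 xi (fun t => truncate c (u t)) y +oo%E ->
    t1 <= t -> (t%:E < Tx)%E -> t - t1 <= Hmax -> (count lam t1 t <= J)%N ->
    (forall s, t1 <= s -> s <= t -> enorm (y s) <= M0) ->
    (\int[leb]_(s in `]t1, t]) (tail c tphif (enorm (u s)))%:E <= d%:E)%E ->
    (forall s, impulses (Sigma lam) s -> t1 < s -> s <= t ->
       tail c tphig (enorm (u s)) <= d) ->
    enorm (x t - y t) <= e.
Proof.
move=> c0 M00 H0.
pose A := Lf E * (Pf M0 + phif c).
pose X := expR (A * Hmax).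
pose Wf := Nf (M0 + E) + Of 0.
pose Wg := Ng (M0 + E) + Og 0.
pose Cg := Pg M0 + phig c.
have X0 : 0 < X by exact: expR_gt0.
have Cg0 : 0 <= Cg.
  by rewrite addr_ge0 ?(ncont_ge0 Pg_nc)// (class_K_ge0 phig_K).
(* A stretch without impulses multiplies the deviation and the tail by at most X, the largest
   Gronwall factor of the window; e < E is the margin for the bootstrap. *)
have flow_part e : 0 < e -> e < E -> forall d e0, 0 <= d -> 0 <= e0 ->
    (e0 + Wf * d) * X <= e ->
    forall lam u x Tx y (t1 : R) xi (a b : R), is_input u -> 0 <= t1 ->
    is_solution (Sigma lam) t1 xi u x Tx ->
    is_solution (Sigma lam) t1 xi (fun t => truncate c (u t)) y +oo%E ->
    t1 <= a -> a <= b -> (b%:E < Tx)%E -> b - t1 <= Hmax ->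
    (forall t, a < t -> t <= b -> ~ impulses (Sigma lam) t) ->
    (forall s, t1 <= s -> s <= b -> enorm (y s) <= M0) ->
    (\int[leb]_(s in `]t1, b]) (tail c tphif (enorm (u s)))%:E <= d%:E)%E ->
    enorm (x a - y a) <= e0 -> enorm (x b - y b) <= e.
  move=> e0 eE d e1 d0 e10 small lam u x Tx y t1 xi a b iu t10 solx soly t1a ab bT bH noimp yM intd ea.
  have E0 : 0 <= E := ltW (lt_trans e0 eE).
  have Wf0 : 0 <= Wf.
    by rewrite addr_ge0 ?(ncont_ge0 Nf_nc) ?(ncont_ge0 Of_nc)// addr_ge0.
  have A0 : 0 <= A.
    rewrite mulr_ge0 ?(ncont_ge0 Lf_nc)// addr_ge0 ?(ncont_ge0 Pf_nc)//.
    exact: (class_K_ge0 phif_K).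
  have le1 : (e1 + Wf * d) * expR (A * (b - a)) <= e.
    apply: le_trans small; apply: ler_wpM2l; first by rewrite addr_ge0// mulr_ge0.
    by rewrite ler_expR ler_wpM2l// (le_trans _ bH)// lerB.
  apply: le_trans le1.
  apply: (flow_compare c0 E0 iu t10 solx soly t1a ab bT noimp _ _ d0 ea).
  - by move=> t at_ tb; apply: yM => //; exact: le_trans at_.
  - apply: le_trans intd; apply: ge0_subset_integral.
    + by apply: sub_caratheodory; exact: measurable_itv.
    + by apply: sub_caratheodory; exact: measurable_itv.
    + apply: measurableT_comp; first exact: EFin_measurable.
      have [mu _] := iu; apply: measurable_funS (tail_measurable c tphif_K mu).
        by apply: sub_caratheodory; exact: measurable_itv.
      by move=> s /=; rewrite !in_itv/= andbT => /andP[t1s _]; exact: le_trans (ltW t1s).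
    + by move=> s _; rewrite lee_fin tail_ge0// enorm_ge0.
    + by apply: subset_itvr; rewrite bnd_simp.
  - apply: le_lt_trans eE; apply: le_trans small; apply: ler_wpM2l.
      by rewrite addr_ge0// mulr_ge0.
    by rewrite ler_expR ler_wpM2l// (le_trans _ bH)// lerB.
have count_0 lam (t1 t : R) : count lam t1 t = 0%N ->
    forall s, t1 < s -> s <= t -> ~ impulses (Sigma lam) s.
  move=> c00 s t1s st imp.
  by have := impulse_count_gt0 (impulsesP (Sigma lam)) imp t1s st; rewrite c00.
elim: J => [|J IH] e e0 eE.
  have Wf1 : 0 < (`|Wf| + 1) * X by rewrite mulr_gt0// ltr_wpDl.
  exists (e / ((`|Wf| + 1) * X)); first by rewrite divr_gt0.
  move=> lam u x Tx y t1 xi t iu t10 solx soly t1t tT tH; rewrite leqn0 => /eqP cnt yM intd _.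
  have xy1 : enorm (x t1 - y t1) <= 0.
    by have [_ -> _ _] := solx; have [_ -> _ _] := soly; rewrite subrr enorm0.
  apply: (flow_part e e0 eE _ 0 _ (lexx _) _ lam u x Tx y t1 xi t1 t) intd xy1 => //.
  - by rewrite divr_ge0 ?ltW.
  - rewrite add0r mulrAC (le_trans (_ : _ <= (`|Wf| + 1) * X * (e / ((`|Wf| + 1) * X))))//.
      apply: ler_wpM2r; first by rewrite divr_ge0 ?ltW.
      by rewrite ler_pM2r// (le_trans (ler_norm _))// lerDl.
    by rewrite mulrC divfK// gt_eqF.
  - exact: count_0.
(* Three shares of e / (4X) are spent: on the deviation e1 before the last impulse, on its
   distortion by [etag], and on the tails of flow and jump together. *)
have eX : 0 < e / (4 * X) by rewrite divr_gt0// mulr_gt0.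
have Cg1 : 0 < Cg + 1 by rewrite ltr_wpDl.
have [r r0 etar] := class_K_small etag_K (divr_gt0 eX Cg1).
pose e1 := Num.min r (Num.min (e / (4 * X)) (e / 2)).
have e10 : 0 < e1 by rewrite !lt_min r0 eX divr_gt0.
have e1E : e1 < E.
  rewrite (lt_trans _ eE)// (le_lt_trans (_ : _ <= e / 2))//.
    by rewrite !ge_min lexx !orbT.
  by rewrite ltr_pdivrMr// ltr_pMr// ltr1n.
have [d1 d10 IH1] := IH e1 e10 e1E.
have Wfg1 : 0 < (`|Wf| + `|Wg| + 1) by rewrite ltr_wpDl// addr_ge0.
pose d := Num.min d1 (e / (4 * X) / (`|Wf| + `|Wg| + 1)).
have d0 : 0 < d by rewrite lt_min d10 divr_gt0.
exists d => // lam u x Tx y t1 xi t iu t10 solx soly t1t tT tH cnt yM intd jmpd.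
have dW : Wf * d <= e / (4 * X) /\ Wg * d <= e / (4 * X) - `|Wf| * d.
  have : d * (`|Wf| + `|Wg| + 1) <= e / (4 * X).
    by rewrite -ler_pdivlMr// ge_min lexx orbT.
  have hf : Wf * d <= `|Wf| * d by rewrite ler_pM2r// ler_norm.
  have hg : Wg * d <= `|Wg| * d by rewrite ler_pM2r// ler_norm.
  have q0 : 0 <= `|Wg| * d by rewrite mulr_ge0// ltW.
  rewrite !mulrDr mulr1 (mulrC d `|Wf|) (mulrC d `|Wg|) => h; split.
    by rewrite (le_trans hf)// (le_trans _ h)// -addrA lerDl addr_ge0// ltW.
  by rewrite lerBrDl (le_trans (lerD (lexx _) hg))// (le_trans _ h)// lerDl ltW.
have [cnt0|cnt0] := posnP (count lam t1 t).
  have xy1 : enorm (x t1 - y t1) <= 0.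
    by have [_ -> _ _] := solx; have [_ -> _ _] := soly; rewrite subrr enorm0.
  apply: (flow_part e e0 eE _ 0 (ltW d0) (lexx _) _ lam u x Tx y t1 xi t1 t) intd xy1 => //.
  - rewrite add0r -ler_pdivlMr// (le_trans dW.1)//.
    rewrite invfM mulrA ler_pM2r ?invr_gt0// ler_piMr ?(ltW e0)// invf_le1//.
    by rewrite ler1n.
  - exact: count_0.
have [tau [imp t1tau taut notau]] := last_impulse (impulsesP (Sigma lam)) cnt0.
have tauT : (tau%:E < Tx)%E by apply: le_lt_trans tT; rewrite lee_fin.
(* Before tau there is one impulse fewer, so the induction hypothesis applies; the bound then passes
   to the left limits at tau. *)
have dev s : t1 <= s -> s < tau -> enorm (x s - y s) <= e1.
  move=> t1s stau; have st : s <= t := ltW (lt_le_trans stau taut).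
  apply: (IH1 lam u x Tx y t1 xi s) => //.
  - by apply: lt_trans tauT; rewrite lte_fin.
  - by rewrite (le_trans _ tH)// lerB.
  - have := impulse_countD (impulsesP (Sigma lam)) t1s st.
    have := impulse_count_gt0 (impulsesP (Sigma lam)) imp stau taut.
    move: cnt; case: (count lam s t) => // k cnt _ cE.
    by move: cnt; rewrite cE addnS ltnS; apply: leq_trans; exact: leq_addr.
  - by move=> r' t1r rs; apply: yM => //; exact: le_trans st.
  - apply: le_trans (_ : (d%:E <= d1%:E)%E); last by rewrite lee_fin ge_min lexx.
    apply: le_trans intd; apply: ge0_subset_integral.
    + by apply: sub_caratheodory; exact: measurable_itv.
    + by apply: sub_caratheodory; exact: measurable_itv.
    + apply: measurableT_comp; first exact: EFin_measurable.
      have [mu _] := iu; apply: measurable_funS (tail_measurable c tphif_K mu).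
        by apply: sub_caratheodory; exact: measurable_itv.
      by move=> s' /=; rewrite !in_itv/= andbT => /andP[? _]; rewrite (le_trans t10)// ltW.
    + by move=> s' _; rewrite lee_fin tail_ge0// enorm_ge0.
    + by apply: subset_itvl; rewrite bnd_simp.
  - move=> s' imps' t1s' s's; rewrite (le_trans (jmpd _ imps' t1s' (le_trans s's st)))//.
    by rewrite ge_min lexx.
have [_ _ _ jumpx] := solx; have [_ _ _ jumpy] := soly.
have [lx cvx xtau] := jumpx tau imp t1tau tauT.
have [ly cvy ytau] := jumpy tau imp t1tau (ltry _).
have lyM : enorm ly <= M0.
  apply: (cvg_left_enorm_le t1tau cvy) => s t1s stau; apply: yM => //.
  exact: ltW (lt_le_trans stau taut).
have lxy : enorm (lx - ly) <= e1.
  by apply: (cvg_left_enorm_le t1tau (cvgB cvx cvy)) => s t1s stau; exact: dev.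
have lxM : enorm lx <= M0 + E.
  have := ler_enormD ly (lx - ly); rewrite addrC subrK => /le_trans; apply.
  by rewrite lerD// (le_trans lxy)// ltW.
have tau0 : 0 <= tau := le_trans t10 (ltW t1tau).
have xytau : enorm (x tau - y tau) <= e1 + Wg * d + Cg * etag e1.
  rewrite xtau ytau.
  have h1 := jump_trunc lam (u tau) c tau0 lxM.
  have h2 := jump_modulus lam tau0 lyM (enorm_truncate (u tau) c0) lxy.
  have h3 : Wg * tail c tphig (enorm (u tau)) <= Wg * d.
    apply: ler_wpM2l; last exact: jmpd.
    by rewrite addr_ge0 ?(ncont_ge0 Ng_nc) ?(ncont_ge0 Og_nc)// addr_ge0// ltW// (lt_trans e0).
  rewrite (_ : _ - _ = (lx - ly) +
    ((jump (Sigma lam) tau lx (u tau) - jump (Sigma lam) tau lx (truncate c (u tau))) +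
     (jump (Sigma lam) tau lx (truncate c (u tau)) - jump (Sigma lam) tau ly (truncate c (u tau))))); last first.
    by rewrite opprD addrACA subrKA.
  rewrite -[leRHS]addrA (le_trans (ler_enormD _ _))// lerD//.
  rewrite (le_trans (ler_enormD _ _))// lerD//.
  exact: le_trans h1 h3.
have e1X : e1 <= e / (4 * X) by rewrite !ge_min lexx !orbT.
have etaX : Cg * etag e1 <= e / (4 * X).
  have /(ler_wpM2l Cg0) : etag e1 <= e / (4 * X) / (Cg + 1).
    by apply: etar; [exact: ltW|rewrite ge_min lexx].
  move/le_trans; apply; rewrite mulrA ler_pdivrMr// mulrC.
  by rewrite ler_pM2l// lerDl.
have xy0 := le_trans (enorm_ge0 _) xytau.
apply: (flow_part e e0 eE d (e1 + Wg * d + Cg * etag e1) (ltW d0) xy0 _ lam u x Tx y t1 xi tau t) intd xytau => //.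
- rewrite -ler_pdivlMr//.
  have hf : Wf * d <= `|Wf| * d by rewrite ler_pM2r// ler_norm.
  have -> : e / X = 4 * (e / (4 * X)) by field; rewrite gt_eqF.
  have h : Wg * d + Wf * d <= e / (4 * X).
    by rewrite (le_trans (lerD dW.2 hf))// subrK.
  rewrite (_ : _ + _ + _ + _ = e1 + (Wg * d + Wf * d) + Cg * etag e1); last by ring.
  rewrite (le_trans (lerD (lerD e1X h) etaX))//.
  rewrite (_ : 4 * _ = e / (4 * X) + e / (4 * X) + e / (4 * X) + e / (4 * X)); last by ring.
  by rewrite lerDl ltW.
- exact: ltW.
Qed.

Notation hybrid lam a b := (b - a + (count lam a b)%:R).

(** Three quarters of l are used: beta(L, T) <= l / 4 by the choice of T, rho(c) <= l / 4, and |x -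
    y| <= l / 4. *)
Lemma window l L c : 0 < l -> l <= L -> 0 <= c -> rho c <= l / 4 ->
  exists (T : nat) (d : R), [/\ (0 < T)%N, 0 < d &
  forall lam u x Tx (t1 : R) xi (t : R), is_input u -> 0 <= t1 ->
    is_solution (Sigma lam) t1 xi u x Tx -> t1 <= t -> (t%:E < Tx)%E ->
    enorm xi <= L -> hybrid lam t1 t <= T%:R + 1 ->
    (\int[leb]_(s in `]t1, t]) (tail c tphif (enorm (u s)))%:E <= d%:E)%E ->
    (forall s, impulses (Sigma lam) s -> t1 < s -> s <= t ->
       tail c tphig (enorm (u s)) <= d) ->
    enorm (x t) <= beta L 0 + L /\
    (T%:R <= hybrid lam t1 t -> enorm (x t) <= l)].
Proof.
move=> l0 lL c0 rhoc.
have L0 : 0 <= L := le_trans (ltW l0) lL.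
have l4 : 0 < l / 4 by rewrite divr_gt0.
have l2 : l / 4 < l / 2 by rewrite ltr_pM2l// ltf_pV2 ?posrE// ltr_nat.
have [T [T0 betaT]] := class_KL_small beta_KL L0 l4.
have beta00 : 0 <= beta L 0 by exact: class_KL_ge0.
have M00 : 0 <= beta L 0 + l / 4 by rewrite addr_ge0// ltW.
have H0 : 0 <= T%:R + 1 :> R by rewrite addr_ge0.
(* A hybrid time of at most T + 1, overshoot included, bounds both the duration and the number of
   impulses. *)
have [d d0 dev] := window_deviation T.+1 c0 M00 H0 l4 l2.
exists T, d; split => // lam u x Tx t1 xi t iu t10 solx t1t tT xiL hT intd jmpd.
have [y [soly ybnd]] := iss_global_solution lam xi (truncate_measurable c iu.1) c0
  (fun t => enorm_truncate (u t) c0) t10.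
have {}ybnd s : t1 <= s -> enorm (y s) <= beta L (hybrid lam t1 s) + l / 4.
  move=> t1s; rewrite (le_trans (ybnd s t1s))// lerD//.
  by apply: class_KL_lel => //; rewrite ?enorm_ge0// addr_ge0// subr_ge0.
have h0 s : t1 <= s -> 0 <= hybrid lam t1 s by move=> ?; rewrite addr_ge0// subr_ge0.
have xy : enorm (x t - y t) <= l / 4.
  apply: (dev lam u x Tx y t1 xi t iu t10 solx soly t1t tT _ _ _ intd jmpd).
  - by rewrite (le_trans _ hT)// lerDl.
  - rewrite -(ler_nat R) (le_trans (_ : _ <= hybrid lam t1 t))//.
      by rewrite lerDr subr_ge0.
    by rewrite (le_trans hT)// -natr1.
  - move=> s t1s st; rewrite (le_trans (ybnd s t1s))// lerD2r.
    exact: class_KL_le (h0 s t1s).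
have x_le : enorm (x t) <= enorm (y t) + l / 4.
  have := ler_enormD (y t) (x t - y t); rewrite addrC subrK => /le_trans; apply.
  by rewrite lerD2l.
have ll : l = l / 4 + l / 4 + l / 4 + l / 4 by field.
split=> [|Th].
- have := class_KL_le beta_KL L0 (lexx 0) (h0 t t1t).
  by have := ybnd t t1t; lra.
- have := class_KL_le beta_KL L0 (ler0n _ T) Th.
  by have := ybnd t t1t; lra.
Qed.

(** The initial state is read off as [x t0] and maximality is not included, so that restarting at a
    later time gives a trajectory again; ISS is applied to the comparison solution only. *)
Definition trajectory lam (u : R -> 'rV[R]_m) (x : R -> 'rV[R]_n) (Tx : \bar R)
    (t0 t : R) : Prop :=
  [/\ is_input u, 0 <= t0, is_solution (Sigma lam) t0 (x t0) u x Tx, t0 <= t &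
      (t%:E < Tx)%E].

Notation energy rho1 rho2 lam u a b :=
  (input_int_norm rho1 rho2 u `]a, b]%classic (impulses (Sigma lam))).

Definition bounded_by (rho1 rho2 : R -> R) (r s M : R) : Prop :=
  forall lam u x Tx t0 t, trajectory lam u x Tx t0 t ->
    (energy rho1 rho2 lam u t0 t <= s%:E)%E -> enorm (x t0) <= r -> enorm (x t) <= M.

(** Only one visit to the ball of radius l is demanded. Visits can be chained, and [bounded_by] from
    l afterwards makes the last one permanent. *)
Definition reaches (rho1 rho2 : R -> R) (r s l T : R) : Prop :=
  forall lam u x Tx t0 t, trajectory lam u x Tx t0 t ->
    (energy rho1 rho2 lam u t0 t <= s%:E)%E -> enorm (x t0) <= r ->
    T <= hybrid lam t0 t ->
    exists t1, [/\ t0 <= t1, t1 <= t & enorm (x t1) <= l].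

Definition controlled (rho1 rho2 : R -> R) (s M : R) : Prop :=
  bounded_by rho1 rho2 s s M /\
  forall r, exists2 T, 0 <= T & forall lam u x Tx t0 t, trajectory lam u x Tx t0 t ->
    (energy rho1 rho2 lam u t0 t <= s%:E)%E -> enorm (x t0) <= r ->
    T <= hybrid lam t0 t -> enorm (x t) <= M.

Lemma trajectory_sub lam u x Tx t0 t (a b : R) : trajectory lam u x Tx t0 t ->
  t0 <= a -> a <= b -> b <= t -> trajectory lam u x Tx a b.
Proof.
move=> [iu t00 solx t0t tT] t0a ab bt.
have bT : (b%:E < Tx)%E by rewrite (le_lt_trans _ tT)// lee_fin.
split => //; first exact: le_trans t0a.
by apply: (is_solution_restart solx t0a); rewrite (le_lt_trans _ bT)// lee_fin.
Qed.

Lemma energy_sub rho1 rho2 lam u x Tx t0 t (a b : R) : class_K rho1 -> class_K rho2 ->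
  trajectory lam u x Tx t0 t -> t0 <= a -> b <= t ->
  (energy rho1 rho2 lam u a b <= energy rho1 rho2 lam u t0 t)%E.
Proof. by move=> K1 K2 [iu t00 _ _ _] t0a bt; exact: input_int_norm_sub. Qed.

Lemma hybridD lam (a b c : R) : a <= b -> b <= c ->
  hybrid lam a c = hybrid lam a b + hybrid lam b c.
Proof.
move=> ab bc; rewrite (impulse_countD (impulsesP (Sigma lam)) ab bc) natrD.
by ring.
Qed.

(** The first visit occurs before hybrid time T + 1, since T is attained with an overshoot of at
    most 1; T' remains for the second. *)
Lemma reaches_trans rho1 rho2 r s l l' T T' : class_K rho1 -> class_K rho2 ->
  0 <= T -> 0 <= T' ->
  reaches rho1 rho2 r s l T -> reaches rho1 rho2 l s l' T' ->
  reaches rho1 rho2 r s l' (T + 1 + T').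
Proof.
move=> K1 K2 T0 T'0 rl ll' lam u x Tx t0 t traj en xr Th.
have [_ _ _ t0t _] := traj.
have T1h : T <= hybrid lam t0 t by rewrite (le_trans _ Th)// -addrA lerDl addr_ge0.
have [b [t0b bt Tb bT]] := hybrid_time_mid (impulsesP (Sigma lam)) t0t T0 T1h.
have trajb := trajectory_sub traj (lexx _) t0b bt.
have [a [t0a ab xa]] :=
  rl _ _ _ _ _ _ trajb (le_trans (energy_sub K1 K2 traj (lexx _) bt) en) xr Tb.
have at_ := le_trans ab bt.
have traja := trajectory_sub traj t0a at_ (lexx _).
have ha : T' <= hybrid lam a t.
  have h1 := hybridD lam t0a at_; have h2 := hybridD lam t0a ab.
  have h3 : 0 <= hybrid lam a b by rewrite addr_ge0// subr_ge0.
  by lra.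
have [t1 [at1 t1t xt1]] :=
  ll' _ _ _ _ _ _ traja (le_trans (energy_sub K1 K2 traj t0a (lexx _)) en) xa ha.
by exists t1; split => //; exact: le_trans at1.
Qed.

Lemma reaches_controlled rho1 rho2 l s M : class_K rho1 -> class_K rho2 ->
  s <= l -> bounded_by rho1 rho2 l s M ->
  (forall r, exists2 T, 0 <= T & reaches rho1 rho2 r s l T) ->
  controlled rho1 rho2 s M.
Proof.
move=> K1 K2 sl bnd rch; split.
  by move=> lam u x Tx t0 t traj en xs; apply: (bnd _ _ _ _ _ _ traj en (le_trans xs sl)).
move=> r; have [T T0 rT] := rch r; exists T => // lam u x Tx t0 t traj en xr Th.
have [a [t0a at_ xa]] := rT _ _ _ _ _ _ traj en xr Th.
apply: (bnd _ _ _ _ _ _ (trajectory_sub traj t0a at_ (lexx _)) _ xa).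
exact: le_trans (energy_sub K1 K2 traj t0a (lexx _)) en.
Qed.

(** The order of quantifiers matters: T and d are fixed before [rho1] and [rho2], so the gains may
    be built from d. *)
Lemma window_reaches L l c : 0 < l -> l <= L -> 0 <= c -> rho c <= l / 4 ->
  exists (T : nat) (d : R), 0 < d /\
  forall rho1 rho2 k s, class_K rho1 -> class_K rho2 -> 0 <= k -> k * s <= d ->
    (forall r, 0 <= r -> tail c tphif r <= k * rho1 r) ->
    (forall r, 0 <= r -> tail c tphig r <= k * rho2 r) ->
    reaches rho1 rho2 L s l T%:R /\ bounded_by rho1 rho2 L s (beta L 0 + L).
Proof.
move=> l0 lL c0 rhoc; have [T [d [T0 d0 win]]] := window l0 lL c0 rhoc.
exists T, d; split=> // rho1 rho2 k s K1 K2 k0 ksd tail1 tail2.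
have {}win lam u x Tx t0 t : trajectory lam u x Tx t0 t ->
    (energy rho1 rho2 lam u t0 t <= s%:E)%E -> enorm (x t0) <= L ->
    hybrid lam t0 t <= T%:R + 1 ->
    enorm (x t) <= beta L 0 + L /\ (T%:R <= hybrid lam t0 t -> enorm (x t) <= l).
  move=> [iu t00 solx t0t tT] en xL hT.
  have [intd jmpd] := input_int_norm_tail K1 K2 tphif_K tphig_K iu t00 k0 tail1 tail2 en.
  apply: (win lam u x Tx t0 _ t iu t00 solx t0t tT xL hT).
    by rewrite (le_trans intd)// lee_fin.
  by move=> r imp t0r rt; rewrite (le_trans (jmpd r imp t0r rt)).
have step lam u x Tx t0 t : trajectory lam u x Tx t0 t ->
    (energy rho1 rho2 lam u t0 t <= s%:E)%E -> enorm (x t0) <= L ->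
    T%:R <= hybrid lam t0 t ->
    exists a, [/\ t0 <= a, a <= t, T%:R <= hybrid lam t0 a & enorm (x a) <= l].
  move=> traj en xL Th; have [_ _ _ t0t _] := traj.
  have [a [t0a at_ Ta aT]] := hybrid_time_mid (impulsesP (Sigma lam)) t0t (ler0n _ T) Th.
  have traja := trajectory_sub traj (lexx _) t0a at_.
  have ena := le_trans (energy_sub K1 K2 traj (lexx _) at_) en.
  have [_ /(_ Ta) xa] := win _ _ _ _ _ _ traja ena xL aT.
  by exists a.
split=> [lam u x Tx t0 t traj en xL Th|].
  by have [a [? ? _ ?]] := step _ _ _ _ _ _ traj en xL Th; exists a.
(* Each full window returns x to the ball of radius l <= L and takes hybrid time at least T >= 1,
   whence the induction on N. *)
suff bnd N lam u x Tx t0 t : trajectory lam u x Tx t0 t ->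
    (energy rho1 rho2 lam u t0 t <= s%:E)%E -> enorm (x t0) <= L ->
    hybrid lam t0 t <= N%:R -> enorm (x t) <= beta L 0 + L.
  move=> lam u x Tx t0 t traj en xL.
  apply: (bnd (Num.bound (hybrid lam t0 t)) _ _ _ _ _ _ traj en xL).
  exact/ltW/unstable.ltr_bound.
elim: N lam u x Tx t0 t => [|N IH] lam u x Tx t0 t traj en xL hN.
  have [] // := win _ _ _ _ _ _ traj en xL _.
  by rewrite (le_trans hN)// addr_ge0.
have [hT|hT] := leP (hybrid lam t0 t) (T%:R + 1).
  by have [] := win _ _ _ _ _ _ traj en xL hT.
have Th : T%:R <= hybrid lam t0 t by rewrite ltW// (le_lt_trans _ hT)// lerDl.
have [a [t0a at_ Ta xa]] := step _ _ _ _ _ _ traj en xL Th.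
apply: (IH lam u x Tx a t (trajectory_sub traj t0a at_ (lexx _))).
- exact: le_trans (energy_sub K1 K2 traj t0a (lexx _)) en.
- exact: le_trans xa lL.
have h1 := hybridD lam t0a at_.
have T1 : 1 <= T%:R :> R by rewrite ler1n.
by move: hN; rewrite -natr1; lra.
Qed.

(* The window from [level k.+1] to [level k] truncates the input at the radius
   [k.+1]; [rho1] and [rho2] are large enough for an energy at most [k.+1] to make
   the discarded part negligible on that window. *)
Lemma iISS_gains : exists rho1 rho2, [/\ class_Kinfty rho1, class_Kinfty rho2,
  forall s, exists M, controlled rho1 rho2 s M &
  forall e, 0 < e -> exists2 s, 0 < s & controlled rho1 rho2 s e].
Proof.
(* The second entry is the requirement of [window] for the radius k + 1; the first makes the levels
   exhaust all radii. *)
pose level (k : nat) := Num.max k.+1%:R (4 * rho k.+1%:R).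
have level_ge k : k.+1%:R <= level k by rewrite le_max lexx.
have level_gt0 k : 0 < level k by rewrite (lt_le_trans _ (level_ge k)).
have level_le k : level k <= level k.+1.
  by rewrite ge_max !le_max !ler_nat leqnSn/= ler_pM2l// class_K_le ?ler_nat ?orbT.
have rho_level k : rho k.+1%:R <= level k / 4.
  by rewrite ler_pdivlMr// mulrC le_max lexx orbT.
have /boolp.choice[T /boolp.choice[d win]] := fun k =>
  window_reaches (level_gt0 k) (level_le k) (ler0n _ k.+1) (rho_level k).
have d0 k : 0 < d k by have [] := win k.
have a0 k : 0 <= k.+1%:R / d k by rewrite divr_ge0// ltW.
(* Beyond radius k + 1 the factor S is at least (k + 1) / d_k, so an energy of at most k + 1 leaves
   a tail of at most d_k. *)
have [S [Snc S1 Sa]] := nondecreasing_continuous_majorant a0.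
pose rho1 r := tphif r * S r; pose rho2 r := tphig r * S r.
have K1 : class_Kinfty rho1 by exact: class_Kinfty_mul.
have K2 : class_Kinfty rho2 by exact: class_Kinfty_mul.
have [K1' K2'] := (K1.1, K2.1).
have tail_level k phi r : class_K phi -> 0 <= r ->
    tail k.+1%:R phi r <= d k / k.+1%:R * (phi r * S r).
  move=> phiK r0; have phi0 := class_K_ge0 phiK r0.
  have S0 : 0 <= S r by rewrite (le_trans _ (S1 r r0)).
  rewrite /tail; have [kr|kr] := leP r k.+1%:R.
    by apply: mulr_ge0; [rewrite divr_ge0// ltW|exact: mulr_ge0].
  rewrite mulrCA ler_peMr// -ler_pdivrMl ?divr_gt0// mulr1 invf_div Sa//.
  by rewrite (lt_trans _ kr)// ltr_nat.
have tail1 c phi r : class_K phi -> 0 <= r -> tail c phi r <= 1 * (phi r * S r).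
  move=> phiK r0; have phi0 := class_K_ge0 phiK r0.
  rewrite mul1r /tail; case: ifP => _; last by rewrite ler_peMr// S1.
  by rewrite mulr_ge0// (le_trans _ (S1 r r0)).
have {}win k s : s <= k.+1%:R -> reaches rho1 rho2 (level k.+1) s (level k) (T k)%:R /\
    bounded_by rho1 rho2 (level k.+1) s (beta (level k.+1) 0 + level k.+1).
  move=> sk; have [_] := win k; move/(_ rho1 rho2 (d k / k.+1%:R) s K1' K2').
  apply.
  - by rewrite divr_ge0// ltW.
  - by rewrite mulrAC ler_pdivrMr// ler_pM2l.
  - by move=> r r0; exact: tail_level.
  - by move=> r r0; exact: tail_level.
have chain k s : s <= k.+1%:R -> forall r, exists2 T0, 0 <= T0 &
    reaches rho1 rho2 r s (level k) T0.
  move=> sk r.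
  suff [T0 T00 rch] : exists2 T0, 0 <= T0 &
      reaches rho1 rho2 (level (k + Num.bound r)%N) s (level k) T0.
    exists T0 => // lam u x Tx t0 t traj en xr.
    apply: (rch _ _ _ _ _ _ traj en); rewrite (le_trans xr)//.
    rewrite (le_trans _ (level_ge _))// ltW// (lt_le_trans (unstable.ltr_bound r))//.
    by rewrite ler_nat (leq_trans (leq_addl _ _) (leqnSn _)).
  elim: (Num.bound r) => [|j [T0 T00 IH]].
    exists 0 => // lam u x Tx t0 t [_ _ _ t0t _] _ xr _.
    by exists t0; rewrite addn0 in xr.
  exists ((T (k + j)%N)%:R + 1 + T0); first by rewrite !addr_ge0.
  apply: reaches_trans IH => //; rewrite addnS.
  have [] // := win (k + j)%N s _.
  by rewrite (le_trans sk)// ler_nat ltnS leq_addr.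
exists rho1, rho2; split => //.
- move=> s; pose k := Num.bound s.
  have sk : s <= k.+1%:R.
    by rewrite ltW// (lt_trans (unstable.ltr_bound s))// ltr_nat.
  exists (beta (level k.+1) 0 + level k.+1).
  apply: (@reaches_controlled _ _ (level k.+1)) => //.
  + by rewrite (le_trans sk)// (le_trans (level_ge k)).
  + by have [] := win k s sk.
  + by apply: chain; rewrite (le_trans sk)// ler_nat.
- move=> e e0; have e2 : 0 < e / 2 by rewrite divr_gt0.
  have [[b0K _] _] := (beta_KL.1 0 (lexx 0), tt).
  have [l0 l00 betal] := class_K_small b0K e2.
  pose l := Num.min l0 (Num.min (e / 2) (level 0)).
  have lgt0 : 0 < l by rewrite !lt_min l00 e2 level_gt0.
  have le2 : beta l 0 + l <= e.
    rewrite [e]splitr lerD//; last by rewrite !ge_min lexx orbT.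
    by apply: betal; [exact: ltW|rewrite ge_min lexx].
  have l_level : l <= level 0 by rewrite !ge_min !lexx !orbT.
  clearbody l.
  have l4 : 0 < l / 4 by rewrite divr_gt0.
  have [c c0 rhoc] := class_K_small rho_K l4.
  have {}rhoc := rhoc c (ltW c0) (lexx c).
  (* The window from l to l keeps x below beta(l, 0) + l <= e; the next one, from level 0 to l,
     completes the descent of [chain]. Since S >= 1, both tails are bounded by the energy itself. *)
  have [T1 [d1 [d10 win1]]] := window_reaches lgt0 (lexx l) (ltW c0) rhoc.
  have [T2 [d2 [d20 win2]]] := window_reaches lgt0 l_level (ltW c0) rhoc.
  pose s := Num.min (Num.min d1 d2) (Num.min l 1).
  have [sd1 sd2 sl s1] : [/\ s <= d1, s <= d2, s <= l & s <= 1].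
    rewrite /s; split; rewrite ge_min.
    - by rewrite ge_min lexx.
    - by rewrite ge_min lexx orbT.
    - by rewrite [X in _ || X]ge_min lexx orbT.
    - by rewrite [X in _ || X]ge_min lexx !orbT.
  exists s; first by rewrite !lt_min d10 d20 lgt0 ltr01.
  apply: (@reaches_controlled _ _ l) => //.
  + have [] := win1 rho1 rho2 1 s K1' K2' ler01.
    * by rewrite mul1r.
    * by move=> r r0; exact: tail1.
    * by move=> r r0; exact: tail1.
    move=> _ bnd lam u x Tx t0 t traj en xl.
    exact: le_trans (bnd _ _ _ _ _ _ traj en xl) le2.
  + move=> r; have [T0 T00 rch] := chain 0%N s s1 r.
    exists (T0 + 1 + T2%:R); first by rewrite !addr_ge0.
    apply: reaches_trans rch _ => //.
    have [] // := win2 rho1 rho2 1 s K1' K2' ler01.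
    * by rewrite mul1r.
    * by move=> r' r0; exact: tail1.
    * by move=> r' r0; exact: tail1.
Qed.

Lemma controlled_le rho1 rho2 s s' M M' : s' <= s -> M <= M' ->
  controlled rho1 rho2 s M -> controlled rho1 rho2 s' M'.
Proof.
move=> ss MM [bnd att]; split.
  move=> lam u x Tx t0 t traj en xs; rewrite (le_trans _ MM)//.
  apply: (bnd _ _ _ _ _ _ traj); last exact: le_trans ss.
  by rewrite (le_trans en)// lee_fin.
move=> r; have [T T0 rT] := att r; exists T => // lam u x Tx t0 t traj en xr Th.
rewrite (le_trans _ MM)//; apply: (rT _ _ _ _ _ _ traj _ xr Th).
by rewrite (le_trans en)// lee_fin.
Qed.

(** The supremum of [A z] is a generalized inverse of M, and a is a minorant of it taken at z / 2.
    The halving provides strictness: s < a(z) excludes a controlled state of norm z. *)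
Lemma iISS_alpha rho1 rho2 : (forall s, exists M, controlled rho1 rho2 s M) ->
  (forall e, 0 < e -> exists2 s, 0 < s & controlled rho1 rho2 s e) ->
  exists2 a, class_Kinfty a &
    forall s z, 0 < z -> s < a z -> controlled rho1 rho2 s (z / 2).
Proof.
move=> P1 P2.
(* The condition s <= z keeps the set bounded, even if every energy is controlled by z. *)
pose A z := [set s | s <= z /\ controlled rho1 rho2 s z].
have supA z : 0 < z -> exists2 s, 0 < s & A z s.
  move=> z0; have [s s0 cs] := P2 z z0; exists (Num.min s z).
    by rewrite lt_min s0 z0.
  by split; [rewrite ge_min lexx orbT|apply: controlled_le cs; rewrite ?ge_min ?lexx].
have has_supA z : 0 < z -> has_sup (A z).
  by move=> z0; split; [have [s _] := supA z z0; exists s|exists z => s []].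
have z2 (z : R) : 0 < z -> 0 < z / 2 by move=> z0; rewrite divr_gt0.
have [a aK a_le] : exists2 a, class_Kinfty a & forall z, 0 < z -> a z <= sup (A (z / 2)).
  apply: class_Kinfty_minorant => [z z0|y z y0 yz|M].
  - have [s s0 As] := supA _ (z2 z z0).
    by rewrite (lt_le_trans s0)// sup_upper_bound//; exact/has_supA/z2.
  - have yz2 : y / 2 <= z / 2 by rewrite ler_pM2r.
    apply: ge_sup; first exact: (has_supA _ (z2 y y0)).1.
    move=> s [sy cs]; apply: sup_upper_bound.
      by apply/has_supA/z2; exact: lt_le_trans yz.
    by split; [exact: le_trans yz2|exact: controlled_le cs].
  - have [B cB] := P1 (`|M| + 1).
    have M1 : 0 < `|M| + 1 by rewrite ltr_wpDl.
    pose z := Num.max B (`|M| + 1).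
    have z0 : 0 < z by rewrite lt_max M1 orbT.
    exists (z * 2); first by rewrite mulr_gt0.
    rewrite mulfK// (lt_le_trans (_ : _ < `|M| + 1))//.
      by rewrite (le_lt_trans (ler_norm M))// ltrDl.
    apply: sup_upper_bound; first exact: has_supA.
    by split; [rewrite le_max lexx orbT|apply: controlled_le cB; rewrite // le_max lexx].
exists a => // s z z0 sa.
have /sup_gt[|s' [_ cs'] ss'] := lt_le_trans sa (a_le z z0).
  exact: (has_supA _ (z2 z z0)).1.
exact: controlled_le (ltW ss') (lexx _) cs'.
Qed.

Lemma strong_ISS_strong_iISS : strongly_iISS Sigma.
Proof.
have [rho1 [rho2 [K1 K2 P1 P2]]] := iISS_gains.
have [a aK ctrl] := iISS_alpha P1 P2.
have aK' := aK.1.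
(* Otherwise s would be controlled by |x(t)| / 2, giving |x(t)| <= |x(t)| / 2 for a nonzero
   state. *)
have a_le lam u x Tx t0 t s : trajectory lam u x Tx t0 t ->
    (energy rho1 rho2 lam u t0 t <= s%:E)%E -> enorm (x t0) <= s ->
    a (enorm (x t)) <= s.
  move=> traj en xs; rewrite leNgt; apply/negP => sa.
  have x0 : 0 < enorm (x t).
    rewrite lt_neqAle enorm_ge0 andbT; apply/eqP => x0.
    move: sa; rewrite -x0 (class_K0 aK') ltNge (le_trans _ xs)//.
    exact: enorm_ge0.
  have [bnd _] := ctrl s _ x0 sa.
  have := bnd _ _ _ _ _ _ traj en xs.
  by rewrite leNgt ltr_pdivrMr// ltr_pMr// ltr1n.
have a_lim r s : 0 < s -> exists2 T, 0 <= T &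
    forall lam u x Tx t0 t, trajectory lam u x Tx t0 t ->
    (energy rho1 rho2 lam u t0 t <= s%:E)%E -> enorm (x t0) <= r ->
    T <= hybrid lam t0 t -> a (enorm (x t)) <= s.
  move=> s0; have [d d0 ad] := class_K_small aK' s0.
  pose Z := [set z | 0 <= z /\ s < a z].
  have Zd z : Z z -> d < z.
    by move=> [z0 saz]; rewrite ltNge; apply/negP => /(ad _ z0); rewrite leNgt saz.
  have infZ : has_inf Z.
    split; last by exists d => z /Zd/ltW.
    by have [z z0 saz] := aK.2 s; exists z.
  have i0 : 0 < inf Z.
    by apply: lt_le_trans d0 _; apply: lb_le_inf infZ.1 _ => z /Zd/ltW.
  (* z is less than twice the infimum of Z, so z / 2 is outside Z and a(z / 2) <= s, while s < a(z)
     makes z / 2 an eventual bound. *)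
  have [z [z0 saz] zi] := inf_adherent i0 infZ.
  have zgt0 : 0 < z := lt_trans d0 (Zd z (conj z0 saz)).
  have az2 : a (z / 2) <= s.
    rewrite leNgt; apply/negP => saz2.
    have := ge_inf infZ.2 (conj (divr_ge0 z0 (ler0n _ 2)) saz2 : Z (z / 2)).
    by rewrite leNgt ltr_pdivrMr// mulr_natr mulr2n zi.
  have [_ /(_ r)[T T0 rT]] := ctrl s z zgt0 saz.
  exists T => // lam u x Tx t0 t traj en xr Th.
  rewrite (le_trans _ az2)// (class_K_le aK') ?enorm_ge0//.
  exact: (rT _ _ _ _ _ _ traj en xr Th).
(* Excess of alpha(|x|) over the energy after hybrid time h. The element 0 makes the supremum exist
   and be nonnegative even when no trajectory qualifies. *)
pose D r h := [set w | w = 0 \/ exists lam u x Tx t0 t e,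
  [/\ trajectory lam u x Tx t0 t, (energy rho1 rho2 lam u t0 t <= e%:E)%E, 0 <= e,
      enorm (x t0) <= r & h <= hybrid lam t0 t /\ w = a (enorm (x t)) - e]].
have ubD r h : 0 <= r -> ubound (D r h) r.
  move=> r0 _ [->//|[lam [u [x [Tx [t0 [t [e [traj en e0 xr [_ ->]]]]]]]]]].
  have [re|er] := leP r e.
    rewrite (le_trans _ r0)// subr_le0; apply: a_le traj en _.
    exact: le_trans re.
  rewrite (le_trans (_ : _ <= a (enorm (x t))))// ?lerBlDr ?lerDl//.
  by apply: a_le traj _ xr; rewrite (le_trans en)// lee_fin ltW.
have supD r h : 0 <= r -> has_sup (D r h).
  by move=> r0; split; [exists 0; left|exists r; exact: ubD].
have D_sub r h w B : 0 <= r -> sup (D r h) <= B -> D r h w -> w <= B.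
  by move=> r0 DB Dw; rewrite (le_trans _ DB)// sup_upper_bound//; exact: supD.
have D_le r h B : 0 <= r -> (forall w, D r h w -> w <= B) -> sup (D r h) <= B.
  by move=> r0 DB; apply: ge_sup (supD r h r0).1 _ => w; exact: DB.
have [||||b bKL Db] := class_KL_majorant (psi := fun r h => sup (D r h)).
- move=> r h r0 _; rewrite D_le//; last by move=> w; exact: ubD.
  by rewrite andbT (D_sub r h)//; left.
- move=> r s h r0 rs _; have s0 := le_trans r0 rs.
  apply: D_le => // w Dw; apply: (D_sub s h) => //.
  case: Dw => [->|[lam [u [x [Tx [t0 [t [e [traj en e0 xr Hh]]]]]]]]]; first by left.
  by right; exists lam, u, x, Tx, t0, t, e; split => //; exact: le_trans rs.
- move=> r s h r0 s0 sh; apply: D_le => // w Dw; apply: (D_sub r s) => //.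
  case: Dw => [->|[lam [u [x [Tx [t0 [t [e [traj en e0 xr [hh we]]]]]]]]]]; first by left.
  right; exists lam, u, x, Tx, t0, t, e; split => //; split => //.
  exact: le_trans hh.
- move=> r eps r0 eps0.
  (* The time in [a_lim] depends on the energy bound. Rounding energies up to multiples of eps
     leaves finitely many bounds; once the energy reaches r, [a_le] needs no waiting. *)
  have grid (N : nat) : exists2 T, 0 <= T &
      forall lam u x Tx t0 t e, trajectory lam u x Tx t0 t ->
      (energy rho1 rho2 lam u t0 t <= e%:E)%E -> 0 <= e -> e < N%:R * eps ->
      enorm (x t0) <= r -> T <= hybrid lam t0 t -> a (enorm (x t)) <= e + eps.
    elim: N => [|N [T T0 IH]].
      by exists 0 => // lam u x Tx t0 t e _ _ e0; rewrite mul0r ltNge e0.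
    have Ne0 : 0 < N.+1%:R * eps by rewrite mulr_gt0.
    have [T' T'0 limT'] := a_lim r _ Ne0.
    exists (Num.max T T'); first by rewrite le_max T0.
    move=> lam u x Tx t0 t e traj en e0 eN xr; rewrite ge_max => /andP[Th T'h].
    have [eN'|Ne] := ltP e (N%:R * eps); first exact: IH traj en e0 eN' xr Th.
    rewrite (le_trans (_ : _ <= N.+1%:R * eps))//.
      by apply: limT' traj _ xr T'h; rewrite (le_trans en)// lee_fin ltW.
    by rewrite -natr1 mulrDl mul1r lerD2r.
  have [T T0 HT] := grid (Num.bound (r / eps)).
  exists T => //; apply: D_le => // w.
  move=> [->|[lam [u [x [Tx [t0 [t [e [traj en e0 xr [Th ->]]]]]]]]]]; first exact: ltW.
  rewrite lerBlDl; have [eN|Ne] := ltP e ((Num.bound (r / eps))%:R * eps).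
    exact: HT traj en e0 eN xr Th.
  rewrite (le_trans (_ : _ <= e)) ?lerDl ?(ltW eps0)//; apply: a_le traj en _.
  rewrite (le_trans xr)// (le_trans _ Ne)// -ler_pdivrMr// ltW//.
  exact: unstable.ltr_bound.
exists b, a, rho1, rho2; split => // lam t0 x0 u x Tx t t00 iu [solx _] [t0t tT] /=.
have [_ xt0 _ _] := solx.
have traj : trajectory lam u x Tx t0 t by split => //; rewrite xt0.
have := input_int_norm_ge0 u `]t0, t]%classic (impulses (Sigma lam)) K1.1 K2.1.
(* An infinite energy makes the estimate trivial. *)
case en : (input_int_norm _ _ _ _ _) => [e||] //; last by rewrite addey// => _; exact: leey.
rewrite lee_fin => e0; rewrite -EFinD lee_fin -lerBlDr.
rewrite (le_trans _ (Db _ _ (enorm_ge0 _) _))//; last by rewrite addr_ge0// subr_ge0.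
rewrite (D_sub _ _ _ _ (enorm_ge0 x0) (lexx _))//; right.
by exists lam, u, x, Tx, t0, t, e; split => //; rewrite ?en ?xt0.
Qed.

End iss.

Theorem theorem4p1 (R : realType) (n m : nat) (Lambda : Type)
    (Lambda_nonempty : inhabited Lambda)
    (Sigma : Lambda -> @impulsive_system R n m)
    (ISS : strongly_ISS Sigma)
    (tphif tphig etaf etag phif phig : R -> R)
    (Nf Ng Of Og Pf Pg : R -> R)
    (tphif_Kinfty : class_Kinfty tphif) (tphig_Kinfty : class_Kinfty tphig)
    (etaf_Kinfty : class_Kinfty etaf) (etag_Kinfty : class_Kinfty etag)
    (phif_Kinfty : class_Kinfty phif) (phig_Kinfty : class_Kinfty phig)
    (Nf_nc : nondecreasing_continuous Nf) (Ng_nc : nondecreasing_continuous Ng)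
    (Of_nc : nondecreasing_continuous Of) (Og_nc : nondecreasing_continuous Og)
    (Pf_nc : nondecreasing_continuous Pf) (Pg_nc : nondecreasing_continuous Pg)
    (flow_input : forall (lam : Lambda) (t : R) (xi : 'rV[R]_n)
        (mu1 mu2 : 'rV[R]_m), 0 <= t ->
      enorm (flow (Sigma lam) t xi mu1 - flow (Sigma lam) t xi mu2) <=
        tphif (enorm (mu1 - mu2)) *
          (Nf (enorm xi) + Of (Num.min (enorm mu1) (enorm mu2))))
    (flow_state : forall (lam : Lambda) (t : R) (xi1 xi2 : 'rV[R]_n)
        (mu : 'rV[R]_m), 0 <= t ->
      enorm (flow (Sigma lam) t xi1 mu - flow (Sigma lam) t xi2 mu) <=
        etaf (enorm (xi1 - xi2)) *
          (Pf (Num.min (enorm xi1) (enorm xi2)) + phif (enorm mu)))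
    (jump_input : forall (lam : Lambda) (t : R) (xi : 'rV[R]_n)
        (mu1 mu2 : 'rV[R]_m), 0 <= t ->
      enorm (jump (Sigma lam) t xi mu1 - jump (Sigma lam) t xi mu2) <=
        tphig (enorm (mu1 - mu2)) *
          (Ng (enorm xi) + Og (Num.min (enorm mu1) (enorm mu2))))
    (jump_state : forall (lam : Lambda) (t : R) (xi1 xi2 : 'rV[R]_n)
        (mu : 'rV[R]_m), 0 <= t ->
      enorm (jump (Sigma lam) t xi1 mu - jump (Sigma lam) t xi2 mu) <=
        etag (enorm (xi1 - xi2)) *
          (Pg (Num.min (enorm xi1) (enorm xi2)) + phig (enorm mu)))
    (Lf : R -> R)
    (Lf_nc : nondecreasing_continuous Lf)
    (Lf_gt0 : forall M : R, 0 < M -> 0 < Lf M)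
    (etaf_Lf : forall M s : R, 0 <= M -> 0 <= s -> s <= M ->
      etaf s <= Lf M * s) :
  strongly_iISS Sigma.
Proof.
have [beta [rho [beta_KL rho_Kinfty iss]]] := ISS.
exact: (strong_ISS_strong_iISS tphif_Kinfty tphig_Kinfty etaf_Kinfty etag_Kinfty phif_Kinfty
  phig_Kinfty Nf_nc Ng_nc Of_nc Og_nc Pf_nc Pg_nc flow_input flow_state jump_input
  jump_state Lf_nc etaf_Lf beta_KL rho_Kinfty iss).
Qed.
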